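(* Let $p \geq 1$ and let $\boldsymbol X = (X_1,X_2,\ldots,X_p)$ be an $\mathbb{R}^p$-valued infinitely divisible random vector with characteristic function $$\phi(\boldsymbol t)= \exp \left\{ \mathrm{i} \langle \boldsymbol a, \boldsymbol t\rangle -\frac{1}{2}Q(\boldsymbol t) + \int_{\mathbb{R}^p} \left(\mathrm{e}^{\mathrm{i} \langle \boldsymbol t,\boldsymbol x\rangle} -1 - \frac{\mathrm{i} \langle \boldsymbol t,\boldsymbol x\rangle}{1+\|\boldsymbol x\|^2}\right)d\nu(\boldsymbol x) \right\}, \quad \boldsymbol t \in \mathbb{R}^p,$$ where $\boldsymbol a \in \mathbb{R}^p$, $Q$ is a nonnegative definite quadratic form on $\mathbb{R}^p$, and $\nu$ is the L\'evy measure. Let $\tau \in (0,\infty)$ and let $\nu_1(\cdot) = \nu(\{\boldsymbol x \in \mathbb{R}^p : \|\boldsymbol x\| \geq \tau\} \cap \cdot)$. Let $\beta_r \in [0,\infty)$, $r=1,2,\ldots,p$. Then $$\mathbb{E} \left( \prod_{r=1}^{p} |X_r|^{\alpha_r} \right) < \infty \quad \text{for all } \alpha_r \in [0, \beta_r],\ r=1,2,\ldots,p,$$ if and only if $$\int_{\mathbb{R}^p} \left( \prod_{r=1}^{p} |x_r|^{\alpha_r}\right)d\nu_1(\boldsymbol x) < \infty \quad \text{for all } \alpha_r \in [0, \beta_r],\ r=1,2,\ldots,p,$$ where $\boldsymbol x = (x_1,x_2,\ldots,x_p)$.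
   Context: A random vector is infinitely divisible if for every positive integer $n$ its distribution is the $n$-fold convolution of some probability distribution on $\mathbb{R}^p$. Its characteristic function then has the displayed L\'evy representation, in which the L\'evy measure $\nu$ is a measure on the Borel $\sigma$-field of $\mathbb{R}^p$ with $\nu(\{\boldsymbol 0\})=0$ and $\int_{\mathbb{R}^p} \frac{\|\boldsymbol x\|^2}{1+\|\boldsymbol x\|^2}\,d\nu(\boldsymbol x) < \infty$. Here $\langle\cdot,\cdot\rangle$ and $\|\cdot\|$ denote the usual inner product and norm on $\mathbb{R}^p$. Consequently $\nu_1$ is a finite measure. Convention: $|y|^0 = 1$ for all real $y$, including $y=0$. *)

(* Defs.v *)
From HB Require Import structures.
From mathcomp Require Import all_boot all_order all_algebra.
From mathcomp Require Import complex.
From mathcomp Require Import all_classical all_reals all_analysis.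
From mathcomp Require Import measurable_realfun.
Import Order.TTheory GRing.Theory Num.Theory.
Import numFieldNormedType.Exports.

Set Implicit Arguments.
Unset Strict Implicit.
Unset Printing Implicit Defensive.

Local Open Scope classical_set_scope.
Local Open Scope ring_scope.

Section borel_rV.
Context {R : realType} {p : nat}.

Let borel : set (set 'rV[R]_p) := <<s @open 'rV[R]_p >>.

Let borel_set0 : borel set0. Proof. exact: sigma_algebra0. Qed.

Let borel_setC (A : set 'rV[R]_p) : borel A -> borel (~` A).
Proof. by move=> sA; rewrite -setTD; exact: sigma_algebraCD. Qed.

Let borel_bigcup (F : (set 'rV[R]_p)^nat) :
  (forall i, borel (F i)) -> borel (\bigcup_i F i).
Proof. exact: sigma_algebra_bigcup. Qed.

(* The topology of 'rV[R]_p is that of the sup norm, i.e. the usual one. *)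
HB.instance Definition _ := @isMeasurable.Build (sigma_display (@open 'rV[R]_p))
  'rV[R]_p borel borel_set0 borel_setC borel_bigcup.

Lemma open_measurable_rV (A : set 'rV[R]_p) : open A -> measurable A.
Proof. exact: sub_sigma_algebra. Qed.

Lemma measurable_coord (i : 'I_p) :
  measurable_fun setT (fun x : 'rV[R]_p => x ord0 i).
Proof.
apply: (measurability _ (RGenOInfty.measurableE R)) => _ [_ [r ->] <-].
rewrite setTI; apply: open_measurable_rV; apply: open_comp.
  by move=> x _; exact: coord_continuous.
exact: interval_open.
Qed.

Let box (cr : 'rV[rat]_p * rat) : set 'rV[R]_p :=
  [set x | forall i, `|ratr (cr.1 ord0 i) - x ord0 i| < ratr cr.2].

Let open_box (U : set 'rV[R]_p) : open U ->
  U = \bigcup_(cr in [set cr | box cr `<=` U]) box cr.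
Proof.
move=> oU; apply/seteqP; split=> [x Ux|x [cr /= crU]]; last exact: crU.
have /nbhs_ballP[e /= e0 xU] : nbhs x U by exact: open_nbhs_nbhs.
have /rat_in_itvoo[r] : 0 < e / 2 by rewrite divr_gt0.
rewrite in_itv/= => /andP[r0 re].
have cP i : exists q : rat, `|ratr q - x ord0 i| < ratr r.
  have /rat_in_itvoo[q] : x ord0 i - ratr r < x ord0 i + ratr r.
    by rewrite ltrD2l gtrN.
  by rewrite in_itv/= => qr; exists q; rewrite ltr_distl.
exists (\row_i sval (cid (cP i)), r) => /= [y|] yr; last first.
  by rewrite mxE; case: cid.
apply: xU; split=> // i j; rewrite (ord1 i) /ball/=.
rewrite (splitr e); have := yr j; rewrite /= mxE; case: cid => q /= qx qy.
rewrite (le_lt_trans (ler_distD (ratr q) _ _))// ltrD//.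
  by rewrite distrC (lt_trans qx).
by rewrite (lt_trans qy).
Qed.

Lemma measurable_fun_rV d (T : measurableType d) (f : T -> 'rV[R]_p) :
  (forall i, measurable_fun setT (fun t => f t ord0 i)) ->
  measurable_fun setT f.
Proof.
move=> mf; apply: (@measurability _ _ _ _ _ _ (@open 'rV[R]_p)) => //.
move=> _ [U oU <-]; rewrite setTI (open_box oU) preimage_bigcup.
rewrite bigcup_mkcond; apply: countable_bigcupT_measurable => // cr.
case: ifP => // _.
rewrite (_ : _ @^-1` _ = \bigcap_(i : 'I_p) ((fun t => f t ord0 i) @^-1`
    ball (ratr (cr.1 ord0 i) : R) (ratr cr.2))); last first.
  by apply/seteqP; split=> t /= h i; have := h i; [move=> + _|exact].
apply: fin_bigcap_measurable => // i _; rewrite -[X in measurable X]setTI.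
by apply: mf => //; exact: measurable_ball.
Qed.

End borel_rV.

Section euclidean.
Context {R : realType} {p : nat}.
Implicit Types x y : 'rV[R]_p.

Definition dotp x y : R := \sum_(i < p) x ord0 i * y ord0 i.

(* The library norm `|x| on 'rV[R]_p is the sup norm. *)
Definition enorm x : R := Num.sqrt (dotp x x).

(* A need not be symmetric: Q only depends on its symmetric part. *)
Definition nonneg_quadratic_form (Q : 'rV[R]_p -> R) : Prop :=
  (exists A : 'M[R]_p, forall t,
    Q t = \sum_(i < p) \sum_(j < p) A i j * t ord0 i * t ord0 j) /\
  (forall t, 0 <= Q t).

Lemma measurable_enorm : measurable_fun setT enorm.
Proof.
rewrite (_ : enorm = @Num.sqrt R \o (fun x => dotp x x))//.
apply: measurableT_comp => /=.
  by apply: continuous_measurable_fun => x; exact: sqrt_continuous.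
by apply: measurable_sum => i; apply: measurable_funM; exact: measurable_coord.
Qed.

Lemma measurable_enorm_ge (tau : R) : measurable [set x | tau <= enorm x].
Proof.
rewrite -[X in measurable X]setTI (_ : mkset _ = enorm @^-1` `[tau, +oo[).
  exact: measurable_enorm.
by apply/seteqP; split=> x /=; rewrite in_itv/= andbT.
Qed.

Definition add_rV (xy : 'rV[R]_p * 'rV[R]_p) : 'rV[R]_p := xy.1 + xy.2.

Lemma measurable_add_rV : measurable_fun setT add_rV.
Proof.
apply: measurable_fun_rV => i; rewrite /add_rV; under eq_fun do rewrite mxE.
apply: measurable_funD.
  exact: (measurableT_comp (measurable_coord i) measurable_fst).
exact: (measurableT_comp (measurable_coord i) measurable_snd).
Qed.

HB.instance Definition _ :=
  isMeasurableFun.Build _ _ _ _ add_rV measurable_add_rV.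

End euclidean.

Section infinite_divisibility.
Context {R : realType} {p : nat}.

Definition convolution (mu nu : probability 'rV[R]_p R) :
    probability 'rV[R]_p R :=
  distribution (mu \x nu)%E add_rV.

Fixpoint convolution_pow (mu : probability 'rV[R]_p R) (n : nat) :
    probability 'rV[R]_p R :=
  if n is m.+1 then convolution mu (convolution_pow mu m)
  else dirac (0 : 'rV[R]_p).

Definition infinitely_divisible (mu : probability 'rV[R]_p R) : Prop :=
  forall n, (0 < n)%N -> exists mu_n : probability 'rV[R]_p R,
    forall A, measurable A -> mu A = convolution_pow mu_n n A.

Definition levy_measure (nu : {measure set 'rV[R]_p -> \bar R}) : Prop :=
  nu [set 0] = 0%E /\
  (\int[nu]_x (enorm x ^+ 2 / (1 + enorm x ^+ 2))%:E < +oo)%E.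

Definition levy_restr (nu : {measure set 'rV[R]_p -> \bar R}) (tau : R) :
    {measure set 'rV[R]_p -> \bar R} :=
  mrestr nu (measurable_enorm_ge tau).

End infinite_divisibility.

Section characteristic_function.
Local Open Scope complex_scope.
Context {R : realType}.

Definition cexp (z : R[i]) : R[i] :=
  (expR (complex.Re z))%:C * (cos (complex.Im z) +i* sin (complex.Im z)).

Definition cintegral d (T : measurableType d) (mu : {measure set T -> \bar R})
    (f : T -> R[i]) : R[i] :=
  (\int[mu]_x complex.Re (f x))%R +i* (\int[mu]_x complex.Im (f x))%R.

Definition char_fun d (T : measurableType d) (P : probability T R) (p : nat)
    (X : T -> 'rV[R]_p) (t : 'rV[R]_p) : R[i] :=
  cintegral P (fun w => cexp ('i%C * (dotp t (X w))%:C)).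

Definition levy_khintchine (p : nat) (a : 'rV[R]_p) (Q : 'rV[R]_p -> R)
    (nu : {measure set 'rV[R]_p -> \bar R}) (t : 'rV[R]_p) : R[i] :=
  cexp ('i%C * (dotp a t)%:C - (2^-1 * Q t)%:C +
    cintegral nu (fun x => cexp ('i%C * (dotp t x)%:C) - 1 -
                           'i%C * (dotp t x)%:C / (1 + enorm x ^+ 2)%:C)).

End characteristic_function.

(* Main.v *)
From HB Require Import structures.
Require Import Defs.
From mathcomp Require Import all_boot all_order all_algebra.
From mathcomp Require Import complex.
From mathcomp Require Import all_classical all_reals all_analysis.
From mathcomp Require Import measurable_realfun ring lra.
Import Order.TTheory GRing.Theory Num.Theory.
Import numFieldNormedType.Exports.

Set Implicit Arguments.
Unset Strict Implicit.
Unset Printing Implicit Defensive.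

Local Open Scope classical_set_scope.
Local Open Scope ring_scope.

(* The law of [X] is a weak limit of convolutions [A n * B n] of laws of random
   walks: [A n] carries the drift, the Gaussian part and the jumps of norm
   below [tau], and its polynomial moments are bounded uniformly in [n] (a
   Lyapunov estimate for one step); [B n] carries the jumps of norm at least
   [tau]. Over the box of exponents, the moment conditions amount to
   integrability of the single weight [w x = \prod_r (1 + (x_r) ^+ 2) `^
   (beta_r / 2)], which satisfies [w (x + y) <= K * w x * w y]. The event of
   exactly one large jump bounds the integral of [w] against [B n] below by a
   multiple of its integral against the tail of the Levy measure;
   submultiplicativity, applied step by step, bounds it above by an exponential
   of that integral. Both bounds pass to [A n * B n], since [w] varies at most
   polynomially under translation, and then to the limit, where convergence is
   tested on bounded truncations of [w]: these are Lipschitz functions of the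
   [1 / (1 + m * (x_r) ^+ 2)], themselves mixtures of cosines, so Bernstein
   polynomials reduce everything to characteristic functions. *)

(** Weak convergence does not carry unbounded moments to the limit, so every estimate has to be
    uniform both along the walks and in the truncation of the weight. This decides the form of
    [vtrunc]: its Peetre inequality has one constant for all [m] in [[0, 1]], so the limit can be
    taken at fixed [m > 0] and [m] sent to 0 afterwards. Walks stand in for Gaussian and compound
    Poisson laws: a step is an explicit mixture of Dirac masses and of [nu] restricted to a set of
    finite measure, so its moments can be read off, and a Gaussian direction is imitated by a
    symmetric pair of small frequent jumps. Small jumps may have infinite total intensity, hence
    their walk is controlled through its first two moments; large jumps have finite intensity but
    possibly no moments, hence they are counted. Quantifying over a whole box of exponents makes a
    single weight available: it is dominated by the moments at the vertices, where each exponent is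
    0 or [beta_r]. *)

Section bounded_measurable.
Context {R : realType} d (T : measurableType d).
Implicit Types (f g : T -> R) (P : probability T R).

Definition bounded_mfun f : Prop :=
  measurable_fun setT f /\ exists C : R, forall x, `|f x| <= C.

Lemma bounded_mfun_cst r : bounded_mfun (fun=> r).
Proof. by split; [exact: measurable_cst|exists `|r|]. Qed.

Lemma bounded_mfunD f g : bounded_mfun f -> bounded_mfun g ->
  bounded_mfun (fun x => f x + g x).
Proof.
move=> [mf [A fA]] [mg [B gB]]; split; first exact: measurable_funD.
by exists (A + B) => x; rewrite (le_trans (ler_normD _ _))// lerD.
Qed.

Lemma bounded_mfunM f g : bounded_mfun f -> bounded_mfun g ->
  bounded_mfun (fun x => f x * g x).
Proof.
move=> [mf [A fA]] [mg [B gB]]; split; first exact: measurable_funM.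
by exists (A * B) => x; rewrite normrM ler_pM.
Qed.

Lemma bounded_mfunZ r f : bounded_mfun f -> bounded_mfun (fun x => r * f x).
Proof. by move=> bf; apply: bounded_mfunM => //; exact: bounded_mfun_cst. Qed.

Lemma bounded_mfun_cos f : measurable_fun setT f ->
  bounded_mfun (fun x => cos (f x)).
Proof.
move=> mf; split; last by exists 1 => x; exact: cos_max.
by apply: measurableT_comp => //;
  exact: (continuous_measurable_fun (@continuous_cos R)).
Qed.

Lemma bounded_mfun_sin f : measurable_fun setT f ->
  bounded_mfun (fun x => sin (f x)).
Proof.
move=> mf; split; last by exists 1 => x; exact: sin_max.
by apply: measurableT_comp => //;
  exact: (continuous_measurable_fun (@continuous_sin R)).
Qed.

Lemma bounded_mfun_integrable (mu : {finite_measure set T -> \bar R}) f :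
  bounded_mfun f -> mu.-integrable setT (EFin \o f).
Proof.
move=> [mf [C fC]]; apply: measurable_bounded_integrable => //.
  by rewrite ltey_eq fin_num_measure.
by exists C; split; [exact: num_real|move=> A CA x _;
  exact/(le_trans (fC x))/ltW].
Qed.

Lemma le_norm_expectation P f (C : R) : bounded_mfun f ->
  (forall x, `|f x| <= C) ->
  `|\int[P]_x f x| <= C.
Proof.
move=> bf fC.
rewrite (le_trans (le_normr_Rintegral _ (bounded_mfun_integrable P bf)))//.
rewrite -[leRHS](_ : \int[P]_x C = C); last first.
  by rewrite Rintegral_cst//; have /= -> := probability_setT P; rewrite mulr1.
apply: le_Rintegral => //.
  have [mf [D fD]] := bf; apply: (bounded_mfun_integrable P); split.
    exact: measurableT_comp.
  by exists D => x; rewrite normr_id.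
exact/(bounded_mfun_integrable P)/bounded_mfun_cst.
Qed.

Lemma RintegralZl_bounded P r f : bounded_mfun f ->
  \int[P]_x (r * f x) = r * \int[P]_x f x.
Proof. by move=> bf; rewrite RintegralZl//; exact: bounded_mfun_integrable. Qed.

Lemma RintegralD_bounded P f g : bounded_mfun f -> bounded_mfun g ->
  \int[P]_x (f x + g x) = \int[P]_x f x + \int[P]_x g x.
Proof. by move=> bf bg; rewrite RintegralD//;
  exact: bounded_mfun_integrable. Qed.

Lemma EFin_Rintegral_bounded P f : bounded_mfun f ->
  (\int[P]_x f x)%:E = (\int[P]_x (f x)%:E)%E.
Proof.
move=> bf; rewrite /Rintegral fineK//.
exact/integrable_fin_num/bounded_mfun_integrable.
Qed.

End bounded_measurable.

(** * Fubini for bounded functions *)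

Section bounded_fubini.
Context {R : realType} d1 d2 (T1 : measurableType d1) (T2 : measurableType d2).
Variables (P1 : probability T1 R) (P2 : probability T2 R) (f : T1 * T2 -> R).
Hypothesis bf : bounded_mfun f.

Lemma bounded_mfun_integrable_prod :
  (P1 \x P2)%E.-integrable setT (EFin \o f).
Proof. exact: (bounded_mfun_integrable (P1 \x P2 : probability _ _)%E bf). Qed.

Lemma bounded_mfun_pair1 x : bounded_mfun (fun y => f (x, y)).
Proof.
have [mf [C fC]] := bf; split; last by exists C.
exact: measurableT_comp.
Qed.

Lemma bounded_mfun_pair2 y : bounded_mfun (fun x => f (x, y)).
Proof.
have [mf [C fC]] := bf; split; last by exists C.
exact: measurableT_comp.
Qed.

Lemma bounded_mfun_Rintegral2 : bounded_mfun (fun x => \int[P2]_y f (x, y)).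
Proof.
split.
  apply/measurable_EFinP.
  rewrite (_ : _ \o _ = fubini_F P2 (EFin \o f)).
    exact: measurable_fubini_F bounded_mfun_integrable_prod.
  apply/funext => x /=; rewrite EFin_Rintegral_bounded//.
  exact: bounded_mfun_pair1.
have [_ [C fC]] := bf; exists C => x.
apply: le_norm_expectation => //.
exact: bounded_mfun_pair1.
Qed.

Lemma bounded_mfun_Rintegral1 : bounded_mfun (fun y => \int[P1]_x f (x, y)).
Proof.
split.
  apply/measurable_EFinP.
  rewrite (_ : _ \o _ = fubini_G P1 (EFin \o f)).
    exact: measurable_fubini_G bounded_mfun_integrable_prod.
  apply/funext => x /=; rewrite EFin_Rintegral_bounded//.
  exact: bounded_mfun_pair2.
have [_ [C fC]] := bf; exists C => x.
apply: le_norm_expectation => //.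
exact: bounded_mfun_pair2.
Qed.

Lemma Rintegral_prod_bounded :
  \int[(P1 \x P2)%E]_z f z = \int[P1]_x \int[P2]_y f (x, y).
Proof.
rewrite /Rintegral -integral12_prod_meas1;
  last exact: bounded_mfun_integrable_prod.
congr fine; apply: eq_integral => x _.
by rewrite EFin_Rintegral_bounded//; exact: bounded_mfun_pair1.
Qed.

Lemma Rintegral_fubini_bounded :
  \int[P1]_x \int[P2]_y f (x, y) = \int[P2]_y \int[P1]_x f (x, y).
Proof.
rewrite -Rintegral_prod_bounded /Rintegral -integral21_prod_meas1; last first.
  exact: bounded_mfun_integrable_prod.
congr fine; apply: eq_integral => x _.
by rewrite EFin_Rintegral_bounded//; exact: bounded_mfun_pair2.
Qed.

End bounded_fubini.

(** * The Euclidean scalar product *)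

Section dot_product.
Context {R : realType} {p : nat}.
Implicit Types x y t : 'rV[R]_p.

Lemma dotpDl x y t : dotp (x + y) t = dotp x t + dotp y t.
Proof. by rewrite /dotp -big_split/=; apply: eq_bigr => i _;
  rewrite mxE mulrDl. Qed.

Lemma dotpZl r x t : dotp (r *: x) t = r * dotp x t.
Proof. by rewrite /dotp mulr_sumr; apply: eq_bigr => i _;
  rewrite mxE mulrA. Qed.

Lemma dotpC x y : dotp x y = dotp y x.
Proof. by apply: eq_bigr => i _; rewrite mulrC. Qed.

Lemma dotpDr t x y : dotp t (x + y) = dotp t x + dotp t y.
Proof. by rewrite !(dotpC t) dotpDl. Qed.

Lemma dotpZr r t x : dotp t (r *: x) = r * dotp t x.
Proof. by rewrite !(dotpC t) dotpZl. Qed.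

Lemma dotpNr t x : dotp t (- x) = - dotp t x.
Proof. by rewrite -scaleN1r dotpZr mulN1r. Qed.

Lemma dotpNl t x : dotp (- t) x = - dotp t x.
Proof. by rewrite dotpC dotpNr dotpC. Qed.

Lemma dotp0r t : dotp t 0 = 0.
Proof. by rewrite -(scale0r 0) dotpZr mul0r. Qed.

Lemma dotp_delta i x : dotp (delta_mx ord0 i) x = x ord0 i.
Proof.
rewrite /dotp (bigD1 i)//= mxE !eqxx mul1r big1 ?addr0// => j ji.
by rewrite mxE (negbTE ji) andbF mul0r.
Qed.

Lemma dotp_ge0 x : 0 <= dotp x x.
Proof. by apply: sumr_ge0 => i _; rewrite -expr2 sqr_ge0. Qed.

Lemma measurable_dotp t : measurable_fun setT (dotp t).
Proof.
apply: measurable_sum => i; apply: measurable_funM;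
  last exact: measurable_coord.
exact: measurable_cst.
Qed.

Lemma measurable_dotp_diag : measurable_fun setT (fun x : 'rV[R]_p => dotp x x).
Proof.
by apply: measurable_sum => i; apply: measurable_funM; exact: measurable_coord.
Qed.

End dot_product.

Lemma Rintegral_bounded_cvg {R : realType} d (T : measurableType d)
    (P : probability T R) (f_ : nat -> T -> R) (f : T -> R) (C : R) :
  (forall n, measurable_fun setT (f_ n)) -> measurable_fun setT f ->
  (forall n x, `|f_ n x| <= C) ->
  (forall x, f_ n x @[n --> \oo] --> f x) ->
  \int[P]_x f_ n x @[n --> \oo] --> \int[P]_x f x.
Proof.
move=> mf_ mf fC cf.
have [|||||_ _] := @dominated_convergence _ _ _ P setT measurableT
  (fun n x => (f_ n x)%:E) (EFin \o f) (cst C%:E).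
- by move=> n; exact/measurable_EFinP.
- exact/measurable_EFinP.
- by apply/aeW => x _; apply: cvg_EFin; [exact: nearW|exact: cf].
- exact/(bounded_mfun_integrable P)/bounded_mfun_cst.
- by apply/aeW => x n _; rewrite lee_fin.
have bf : bounded_mfun f.
  split=> //; exists C => x.
  have /(@cvg_lim _)<- // : `|f_ n x| @[n --> \oo] -->
    `|f x| by exact: cvg_norm.
  apply: limr_le; first by apply/cvg_ex; eexists; apply: cvg_norm; exact: cf.
  by near=> n.
rewrite -(EFin_Rintegral_bounded P bf) => /fine_cvgP[_].
exact.
Unshelve. all: by end_near. Qed.

(** * Functions whose integrals converge along with characteristic functions *)

Section trigonometric_convergence.
Context {R : realType} {p : nat}.
Local Notation V := 'rV[R]_p.
Variables (L : nat -> probability V R) (mu : probability V R).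
Implicit Types f w : V -> R.

(** Testing [f] against all frequencies, and not only against 1, is what makes the class stable
    under multiplication by cosines; the phase [s] covers sines as well. *)
Definition trig_cvg f : Prop := bounded_mfun f /\
  forall t s, \int[L n]_x (f x * cos (dotp t x + s)) @[n --> \oo] -->
              \int[mu]_x (f x * cos (dotp t x + s)).

(* Multipliers form an algebra closed under uniform limits and mixtures, so
   convergence of characteristic functions yields convergence of integrals of
   many explicit bounded functions without any tightness argument. *)
Definition multiplier w : Prop := bounded_mfun w /\
  forall f, trig_cvg f -> trig_cvg (fun x => f x * w x).

Lemma bounded_mfun_cos_dotp t s : bounded_mfun
  (fun x : V => cos (dotp t x + s)).
Proof.
apply: bounded_mfun_cos; apply: measurable_funD; first exact: measurable_dotp.
exact: measurable_cst.
Qed.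

Lemma trig_cvg_cvg f : trig_cvg f ->
  \int[L n]_x f x @[n --> \oo] --> \int[mu]_x f x.
Proof.
move=> [bf /(_ 0 0)].
have h (P : probability V R) : \int[P]_x (f x * cos (dotp 0 x + 0)) =
    \int[P]_x f x.
  by apply: eq_Rintegral => x _; rewrite dotpC dotp0r addr0 cos0 mulr1.
by under eq_cvg do rewrite h; rewrite h.
Qed.

Lemma trig_cvgD f g : trig_cvg f -> trig_cvg g -> trig_cvg (fun x => f x + g x).
Proof.
move=> [bf cf] [bg cg]; split=> [|t s]; first exact: bounded_mfunD.
have h (P : probability V R) : \int[P]_x ((f x + g x) * cos (dotp t x + s)) =
    \int[P]_x (f x * cos (dotp t x + s)) + \int[P]_x (g x * cos (dotp t x + s)).
  under eq_Rintegral do rewrite mulrDl.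
  by rewrite RintegralD_bounded//; apply: bounded_mfunM => //;
    exact: bounded_mfun_cos_dotp.
by under eq_cvg do rewrite h; rewrite h; exact: cvgD.
Qed.

Lemma trig_cvgZ r f : trig_cvg f -> trig_cvg (fun x => r * f x).
Proof.
move=> [bf cf]; split=> [|t s]; first exact: bounded_mfunZ.
have h (P : probability V R) : \int[P]_x (r * f x * cos (dotp t x + s)) =
    r * \int[P]_x (f x * cos (dotp t x + s)).
  under eq_Rintegral do rewrite -mulrA.
  by rewrite RintegralZl_bounded//; apply: bounded_mfunM => //;
    exact: bounded_mfun_cos_dotp.
by under eq_cvg do rewrite h; rewrite h; apply: cvgM => //; exact: cvg_cst.
Qed.

(** Three-epsilon argument: a uniform error [e / 3] costs at most [e / 3] under every probability
    measure, hence under all [L n] and [mu] at once. *)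
Lemma trig_cvg_unif f : measurable_fun setT f ->
  (forall e, 0 < e -> exists2 g, trig_cvg g & forall x, `|f x - g x| <= e) ->
  trig_cvg f.
Proof.
move=> mf fg.
have bf : bounded_mfun f.
  split=> //; have [g [[_ [C gC]] _] fg1] := fg 1 ltr01.
  exists (1 + C) => x; rewrite -(subrK (g x) (f x)).
  by rewrite (le_trans (ler_normD _ _))// lerD.
split=> // t s; apply/cvgrPdist_le => e e0.
have e30 : 0 < e / 3 by rewrite divr_gt0.
have [g [bg cg] fge] := fg _ e30.
have h (P : probability V R) : `|\int[P]_x (f x * cos (dotp t x + s)) -
    \int[P]_x (g x * cos (dotp t x + s))| <= e / 3.
  rewrite -RintegralB//; last 2 first.
    by apply: (bounded_mfun_integrable P); apply: bounded_mfunM => //;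
      exact: bounded_mfun_cos_dotp.
    by apply: (bounded_mfun_integrable P); apply: bounded_mfunM => //;
      exact: bounded_mfun_cos_dotp.
  apply: le_norm_expectation.
    under eq_fun do rewrite -mulrBl -mulN1r.
    apply: bounded_mfunM; last exact: bounded_mfun_cos_dotp.
    by apply: bounded_mfunD => //; exact: bounded_mfunZ.
  move=> x; rewrite -mulrBl normrM -[leRHS]mulr1 ler_pM//; last exact: cos_max.
have /cvgrPdist_le /(_ _ e30) := cg t s; apply: filterS => n hn.
rewrite (_ : e = e / 3 + (e / 3 + e / 3)); last by field.
rewrite (le_trans (ler_distD (\int[mu]_x (g x * cos (dotp t x + s))) _ _))//.
rewrite lerD//.
rewrite (le_trans (ler_distD (\int[L n]_x (g x * cos (dotp t x + s))) _ _))//.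
by rewrite lerD// distrC.
Qed.

Lemma multiplier_cst r : multiplier (fun=> r).
Proof.
split=> [|f cf]; first exact: bounded_mfun_cst.
by under eq_fun do rewrite mulrC; exact: trig_cvgZ.
Qed.

Lemma multiplierD w1 w2 : multiplier w1 -> multiplier w2 ->
  multiplier (fun x => w1 x + w2 x).
Proof.
move=> [b1 m1] [b2 m2]; split=> [|f cf]; first exact: bounded_mfunD.
by under eq_fun do rewrite mulrDr; apply: trig_cvgD; [exact: m1|exact: m2].
Qed.

Lemma multiplierM w1 w2 : multiplier w1 -> multiplier w2 ->
  multiplier (fun x => w1 x * w2 x).
Proof.
move=> [b1 m1] [b2 m2]; split=> [|f cf]; first exact: bounded_mfunM.
by under eq_fun do rewrite mulrA; exact/m2/m1.
Qed.

Lemma multiplierZ r w : multiplier w -> multiplier (fun x => r * w x).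
Proof. by move=> mw; apply: multiplierM => //; exact: multiplier_cst. Qed.

Lemma multiplier_prod (I : Type) (s : seq I) (w : I -> V -> R) :
  (forall i, multiplier (w i)) -> multiplier (fun x => \prod_(i <- s) w i x).
Proof.
move=> mw; elim: s => [|i s ih].
  by under eq_fun do rewrite big_nil; exact: multiplier_cst.
by under eq_fun do rewrite big_cons; exact: multiplierM.
Qed.

Lemma multiplier_unif w : measurable_fun setT w ->
  (forall e, 0 < e -> exists2 v, multiplier v & forall x, `|w x - v x| <= e) ->
  multiplier w.
Proof.
move=> mw wv; split=> [|f cf].
  split=> //; have [v [[_ [C vC]] _] wv1] := wv 1 ltr01.
  exists (1 + C) => x; rewrite -(subrK (v x) (w x)).
  by rewrite (le_trans (ler_normD _ _))// lerD.
have [[mf [C fC]] _] := cf.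
apply: trig_cvg_unif => [|e e0]; first exact: measurable_funM.
have C0 : 0 < `|C| + 1 by rewrite ltr_wpDl.
have [|v [_ mv] wve] := wv (e / (`|C| + 1)); first by rewrite divr_gt0.
exists (fun x => f x * v x); first exact: mv.
move=> x; rewrite -mulrBr normrM -[leRHS](mulfVK (lt0r_neq0 C0)) mulrC.
by rewrite ler_pM// (le_trans (fC x))// (le_trans (ler_norm _))// lerDl.
Qed.

(** The product-to-sum formula turns the extra cosine into shifts of the frequency [u] by [t] and by
    [- t]. *)
Lemma multiplier_cos t : multiplier (fun x => cos (dotp t x)).
Proof.
split=> [|f [bf cf]].
  by have := bounded_mfun_cos_dotp t 0; under eq_fun do rewrite addr0.
split=> [|u s].
  apply: bounded_mfunM => //.
  by have := bounded_mfun_cos_dotp t 0; under eq_fun do rewrite addr0.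
have h (P : probability V R) : \int[P]_x
  (f x * cos (dotp t x) * cos (dotp u x + s)) =
    2^-1 * (\int[P]_x (f x * cos (dotp (u + t) x + s)) +
            \int[P]_x (f x * cos (dotp (u - t) x + s))).
  rewrite -RintegralD_bounded//; last 2 first.
    by apply: bounded_mfunM => //; exact: bounded_mfun_cos_dotp.
    by apply: bounded_mfunM => //; exact: bounded_mfun_cos_dotp.
  rewrite -RintegralZl_bounded//; last first.
    by apply: bounded_mfunD; apply: bounded_mfunM => //;
      exact: bounded_mfun_cos_dotp.
  apply: eq_Rintegral => x _; rewrite !dotpDl dotpNl.
  rewrite (addrAC (dotp u x) (dotp t x)) (addrAC (dotp u x) (- dotp t x)).
  by move: (dotp u x + s) => v; rewrite cosD cosB; field.
under eq_cvg do rewrite h; rewrite h.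
by apply: cvgM; [exact: cvg_cst|exact: cvgD].
Qed.

(** Fubini moves the mixing variable outside; for each fixed [u] the inner integrals converge, and
    their common bound permits dominated convergence over [eta]. *)
Lemma multiplier_mix d (U : measurableType d) (eta : probability U R)
    (psi : V * U -> R) :
  bounded_mfun psi -> (forall u, multiplier (fun x => psi (x, u))) ->
  multiplier (fun x => \int[eta]_u psi (x, u)).
Proof.
move=> bpsi mpsi.
have bw : bounded_mfun (fun x => \int[eta]_u psi (x, u)).
  exact: (bounded_mfun_Rintegral2 mu eta bpsi).
split=> // f cf; have [bf _] := cf; split=> [|t s]; first exact: bounded_mfunM.
have [mf [C fC]] := bf; have [mp [D pD]] := bpsi.
pose F (z : V * U) := f z.1 * psi z * cos (dotp t z.1 + s).
have bF : bounded_mfun F.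
  apply: bounded_mfunM; last first.
    apply: bounded_mfun_cos; apply: measurable_funD; last exact: measurable_cst.
    by apply: measurableT_comp => //; exact: measurable_dotp.
  by apply: bounded_mfunM => //; split; [exact: measurableT_comp|exists C].
have h (P : probability V R) :
    \int[P]_x (f x * (\int[eta]_u psi (x, u)) * cos (dotp t x + s)) =
    \int[eta]_u \int[P]_x F (x, u).
  rewrite -(Rintegral_fubini_bounded P eta bF); apply: eq_Rintegral => x _.
  rewrite mulrAC -RintegralZl_bounded//; last exact: bounded_mfun_pair1.
  by apply: eq_Rintegral => u _; rewrite /F/=; ring.
under eq_cvg do rewrite h; rewrite h.
have [_ [K FK]] := bF.
apply: (@Rintegral_bounded_cvg _ _ _ eta _ _ K).
- by move=> n; have [] := bounded_mfun_Rintegral1 (L n) eta bF.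
- by have [] := bounded_mfun_Rintegral1 mu eta bF.
- move=> n u; apply: le_norm_expectation => //; exact: bounded_mfun_pair2.
- by move=> u; have [_ /(_ _ cf)[_]] := mpsi u; exact.
Qed.

End trigonometric_convergence.

(** * Bernstein approximation and Lipschitz functions of multipliers *)

Section bernstein.
Context {R : realType}.

(* The Bernstein polynomial of degree [n] of the samples [f (s / N)], ...,
   [f ((s + n) / N)], as the [n]-step expectation of a Bernoulli walk. *)
Fixpoint bernstein (f : R -> R) (N n s : nat) (x : R) : R :=
  if n is m.+1 then x * bernstein f N m s.+1 x + (1 - x) * bernstein f N m s x
  else f (s%:R / N%:R).

(** Bernstein's second-moment proof. The bound [z <= z ^+ 2 / e + e] replaces the mean absolute
    deviation by a variance without a square root. *)
Lemma bernstein_approx (f : R -> R) (K e x : R) (N : nat) :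
  0 <= K -> 0 < e -> 0 <= x <= 1 -> (0 < N)%N ->
  (forall a b, 0 <= a <= 1 -> 0 <= b <= 1 -> `|f a - f b| <= K * `|a - b|) ->
  `|bernstein f N N 0 x - f x| <= K * ((e * N%:R)^-1 + e).
Proof.
move=> K0 e0 /andP[x0 x1] N0 fK.
have N0' : 0 < N%:R :> R by rewrite ltr0n.
(* [B s n] is [K] times the mean of [(Y / N - x) ^+ 2 / e + e], where [Y] is [s] plus a binomial
   variable with parameters [n] and [x]; it therefore satisfies the recursion of [bernstein]
   exactly. *)
pose B (s n : nat) : R := K * ((((s%:R + n%:R * x) / N%:R - x) ^+ 2 +
  n%:R * (x * (1 - x)) / N%:R ^+ 2) / e + e).
have main n s : (s + n <= N)%N -> `|bernstein f N n s x - f x| <= B s n.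
  elim: n s => [|n ih] s snN /=.
    rewrite (le_trans (fK _ _ _ _))//.
    - by rewrite divr_ge0//= ler_pdivrMr// mul1r ler_nat -(addn0 s).
    - by rewrite x0.
    rewrite /B ler_wpM2l// !mul0r !addr0; set y := s%:R / N%:R - x.
    rewrite -real_normK ?num_real//; move: `|y| (normr_ge0 y) => z z0.
    have -> : z ^+ 2 / e + e = z + ((z - e) ^+ 2 + z * e) / e.
      by field; exact: lt0r_neq0.
    rewrite lerDl; apply: divr_ge0; last exact: ltW.
    by rewrite addr_ge0 ?sqr_ge0// mulr_ge0// ltW.
  have -> : B s n.+1 = x * B s.+1 n + (1 - x) * B s n.
    by rewrite /B -!natr1; field; rewrite !lt0r_neq0.
  have -> : x * bernstein f N n s.+1 x + (1 - x) * bernstein f N n s x - f x =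
    x * (bernstein f N n s.+1 x - f x) + (1 - x) * (bernstein f N n s x - f x).
    by ring.
  rewrite (le_trans (ler_normD _ _))// !normrM (ger0_norm x0).
  rewrite (@ger0_norm _ (1 - x)) ?subr_ge0// lerD//.
    by rewrite ler_wpM2l// ih// addSnnS.
  by rewrite ler_wpM2l ?subr_ge0// ih// (leq_trans _ snN)// addnS.
rewrite (le_trans (main _ _ _))// ler_wpM2l// lerD2r.
rewrite add0r mulrAC divff ?lt0r_neq0// mul1r subrr expr0n/= add0r.
have -> : N%:R * (x * (1 - x)) / N%:R ^+ 2 / e = (e * N%:R)^-1 * (x * (1 - x)).
  by field; rewrite !lt0r_neq0.
by rewrite ler_piMr ?invr_ge0 ?mulr_ge0 ?(ltW e0)// mulr_ile1 ?subr_ge0// gerBl.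
Qed.

End bernstein.

Section multipliers.
Context {R : realType} {p : nat}.
Local Notation V := 'rV[R]_p.
Variables (L : nat -> probability V R) (mu : probability V R).

(** Multipliers form an algebra, so Bernstein polynomials in [w] are multipliers, and they
    approximate [f \o w] uniformly. *)
Lemma multiplier_lipschitz (w : V -> R) (f : R -> R) (K : R) :
  0 <= K -> (forall x, 0 <= w x <= 1) ->
  (forall a b, 0 <= a <= 1 -> 0 <= b <= 1 -> `|f a - f b| <= K * `|a - b|) ->
  measurable_fun setT (f \o w) -> multiplier L mu w ->
  multiplier L mu (f \o w).
Proof.
move=> K0 w01 fK mf mw; apply: multiplier_unif => // e e0.
have K10 : 0 < K + 1 by rewrite ltr_wpDl.
(* With [N >= e' ^- 2] both terms of the Bernstein error are at most [e'], and
   [(K + 1) * (e' + e') = e]; the added 1 keeps the divisor positive when [K = 0]. *)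
pose e' : R := e / (K + 1) / 2.
have e'0 : 0 < e' by rewrite !divr_gt0.
have [N N0 e'N] : exists2 N, (0 < N)%N & e' ^- 2 <= N%:R.
  by exists (Num.truncn (e' ^- 2)).+1 => //; exact/ltW/truncnS_gt.
have N0' : 0 < N%:R :> R by rewrite ltr0n.
exists (fun x => bernstein f N N 0 (w x)).
  have h n s : multiplier L mu (fun x => bernstein f N n s (w x)).
    elim: n s => [|n ih] s /=; first exact: multiplier_cst.
    apply: multiplierD; apply: multiplierM => //.
    apply: multiplierD; first exact: multiplier_cst.
    by under eq_fun do rewrite -mulN1r; exact: multiplierZ.
  exact: h.
move=> x /=; rewrite distrC;
  rewrite (le_trans (bernstein_approx K0 e'0 (w01 x) _ fK))//.
have : (e' * N%:R)^-1 <= e'.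
  rewrite invf_ple ?posrE ?mulr_gt0// ?invr_gt0//.
  by rewrite -ler_pdivrMl// -invfM -expr2.
move=> h; rewrite (@le_trans _ _ ((K + 1) * (e' + e')))//.
  apply: ler_pM => //; rewrite ?lerD2r ?lerDl//.
  by rewrite addr_ge0 ?(ltW e'0)// invr_ge0 mulr_ge0 ?ltW.
by rewrite /e' -splitr mulrC mulfVK ?lt0r_neq0.
Qed.

End multipliers.

(** * The kernel [1 / (1 + c ^+ 2)] as a mixture of cosines *)

Section laplace.
Context {R : realType}.
Local Notation leb := (@lebesgue_measure R).

(* In the limit [A --> +oo] this writes [1 / (1 + c ^+ 2)] as a mixture of the
   cosines [cos (c * u)]; the added [1] keeps the integrand nonnegative. *)
Lemma integral_laplace (A c : R) : 0 < A ->
  (\int[leb]_(u in `[0%R, A]) (expR (- u) * (1 + cos (c * u)))%:E =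
   (1 + (1 + c ^+ 2)^-1 +
    expR (- A) * ((c * sin (c * A) - cos (c * A)) / (1 + c ^+ 2) - 1))%:E)%E.
Proof.
move=> A0.
pose F : R -> R := fun u =>
  expR (- u) * ((c * sin (c * u) - cos (c * u)) / (1 + c ^+ 2) - 1).
pose f (u : R) : R := expR (- u) * (1 + cos (c * u)).
have c0 : 1 + c ^+ 2 != 0 by rewrite lt0r_neq0// ltr_wpDr// sqr_ge0.
have dF (u : R) : is_derive u 1 F (f u).
  have d1 : is_derive u (1:R) (expR \o -%R) (- expR (- u)).
    by apply: is_derive_eq; rewrite mulrN1.
  have d0 : is_derive u (1:R) ( *%R c : R -> R) c.
    rewrite (_ : *%R c = c *: (id : R -> R)); last exact/funext.
    by apply: is_derive_eq; rewrite /GRing.scale/= mulr1.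
  have d2 : is_derive u (1:R) (sin \o ( *%R c : R -> R)) (c * cos (c * u)).
    by apply: is_derive_eq; rewrite mulrC.
  have d3 : is_derive u (1:R) (cos \o ( *%R c : R -> R)) (- (c * sin (c * u))).
    by apply: is_derive_eq; rewrite mulNr mulrC.
  have -> : F = (expR \o -%R) * (((1 + c ^+ 2)^-1 * c) *: (sin \o ( *%R c)) -
      (1 + c ^+ 2)^-1 *: (cos \o ( *%R c)) - cst 1).
    apply/funext => v; rewrite /F/= !fctE/=; congr (_ * _).
    by rewrite /GRing.scale/=; ring.
  apply: is_derive_eq; rewrite /f/= !fctE/= /GRing.scale/=; field.
  by rewrite c0.
have cF : continuous F.
  move=> u; apply/differentiable_continuous/derivable1_diffP.
  by have [] := dF u.
rewrite (@continuous_FTC2 _ f F)//.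
- rewrite -EFinB /F; congr EFin; rewrite !mulr0 oppr0 expR0 sin0 cos0.
  by field.
- apply: continuous_subspaceT => u; apply: cvgM.
    by apply: continuous_comp; [exact: cvgN|exact: continuous_expR].
  apply: cvgD; first exact: cvg_cst.
  apply: continuous_comp; last exact: continuous_cos.
  exact: mulrl_continuous.
- split.
  + by move=> u _; have [] := dF u.
  + exact/cvg_at_right_filter/cF.
  + exact/cvg_at_left_filter/cF.
- move=> u _; rewrite derive1E; exact: derive_val.
Qed.

(** The mixture over [u] uniform on [[0, A]] differs from [1 + k] by at most [3 * expR (- A)],
    uniformly in [x]. *)
Lemma multiplier_laplace {p : nat} (L : nat -> probability 'rV[R]_p R)
    (mu : probability 'rV[R]_p R) (c : R) (r : 'I_p) :
  multiplier L mu (fun x => (1 + (c * x ord0 r) ^+ 2)^-1).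
Proof.
pose k (x : 'rV[R]_p) : R := (1 + (c * x ord0 r) ^+ 2)^-1.
have mk : measurable_fun setT k.
  apply: (measurableT_comp (f := fun y : R => (oneDsqr y)^-1)).
    exact: (continuous_measurable_fun (@continuous_oneDsqrV R)).
  by apply: measurable_funM => //; exact: measurable_coord.
suff : multiplier L mu (fun x => 1 + k x).
  move=> /(multiplierD (multiplier_cst L mu (-1))).
  by under eq_fun do rewrite addrA addNr add0r.
apply: multiplier_unif => [|e e0]; first exact: measurable_funD.
pose A := Num.max 1 (ln (3 / e)).
have A0 : 0 < A by rewrite lt_max ltr01.
have eA : expR (- A) * 3 <= e.
  rewrite expRN -ler_pdivlMl ?invr_gt0 ?expR_gt0// invrK.
  rewrite mulrC -ler_pdivrMl// mulrC.
  rewrite -[leLHS]lnK ?posrE ?divr_gt0// ler_expR le_max.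
  by rewrite lexx orbT.
have cos1_ge0 (y : R) : 0 <= 1 + cos y by have := cos_geN1 y; lra.
(* The factor [A] cancels the density of the uniform law; the absolute value keeps [psi] bounded for
   [u] outside [[0, A]]. *)
pose psi (z : 'rV[R]_p * R) : R :=
  A * (expR (- `|z.2|) * (1 + cos (c * z.2 * z.1 ord0 r))).
have bpsi : bounded_mfun psi.
  apply: bounded_mfunZ; apply: bounded_mfunM.
    split.
      apply: measurableT_comp; first exact: measurable_expR.
      apply: measurableT_comp => //; exact: measurableT_comp.
    by exists 1 => z; rewrite ger0_norm ?expR_ge0// expR_le1 oppr_le0.
  apply: bounded_mfunD; first exact: bounded_mfun_cst.
  apply: bounded_mfun_cos; apply: measurable_funM.
    exact: measurable_funM.
  exact: (measurableT_comp (measurable_coord r) measurable_fst).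
exists (fun x => \int[uniform_prob A0]_u psi (x, u)).
  apply: multiplier_mix => // u; rewrite /psi/=.
  apply: multiplierZ; apply: multiplierZ; apply: multiplierD.
    exact: multiplier_cst.
  have := multiplier_cos L mu ((c * u) *: delta_mx ord0 r).
  by under eq_fun do rewrite dotpZl dotp_delta.
move=> x; rewrite /Rintegral integral_uniform//; last 2 first.
- by apply/measurable_EFinP; have [] := bounded_mfun_pair1 bpsi x.
- move=> u; rewrite lee_fin; apply: mulr_ge0; first exact: ltW.
  by apply: mulr_ge0; [exact: expR_ge0|exact: cos1_ge0].
rewrite (_ : (\int[_]_(_ in _) _)%E = A%:E * \int[leb]_(u in `[0%R, A])
    (expR (- u) * (1 + cos ((c * x ord0 r) * u)))%:E)%E; last first.
  rewrite -ge0_integralZl//=; last 2 first.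
  - apply/measurable_EFinP/measurable_funTS/measurable_funM.
      apply: measurableT_comp; first exact: measurable_expR.
      exact: measurable_funN.
    apply: measurable_funD => //.
    apply: measurableT_comp.
      exact: (continuous_measurable_fun (@continuous_cos R)).
    exact: measurable_funM.
  - by rewrite lee_fin ltW.
  apply: eq_integral => u; rewrite inE/= in_itv/= => /andP[u0 _].
  by rewrite /psi/= ger0_norm// -EFinM mulrAC.
rewrite integral_laplace// -!EFinM/= subr0 mulrA mulVf ?lt0r_neq0// mul1r.
rewrite /k; set y := c * x ord0 r.
rewrite opprD addrA subrr sub0r normrN normrM ger0_norm ?expR_ge0//.
rewrite (le_trans _ eA)// ler_wpM2l ?expR_ge0//.
have y0 : 0 < 1 + y ^+ 2 by rewrite ltr_wpDr// sqr_ge0.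
rewrite (_ : 3 = 2 + 1); last by ring.
rewrite (le_trans (ler_normB _ _))// normr1 lerD2r.
rewrite normrM normfV (gtr0_norm y0) ler_pdivrMr//.
rewrite (le_trans (ler_normB _ _))// normrM.
have := sin_max (y * A); have := cos_max (y * A).
have : `|y| <= (1 + y ^+ 2).
  rewrite -real_normK ?num_real//; have := sqr_ge0 (`|y| - 1); nra.
move: (`|sin _|) (`|cos _|) (normr_ge0 y) => s t; nra.
Qed.

End laplace.

(** * Truncated weights and their growth under translation *)

Section weights.
Context {R : realType}.
Implicit Types (m gam : R).

(* For [m > 0] this is bounded and a function of [1 / (1 + m * x ^+ 2)], hence a
   multiplier, while it increases to [1 + x ^+ 2] as [m] decreases to [0]. *)
Definition vtrunc m (x : R) : R := (1 + x ^+ 2) / (1 + m * x ^+ 2).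

Lemma vtrunc_den_gt0 m (x : R) : 0 <= m -> 0 < 1 + m * x ^+ 2.
Proof. by move=> m0; rewrite ltr_wpDr// mulr_ge0// sqr_ge0. Qed.

Lemma vtrunc_ge1 m (x : R) : 0 <= m <= 1 -> 1 <= vtrunc m x.
Proof.
move=> /andP[m0 m1]; rewrite /vtrunc ler_pdivlMr ?vtrunc_den_gt0// mul1r lerD2l.
by rewrite ler_piMl// sqr_ge0.
Qed.

Lemma vtrunc_le (m1 m2 x : R) : 0 <= m2 <= m1 -> vtrunc m1 x <= vtrunc m2 x.
Proof.
move=> /andP[m20 m12]; have m10 := le_trans m20 m12.
rewrite /vtrunc ler_wpM2l ?addr_ge0 ?sqr_ge0//.
by rewrite lef_pV2 ?posrE ?vtrunc_den_gt0// lerD2l ler_wpM2r// sqr_ge0.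
Qed.

(** Peetre's inequality with a constant independent of [m]; this uniformity lets the truncation be
    removed at the end. *)
Lemma vtrunc_peetre m (x y : R) : 0 <= m <= 1 ->
  vtrunc m (x + y) <= 2 * (1 + x ^+ 2) * vtrunc m y.
Proof.
move=> /andP[m0 m1]; rewrite /vtrunc mulrA.
rewrite ler_pdivrMr ?vtrunc_den_gt0// mulrAC ler_pdivlMr ?vtrunc_den_gt0//.
have := sqr_ge0 (x - y); have := sqr_ge0 x; have := sqr_ge0 y; have :=
  sqr_ge0 (x + y).
have -> : (x - y) ^+ 2 = 2 * x ^+ 2 + 2 * y ^+ 2 - (x + y) ^+ 2 by ring.
move: (x ^+ 2) ((x + y) ^+ 2) (y ^+ 2) => a t s t0 s0 a0 tas.
(* Both sides of the cleared inequality are affine in [m], so it is the combination of its cases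
   [m = 0] and [m = 1] with weights [1 - m] and [m]. *)
have h1 : (1 - m) * (1 + t) <= (1 - m) * (2 * (1 + a) * (1 + s)).
  by rewrite ler_wpM2l ?subr_ge0//; nra.
have h2 : m * ((1 + t) * (1 + s)) <= m * (2 * (1 + a) * ((1 + t) * (1 + s))).
  rewrite ler_wpM2l// ler_peMl//; last by nra.
  by rewrite mulr_ge0 ?addr_ge0.
move: h1 h2; nra.
Qed.

Lemma expr_sub1_le (x : R) (n : nat) : 1 <= x ->
  x ^+ n - 1 <= n%:R * (x - 1) * x ^+ n.
Proof.
move=> x1; elim: n => [|n ih]; first by rewrite expr0 subrr !mul0r.
rewrite exprS -natr1; have := exprn_ege1 n x1.
move: (x ^+ n) ih (ler0n R n) => z ih n0 z1.
have : x * (z - 1) <= x * (n%:R * (x - 1) * z)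
  by rewrite ler_wpM2l// (le_trans ler01).
have : 0 <= (x - 1) * (x * z - 1).
  by rewrite mulr_ge0 ?subr_ge0// mulr_ege1.
nra.
Qed.

(** Factoring out the power of the smaller number [b] leaves the power of a ratio [a / b >= 1],
    minus 1; there the real exponent can be rounded up to an integer and the increment estimated
    algebraically. *)
Lemma powR_lipschitz gam (B : R) : 0 <= gam -> 1 <= B ->
  exists2 K, 0 <= K & forall a b, 1 <= a <= B -> 1 <= b <= B ->
    `|a `^ gam - b `^ gam| <= K * `|a - b|.
Proof.
move=> gam0 B1; have B0 : 0 <= B by exact: le_trans B1.
pose n := (Num.truncn gam).+1.
have gn : gam <= n%:R by exact/ltW/truncnS_gt.
exists (B `^ gam * (n%:R * B ^+ n)).
  by rewrite mulr_ge0 ?powR_ge0// mulr_ge0// exprn_ge0.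
move=> a b; wlog ba : a b / b <= a.
  move=> h aB bB; have [ba|/ltW ab] := leP b a; first exact: h.
  by rewrite distrC (distrC a); exact: h.
move=> /andP[a1 aB] /andP[b1 bB].
have b0 : 0 < b by exact: lt_le_trans b1.
have a0 : 0 < a by exact: lt_le_trans a1.
rewrite (@ger0_norm _ (a `^ gam - b `^ gam)); last first.
  by rewrite subr_ge0 ge0_ler_powR// nnegrE ltW.
rewrite (@ger0_norm _ (a - b)) ?subr_ge0//.
have ab1 : 1 <= a / b by rewrite ler_pdivlMr// mul1r.
have -> : a `^ gam - b `^ gam = b `^ gam * ((a / b) `^ gam - 1).
  by rewrite mulrBr mulr1 -powRM ?ltW ?divr_gt0// mulrC divfK// lt0r_neq0.
rewrite -mulrA ler_pM ?powR_ge0//.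
- by rewrite subr_ge0 -(powRr0 (a / b)) ler_powR.
- by rewrite ge0_ler_powR// nnegrE ltW.
rewrite (@le_trans _ _ ((a / b) ^+ n - 1))//.
  by rewrite lerD2r -powR_mulrn ?ler_powR// divr_ge0 ?ltW.
rewrite (le_trans (expr_sub1_le _ ab1))// -!mulrA ler_wpM2l//.
rewrite mulrC ler_pM ?exprn_ge0 ?subr_ge0// ?(le_trans ler01 ab1)//.
  rewrite lerXn2r ?nnegrE ?(le_trans ler01 ab1)//.
  by rewrite ler_pdivrMr// (le_trans aB)// ler_peMr.
by rewrite -{1}(divff (lt0r_neq0 b0)) -mulrBl ler_pdivrMr// ler_peMr// subr_ge0.
Qed.

Lemma vtrunc_inv m (x : R) : 0 < m ->
  vtrunc m x = m^-1 - (m^-1 - 1) * (1 + (Num.sqrt m * x) ^+ 2)^-1.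
Proof.
move=> m0; rewrite /vtrunc exprMn sqr_sqrtr ?ltW//.
by field; rewrite (lt0r_neq0 m0) lt0r_neq0// vtrunc_den_gt0// ltW.
Qed.

Lemma measurable_vtrunc m gam : 0 <= m ->
  measurable_fun setT (fun x => vtrunc m x `^ gam).
Proof.
move=> m0; apply: (measurableT_comp (f := @powR R ^~ gam));
  first exact: measurable_powR.
apply: continuous_measurable_fun => x; apply: cvgM.
  by apply: cvgD; [exact: cvg_cst|exact: exprn_continuous].
apply: cvgV; first by rewrite lt0r_neq0// vtrunc_den_gt0.
apply: cvgD; first exact: cvg_cst.
by apply: cvgM; [exact: cvg_cst|exact: exprn_continuous].
Qed.

(** Up to an affine map [vtrunc m] is the Laplace multiplier, and its values lie in [[1, m^-1]],
    where real powers are Lipschitz; this is where [m > 0] enters. *)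
Lemma multiplier_vtrunc {p : nat} (L : nat -> probability 'rV[R]_p R)
    (mu : probability 'rV[R]_p R) m gam (r : 'I_p) : 0 < m <= 1 -> 0 <= gam ->
  multiplier L mu (fun x : 'rV[R]_p => vtrunc m (x ord0 r) `^ gam).
Proof.
move=> /andP[m0 m1] gam0.
have im1 : 1 <= m^-1 by rewrite invf_ge1.
have [K K0 hK] := powR_lipschitz gam0 im1.
pose w (x : 'rV[R]_p) : R := (1 + (Num.sqrt m * x ord0 r) ^+ 2)^-1.
pose f (k : R) : R := (m^-1 - (m^-1 - 1) * k) `^ gam.
have wE (x : 'rV[R]_p) : vtrunc m (x ord0 r) `^ gam = f (w x).
  by rewrite vtrunc_inv.
have mw : measurable_fun setT (f \o w).
  rewrite (_ : f \o w = fun x => vtrunc m (x ord0 r) `^ gam).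
    apply: (measurableT_comp (measurable_vtrunc gam (ltW m0))).
    exact: measurable_coord.
  by apply/funext => z; rewrite /= wE.
under eq_fun do rewrite wE.
apply: (@multiplier_lipschitz _ _ _ _ w f (K * (m^-1 - 1))) => //.
- by rewrite mulr_ge0// subr_ge0.
- move=> z; rewrite /w invr_ge0 addr_ge0 ?sqr_ge0//=.
  by rewrite invf_le1 ?lerDl ?sqr_ge0// ltr_wpDr// sqr_ge0.
- have h (a : R) : 0 <= a <= 1 -> 1 <= m^-1 - (m^-1 - 1) * a <= m^-1.
    move=> /andP[a0 a1]; rewrite gerBl mulr_ge0 ?subr_ge0// andbT.
    by rewrite lerBrDl -lerBrDr ler_piMr// subr_ge0.
  move=> a b a01 b01; rewrite (le_trans (hK _ _ (h _ a01) (h _ b01)))//.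
  rewrite (_ : _ - _ - _ = (m^-1 - 1) * (b - a)); last by ring.
  by rewrite normrM (distrC b) ger0_norm ?subr_ge0// mulrA.
- exact: multiplier_laplace.
Qed.

End weights.

Section vector_weights.
Context {R : realType} {p : nat}.
Variable gam : 'I_p -> R.
Hypothesis gam0 : forall r, 0 <= gam r.
Implicit Types (m : R) (x y : 'rV[R]_p).

Definition weight m x : R := \prod_(r < p) vtrunc m (x ord0 r) `^ gam r.

Lemma weight_ge0 m x : 0 <= weight m x.
Proof. by apply: prodr_ge0 => r _; exact: powR_ge0. Qed.

Lemma measurable_weight m : 0 <= m -> measurable_fun setT (weight m).
Proof.
move=> m0; apply: measurable_prod => r _.
by apply: (measurableT_comp (measurable_vtrunc (gam r) m0));
  exact: measurable_coord.
Qed.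

Lemma weight_le m1 m2 x : 0 <= m2 <= m1 -> weight m1 x <= weight m2 x.
Proof.
move=> /andP[m20 m12]; apply: ler_prod => r _; rewrite powR_ge0/=.
have v0 m : 0 <= m -> 0 <= vtrunc m (x ord0 r).
  by move=> m0;
    rewrite divr_ge0 ?(ltW (vtrunc_den_gt0 _ m0))// addr_ge0// sqr_ge0.
rewrite ge0_ler_powR// ?nnegrE ?v0 ?(le_trans m20 m12)//.
by rewrite vtrunc_le// m20.
Qed.

Lemma weight_cvg x : weight n.+1%:R^-1 x @[n --> \oo] --> weight 0 x.
Proof.
apply: cvg_big => [|r _ ]; first exact: mul_continuous.
have v0 : 0 < vtrunc 0 (x ord0 r).
  by rewrite (lt_le_trans ltr01)// vtrunc_ge1// lexx ler01.
have cpow : {for vtrunc 0 (x ord0 r), continuous (fun a : R => a `^ gam r)}.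
  apply/differentiable_continuous/derivable1_diffP/derivable_powR.
  by rewrite in_itv/= v0.
have cv : vtrunc n.+1%:R^-1 (x ord0 r) @[n --> \oo] --> vtrunc 0 (x ord0 r).
  apply: cvgM; first exact: cvg_cst.
  apply: cvgV; first by rewrite lt0r_neq0// vtrunc_den_gt0.
  apply: cvgD; first exact: cvg_cst.
  by apply: cvgM; [exact: cvg_harmonic|exact: cvg_cst].
exact: (cvg_comp _ _ cv cpow).
Qed.

Lemma multiplier_weight (L : nat -> probability 'rV[R]_p R)
    (mu : probability 'rV[R]_p R) m : 0 < m <= 1 -> multiplier L mu (weight m).
Proof.
by move=> m01; apply: multiplier_prod => r; exact: multiplier_vtrunc.
Qed.

(** Plays the role of a Lyapunov function: for large [N] it dominates the weight and, being an
    integer power of a quadratic polynomial, it has increments that expand to second order. *)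
Definition hpoly (N : nat) x : R := (1 + dotp x x) ^+ N.

Lemma hpoly_ge1 N x : 1 <= hpoly N x.
Proof. by rewrite exprn_ege1// lerDl dotp_ge0. Qed.

Lemma hpolyN N x : hpoly N (- x) = hpoly N x.
Proof. by rewrite /hpoly dotpNl dotpNr opprK. Qed.

Lemma measurable_hpoly N : measurable_fun setT (hpoly N).
Proof.
apply: measurable_funX; apply: measurable_funD => //.
exact: measurable_dotp_diag.
Qed.

(** Peetre in each coordinate. The factor in [x] is untruncated while the one in [y] keeps [m], so
    the estimate closes on the truncated weight. *)
Lemma weight_submul : exists2 K : R, 0 < K &
  forall m x y, 0 <= m <= 1 -> weight m (x + y) <= K * weight 0 x * weight m y.
Proof.
exists (\prod_(r < p) 2 `^ gam r); first by apply: prodr_gt0 => r _;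
  exact: powR_gt0.
move=> m x y m01; rewrite /weight -!big_split/=.
apply: ler_prod => r _; rewrite powR_ge0/= mxE.
have v0 z : 0 <= vtrunc m z by rewrite (le_trans ler01)// vtrunc_ge1.
have q0 : 0 <= 1 + x ord0 r ^+ 2 by rewrite addr_ge0// sqr_ge0.
have -> : vtrunc 0 (x ord0 r) = 1 + x ord0 r ^+ 2.
  by rewrite /vtrunc mul0r addr0 divr1.
have q2 : 0 <= 2 * (1 + x ord0 r ^+ 2) by exact: mulr_ge0.
rewrite -powRM// -powRM//; apply: ge0_ler_powR => //; rewrite ?nnegrE//.
  exact: mulr_ge0.
exact: vtrunc_peetre.
Qed.

Lemma weight_le_hpoly : exists N : nat, forall x, weight 0 x <= hpoly N x.
Proof.
(* One integer above all exponents; each of the [p] factors is then at most the [l]-th power of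
   [1 + dotp x x]. *)
pose l := (Num.truncn (\sum_r gam r)).+1.
have gl r : gam r <= l%:R.
  rewrite ltW// (le_lt_trans _ (truncnS_gt _))//.
  by rewrite (bigD1 r)//= lerDl sumr_ge0.
exists (l * p)%N => x; rewrite /hpoly.
have xr r : x ord0 r ^+ 2 <= dotp x x.
  rewrite /dotp (bigD1 r)//= -expr2 lerDl sumr_ge0// => i _.
  by rewrite -expr2 sqr_ge0.
have q1 : 1 <= 1 + dotp x x by rewrite lerDl dotp_ge0.
rewrite exprM -[X in _ ^+ X](card_ord p) -prodr_const.
apply: ler_prod => r _; rewrite powR_ge0/= /vtrunc mul0r addr0 divr1.
rewrite (@le_trans _ _ ((1 + dotp x x) `^ gam r))//.
  rewrite ge0_ler_powR// ?nnegrE ?addr_ge0 ?sqr_ge0 ?dotp_ge0//.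
  by rewrite lerD2l.
by rewrite -powR_mulrn ?ler_powR// (le_trans ler01 q1).
Qed.

End vector_weights.

(** * Elementary estimates for sine, cosine and the complex exponential *)

Section elementary_estimates.
Context {R : realType}.
Implicit Types x y : R.

Lemma norm_sin_le y : `|sin y| <= `|y|.
Proof.
wlog y0 : y / 0 <= y.
  move=> h; have [|/ltW y0] := leP 0 y; first exact: h.
  by rewrite -normrN -sinN -(normrN y) h// oppr_ge0.
have [c _] : exists2 c, c \in `[0, y] & sin y - sin 0 = cos c * (y - 0).
  by apply: MVT_segment => //; apply: continuous_subspaceT => ?;
    exact: continuous_sin.
by rewrite sin0 !subr0 => ->; rewrite normrM ler_piMl// cos_max.
Qed.

Lemma one_sub_cos y : 1 - cos y = 2 * sin (y / 2) ^+ 2.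
Proof.
have {1}-> : y = (y / 2) *+ 2 by rewrite mulr2n -splitr.
by rewrite cos_mulr2n cos2sin2; ring.
Qed.

Lemma cos_sub1_le y : `|cos y - 1| <= y ^+ 2 / 2.
Proof.
rewrite distrC one_sub_cos ger0_norm ?(mulr_ge0 _ (sqr_ge0 _))//.
have := norm_sin_le (y / 2); rewrite normrM => h.
have {}h : `|sin (y / 2)| ^+ 2 <= (`|y| * `|2^-1|) ^+ 2
  by rewrite lerXn2r ?nnegrE.
rewrite exprMn !real_normK ?num_real// in h.
rewrite (le_trans (ler_wpM2l _ h))// (_ : 2 * _ = y ^+ 2 / 2)//; last by field.
Qed.

(** For [y >= 0] the mean value theorem gives [sin y = y * cos c], and
    [1 - cos c = 2 * sin (c / 2) ^+ 2 <= c] on bounding one sine by 1 and the other by its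
    argument. *)
Lemma sin_sub_le y : `|sin y - y| <= y ^+ 2.
Proof.
wlog y0 : y / 0 <= y.
  move=> h; have [|/ltW y0] := leP 0 y; first exact: h.
  have -> : sin y - y = - (sin (- y) - - y) by rewrite sinN; ring.
  by rewrite normrN -(sqrrN y) h// oppr_ge0.
have [c] : exists2 c, c \in `[0, y] & sin y - sin 0 = cos c * (y - 0).
  by apply: MVT_segment => //; apply: continuous_subspaceT => ?;
    exact: continuous_sin.
rewrite in_itv/= => /andP[c0 cy]; rewrite sin0 !subr0 => ->.
rewrite -{2}(mul1r y) -mulrBl normrM expr2 (ger0_norm y0) ler_wpM2r//.
rewrite distrC one_sub_cos ger0_norm ?(mulr_ge0 _ (sqr_ge0 _))//.
rewrite (le_trans _ cy)// (@le_trans _ _ (2 * (1 * `|c / 2|)))//.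
  rewrite ler_wpM2l// -real_normK ?num_real// expr2.
  by rewrite ler_pM// ?sin_max// norm_sin_le.
by rewrite mul1r ger0_norm ?divr_ge0// mulrC divfK.
Qed.

Lemma expR_le0_bounds x : x <= 0 -> 0 <= 1 - expR x <= - x.
Proof.
move=> x0; rewrite subr_ge0 expR_le1 x0/=.
by have := expR_ge1Dx x; lra.
Qed.

Lemma expR_sub1_sub_le x : x <= 0 -> 0 <= expR x - 1 - x <= x ^+ 2.
Proof.
move=> x0; have := expR_ge1Dx x; have := expR_ge1Dx (- x);
  rewrite expRN => h1 h2.
have e0 := expR_gt0 x.
have : (1 - x) * expR x <= 1 by rewrite -ler_pdivlMr// div1r.
have := expR_le0_bounds x0 => /andP[h3 h4] h5.
apply/andP; split; first by lra.
by nra.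
Qed.

End elementary_estimates.

Section complex_exponential.
Context {R : realType}.
Import Normc.
Local Open Scope complex_scope.
Implicit Types z w a b : R[i].

Lemma normc_triangle z w : normc (z + w) <= normc z + normc w.
Proof. exact: le_normcD. Qed.

Lemma normc_opp z : normc (- z) = normc z.
Proof. by case: z => x y /=; rewrite !sqrrN. Qed.

Lemma normc_dist a b c : normc (a - c) <= normc (a - b) + normc (b - c).
Proof. by rewrite (le_trans _ (normc_triangle _ _))// addrA subrK. Qed.

Lemma normc_ge0 z : 0 <= normc z.
Proof. by case: z => x y; exact: sqrtr_ge0. Qed.

Lemma normc_le z : normc z <= `|complex.Re z| + `|complex.Im z|.
Proof.
case: z => x y /=; rewrite -[leRHS]ger0_norm ?addr_ge0// -sqrtr_sqr.
rewrite ler_sqrt ?sqr_ge0// sqrrD !real_normK ?num_real//.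
by rewrite lerD2r lerDl mulrn_wge0// mulr_ge0.
Qed.

Lemma norm_Re_le z : `|complex.Re z| <= normc z.
Proof. by case: z => x y /=;
  rewrite -sqrtr_sqr ler_sqrt ?lerDl ?addr_ge0 ?sqr_ge0. Qed.

Lemma norm_Im_le z : `|complex.Im z| <= normc z.
Proof. by case: z => x y /=;
  rewrite -sqrtr_sqr ler_sqrt ?lerDr ?addr_ge0 ?sqr_ge0. Qed.

Lemma normc_sqr z : normc z ^+ 2 = complex.Re z ^+ 2 + complex.Im z ^+ 2.
Proof. by case: z => x y /=; rewrite sqr_sqrtr// addr_ge0 ?sqr_ge0. Qed.

Lemma normcX z n : normc (z ^+ n) = normc z ^+ n.
Proof.
by elim: n => [|n ih]; rewrite ?expr0 ?normc1// !exprS normcM ih.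
Qed.

Lemma normc_real (r : R) : normc r%:C = `|r|.
Proof. by rewrite /= expr0n addr0 sqrtr_sqr. Qed.

Lemma normc_exprB a b n : normc a <= 1 -> normc b <= 1 ->
  normc (a ^+ n - b ^+ n) <= n%:R * normc (a - b).
Proof.
move=> a1 b1; elim: n => [|n ih]; first by rewrite !expr0 subrr normc0 mul0r.
have -> : a ^+ n.+1 - b ^+ n.+1 = a * (a ^+ n - b ^+ n) + (a - b) * b ^+ n.
  by rewrite !exprS; ring.
rewrite (le_trans (normc_triangle _ _))// !normcM -natr1 mulrDl mul1r lerD//.
  by rewrite (le_trans _ ih)// ler_piMl// normc_ge0.
by rewrite ler_piMr ?normc_ge0// normcX exprn_ile1 ?normc_ge0.
Qed.

Lemma cexpD z w : cexp (z + w) = cexp z * cexp w.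
Proof.
case: z w => [x y] [x' y']; rewrite /cexp/= expRD sinD cosD; simpc.
by congr (_ +i* _); ring.
Qed.

Lemma cexp0 : cexp 0 = 1 :> R[i].
Proof. by rewrite /cexp/= expR0 cos0 sin0; simpc. Qed.

Lemma cexpMn z n : cexp (z *+ n) = cexp z ^+ n.
Proof. by elim: n => [|n ih];
  rewrite ?mulr0n ?cexp0// mulrS cexpD ih exprS. Qed.

Lemma normc_cexp z : normc (cexp z) = expR (complex.Re z).
Proof.
by rewrite /cexp normcM normc_real/= cos2Dsin2 sqrtr1 mulr1 ger0_norm ?expR_ge0.
Qed.

(** A second-order Taylor remainder; the sign of the real part keeps the exponential factor at most
    1, so the constant is absolute. *)
Lemma cexp_sub_le z : complex.Re z <= 0 ->
  normc (cexp z - (1 + z)) <= 2 * normc z ^+ 2.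
Proof.
move=> z0; rewrite (le_trans (normc_le _))// normc_sqr.
case: z z0 => x y /= x0; rewrite /cexp/=; simpc; rewrite /=.
have /andP[e1 e2] := expR_sub1_sub_le x0.
have /andP[e3 e4] := expR_le0_bounds x0.
have e5 := expR_ge0 x.
have e6 : expR x <= 1 by rewrite expR_le1.
have h1 : `|expR x * cos y + (-1 - x)| <= x ^+ 2 + y ^+ 2 / 2.
  have -> : expR x * cos y + (-1 - x) = (expR x - 1 - x) + expR x * (cos y - 1).
    by ring.
  rewrite (le_trans (ler_normD _ _))// lerD//.
    by rewrite ger0_norm.
  by rewrite normrM ger0_norm// (le_trans _ (cos_sub1_le _))// ler_piMl.
have h2 : `|expR x * sin y - y| <= y ^+ 2 + `|x| * `|y|.
  have -> : expR x * sin y - y = expR x * (sin y - y) + (expR x - 1) * y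
    by ring.
  rewrite (le_trans (ler_normD _ _))// lerD//.
    by rewrite normrM ger0_norm// (le_trans _ (sin_sub_le _))// ler_piMl.
  rewrite normrM distrC (@ger0_norm _ (1 - expR x))// ler_wpM2r//.
  by rewrite ler0_norm.
have h3 : 2 * (`|x| * `|y|) <= x ^+ 2 + y ^+ 2.
  rewrite -(real_normK (num_real x)) -(real_normK (num_real y)).
  by have := sqr_ge0 (`|x| - `|y|); nra.
have := sqr_ge0 x; have := sqr_ge0 y; lra.
Qed.

(** Avoids complex logarithms: [a n] is compared with the exponential of [z / N n], both in the unit
    disc, where the difference of [N n]-th powers is at most [N n] times the difference of the
    bases. *)
Lemma cexp_power_limit (a : nat -> R[i]) (N : nat -> nat) z :
  (forall n, normc (a n) <= 1) -> complex.Re z <= 0 ->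
  (forall n, (n < N n)%N) ->
  normc ((N n)%:R * (a n - 1) - z) @[n --> \oo] --> 0 ->
  normc (a n ^+ N n - cexp z) @[n --> \oo] --> 0.
Proof.
move=> a1 z0 nN cz.
have N0 n : 0 < (N n)%:R :> R by rewrite ltr0n (leq_ltn_trans _ (nN n)).
apply: (@squeeze_cvgr _ _ _ _ (fun=> 0) (fun n =>
    normc ((N n)%:R * (a n - 1) - z) + 2 * normc z ^+ 2 * n.+1%:R^-1)).
- apply: nearW => n; rewrite normc_ge0/=.
  pose w := ((N n)%:R^-1)%:C * z.
  have NCr : ((N n)%:R : R[i]) = ((N n)%:R)%:C by rewrite rmorph_nat.
  have zw : z = w *+ N n.
    rewrite -mulr_natl /w mulrA NCr -rmorphM/= mulfV ?lt0r_neq0//.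
    by rewrite rmorph1 mul1r.
  have Rew : complex.Re w = (N n)%:R^-1 * complex.Re z.
    by rewrite /w; case: (z) => x y; simpc.
  have w0 : complex.Re w <= 0.
    by rewrite Rew mulr_ge0_le0// invr_ge0.
  rewrite {1}zw cexpMn (le_trans (normc_exprB _ _ _))//.
    by rewrite normc_cexp expR_le1.
  have -> : (N n)%:R * normc (a n - cexp w) =
      normc ((N n)%:R * (a n - 1) - z - (N n)%:R * (cexp w - (1 + w))).
    have -> : (N n)%:R * (a n - 1) - z - (N n)%:R * (cexp w - (1 + w)) =
              (N n)%:R * (a n - cexp w).
      by rewrite {1}zw -mulr_natl; ring.
    by rewrite normcM NCr normc_real ger0_norm// ltW.
  rewrite (le_trans (normc_triangle _ _))// lerD2l normc_opp normcM
    NCr normc_real.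
  rewrite (@ger0_norm _ (N n)%:R)//.
  rewrite (le_trans (ler_wpM2l _ (cexp_sub_le w0)))// {1}/w normcM normc_real.
  rewrite (@ger0_norm _ (N n)%:R^-1) ?invr_ge0//.
  have -> : (N n)%:R * (2 * ((N n)%:R^-1 * normc z) ^+ 2) =
      2 * normc z ^+ 2 * (N n)%:R^-1.
    move: (N0 n) (normc z); move: ((N n)%:R : R) => M M0 c.
    by field; exact: lt0r_neq0.
  rewrite ler_wpM2l ?(mulr_ge0 _ (sqr_ge0 _))// lef_pV2 ?posrE ?N0 ?ltr0n//.
  by rewrite ler_nat.
- exact: cvg_cst.
- rewrite -[X in _ --> X](addr0 0); apply: cvgD => //.
  rewrite -[X in _ --> X](mulr0 (2 * normc z ^+ 2)).
  by apply: cvgM; [exact: cvg_cst|exact: cvg_harmonic].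
Qed.

End complex_exponential.

(** * Integrals against convolutions and convolution powers *)

Section convolution_integrals.
Context {R : realType} {p : nat}.
Local Notation V := 'rV[R]_p.
Implicit Types (A B K : probability V R) (f : V -> \bar R).

Lemma measurable_translate (x : V) : measurable_fun setT (fun y : V => x + y).
Proof.
apply: measurable_fun_rV => i; under eq_fun do rewrite mxE.
by apply: measurable_funD => //; exact: measurable_coord.
Qed.

Lemma measurable_comp_add f (x : V) : measurable_fun setT f ->
  measurable_fun setT (fun y => f (x + y)).
Proof. by move=> mf; exact: (measurableT_comp mf (measurable_translate x)). Qed.

Lemma measurable_comp_addT f : measurable_fun setT f ->
  measurable_fun setT (fun z : V * V => f (z.1 + z.2)).
Proof. by move=> mf; exact: (measurableT_comp mf measurable_add_rV). Qed.

Lemma measurable_integral_add B f : measurable_fun setT f ->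
  (forall x, 0 <= f x)%E ->
  measurable_fun setT (fun x : V => \int[B]_y f (x + y)%R)%E.
Proof.
move=> mf f0.
exact: (measurable_fun_fubini_tonelli_F _ (measurable_comp_addT mf)).
Qed.

Lemma ge0_integral_convolution A B f : measurable_fun setT f ->
  (forall x, 0 <= f x)%E ->
  (\int[convolution A B]_z f z = \int[A]_x \int[B]_y f (x + y)%R)%E.
Proof.
move=> mf f0; rewrite /convolution ge0_integral_distribution//.
rewrite (fubini_tonelli1 (f \o add_rV))//.
  exact: (measurable_comp_addT mf).
by move=> z; exact: f0.
Qed.

Lemma Rintegral_convolution A B (f : V -> R) : bounded_mfun f ->
  \int[convolution A B]_z f z = \int[A]_x \int[B]_y f (x + y)%R.
Proof.
move=> bf; have [mf [C fC]] := bf.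
have bfa : bounded_mfun (f \o @add_rV R p).
  split; last by exists C => z; exact: fC.
  exact: (measurableT_comp mf measurable_add_rV).
rewrite -(Rintegral_prod_bounded A B bfa) /Rintegral integral_distribution//.
  exact/measurable_EFinP.
exact: (bounded_mfun_integrable_prod A B bfa).
Qed.

(** Iterates a one-step growth factor. The bound is stated from every starting point [x] because the
    induction applies it after the first step has moved the walk. *)
Lemma ge0_integral_convolution_pow_le K (h : V -> R) (q : R) n (x : V) :
  measurable_fun setT h -> (forall x, 0 <= h x) -> 0 <= q ->
  (forall x, (\int[K]_y (h (x + y))%:E <= (q * h x)%:E)%E) ->
  (\int[convolution_pow K n]_y (h (x + y))%:E <= (q ^+ n * h x)%:E)%E.
Proof.
move=> mh h0 q0 hK.
have mhE : measurable_fun setT (EFin \o h) by exact/measurable_EFinP.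
elim: n x => [|n ih] x /=.
  rewrite integral_dirac//; last exact: (measurable_comp_add x mhE).
  by rewrite diracT mul1e addr0 expr0 mul1r.
rewrite (@ge0_integral_convolution _ _ (fun y => (h (x + y))%:E))//;
  last 2 first.
- exact: (measurable_comp_add x mhE).
- by move=> y; rewrite lee_fin.
apply: (@le_trans _ _ (\int[K]_y (q ^+ n * h (x + y))%:E)%E).
  apply: ge0_le_integral => //.
  - by move=> y _; apply: integral_ge0 => z _; rewrite lee_fin.
  - apply: (@measurable_integral_add _ (fun y => (h (x + y))%:E)).
      exact: (measurable_comp_add x mhE).
    by move=> y; rewrite lee_fin.
  - by apply/measurable_EFinP/measurable_funM => //;
      exact: (measurableT_comp mh (measurable_translate x)).
  - by move=> y _; under eq_integral do rewrite addrA; exact: ih.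
under eq_integral do rewrite EFinM.
rewrite ge0_integralZl//; last 3 first.
- exact: (measurable_comp_add x mhE).
- by move=> y _; rewrite lee_fin.
- by rewrite lee_fin exprn_ge0.
rewrite exprSr -mulrA EFinM.
by apply: lee_wpmul2l => //; rewrite lee_fin exprn_ge0.
Qed.

(** [q] bounds from below the probability of staying put, and [e] times [nu] the law of a jump; the
    two conclusions retain the paths without jump and those with exactly one. One jump leaves
    [n - 1] factors [q]; the weaker [q ^+ n], allowed by [q <= 1], avoids the predecessor. *)
Lemma ge0_integral_convolution_pow_ge K (nu : {measure set V -> \bar R})
    (f : V -> \bar R) (q e : R) n (x : V) :
  measurable_fun setT f -> (forall x, 0 <= f x)%E -> 0 <= q <= 1 -> 0 <= e ->
  (forall g : V -> \bar R, measurable_fun setT g -> (forall x, 0 <= g x)%E ->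
    q%:E * g 0%R + e%:E * \int[nu]_y g y <= \int[K]_y g y)%E ->
  (((q ^+ n)%:E * f x <= \int[convolution_pow K n]_y f (x + y)%R) /\
   ((n%:R * e * q ^+ n)%:E * \int[nu]_y f (x + y)%R <=
      \int[convolution_pow K n]_y f (x + y)%R))%E.
Proof.
move=> mf f0 /andP[q0 q1] e0 hK.
elim: n x => [|n ih] x /=.
  rewrite integral_dirac//; last exact: measurable_comp_add.
  by rewrite diracT mul1e addr0 expr0 mul1e !mul0r mul0e.
rewrite (@ge0_integral_convolution _ _ (fun y => f (x + y)%R))//; last first.
  exact: measurable_comp_add.
pose g (z : V) := (\int[convolution_pow K n]_y f (x + z + y)%R)%E.
have g0 z : (0 <= g z)%E by apply: integral_ge0.
have mg : measurable_fun setT g.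
  rewrite /g; under eq_fun do under eq_integral do rewrite -addrA.
  apply: (@measurable_integral_add _ (fun y => f (x + y)%R)) => //.
  exact: measurable_comp_add.
have -> : (\int[K]_z \int[convolution_pow K n]_y f (x + (z + y))%R =
    \int[K]_z g z)%E.
  by apply: eq_integral => z _; apply: eq_integral => y _; rewrite addrA.
have [ih1 ih2] := ih x.
have gx : g 0 = (\int[convolution_pow K n]_y f (x + y)%R)%E by rewrite /g addr0.
have nug : ((q ^+ n)%:E * \int[nu]_y f (x + y)%R <= \int[nu]_y g y)%E.
  rewrite -ge0_integralZl//; last 2 first.
  - exact: measurable_comp_add.
  - by rewrite lee_fin exprn_ge0.
  apply: ge0_le_integral => //.
  - by move=> y _; rewrite mule_ge0// lee_fin exprn_ge0.
  - by apply: measurable_funeM; exact: measurable_comp_add.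
  - by move=> y _; have [] := ih (x + y).
have I0 : (0 <= \int[nu]_y f (x + y)%R)%E by exact: integral_ge0.
split; apply: le_trans (hK g mg g0).
  apply: (@le_trans _ _ (q%:E * g 0%R)%E).
    by rewrite exprS EFinM -muleA gx; apply: lee_wpmul2l.
  by rewrite leeDl// mule_ge0// ?lee_fin// integral_ge0.
(* Either the first step stays and the single jump comes later, or the first step jumps and the
   others stay. *)
apply: (@le_trans _ _
  (q%:E * ((n%:R * e * q ^+ n)%:E * \int[nu]_y f (x + y)%R) +
   e%:E * ((q ^+ n)%:E * \int[nu]_y f (x + y)%R)))%E; last first.
  by apply: leeD; apply: lee_wpmul2l => //; rewrite gx.
rewrite !muleA -!EFinM -ge0_muleDl; last 2 first.
- by rewrite lee_fin !mulr_ge0// exprn_ge0.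
- by rewrite lee_fin mulr_ge0// exprn_ge0.
rewrite -EFinD; apply: lee_wpmul2r => //; rewrite lee_fin.
rewrite -natr1 exprS mulrDl mul1r mulrDl lerD//.
  by rewrite mulrCA mulrA.
by rewrite ler_wpM2l// ler_piMl// exprn_ge0.
Qed.

End convolution_integrals.

(** * Characteristic functions of laws on the vector space *)

Section characteristic_functions.
Context {R : realType} {p : nat}.
Local Notation V := 'rV[R]_p.
Local Open Scope complex_scope.
Import Normc.
Implicit Types (A B K : probability V R) (t : V).

Definition cf A t : R[i] :=
  (\int[A]_x cos (dotp t x))%R +i* (\int[A]_x sin (dotp t x))%R.

Lemma bounded_cos_dotp t : bounded_mfun (fun x : V => cos (dotp t x)).
Proof. by apply: bounded_mfun_cos; exact: measurable_dotp. Qed.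

Lemma bounded_sin_dotp t : bounded_mfun (fun x : V => sin (dotp t x)).
Proof. by apply: bounded_mfun_sin; exact: measurable_dotp. Qed.

Lemma Rintegral_cos_sin A t u v :
  \int[A]_x (u * cos (dotp t x) + v * sin (dotp t x)) =
  u * complex.Re (cf A t) + v * complex.Im (cf A t).
Proof.
rewrite RintegralD_bounded; last 2 first.
- by apply: bounded_mfunZ; exact: bounded_cos_dotp.
- by apply: bounded_mfunZ; exact: bounded_sin_dotp.
rewrite !RintegralZl_bounded//; first exact: bounded_sin_dotp.
exact: bounded_cos_dotp.
Qed.

Lemma Rintegral_cos_add A t s : \int[A]_x cos (dotp t x + s) =
  complex.Re (cf A t) * cos s - complex.Im (cf A t) * sin s.
Proof.
rewrite mulrC [_ * sin s]mulrC -mulNr -Rintegral_cos_sin.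
by apply: eq_Rintegral => x _; rewrite cosD; ring.
Qed.

Lemma Rintegral_sin_add A t s : \int[A]_x sin (dotp t x + s) =
  complex.Re (cf A t) * sin s + complex.Im (cf A t) * cos s.
Proof.
rewrite mulrC [_ * cos s]mulrC -Rintegral_cos_sin.
by apply: eq_Rintegral => x _; rewrite sinD; ring.
Qed.

Lemma cf_convolution A B t : cf (convolution A B) t = cf A t * cf B t.
Proof.
have bc := bounded_cos_dotp t; have bs := bounded_sin_dotp t.
have AE : cf A t = complex.Re (cf A t) +i* complex.Im (cf A t)
  by case: (cf A t).
have BE : cf B t = complex.Re (cf B t) +i* complex.Im (cf B t)
  by case: (cf B t).
rewrite AE BE; simpc; rewrite {1}/cf !Rintegral_convolution//; congr (_ +i* _).
  rewrite mulrC [complex.Im _ * _]mulrC -mulNr -Rintegral_cos_sin.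
  apply: eq_Rintegral => x _; under eq_Rintegral do rewrite dotpDr addrC.
  by rewrite Rintegral_cos_add mulNr.
rewrite [RHS](_ : _ = complex.Im (cf B t) * complex.Re (cf A t) +
  complex.Re (cf B t) * complex.Im (cf A t)); last by ring.
rewrite -Rintegral_cos_sin; apply: eq_Rintegral => x _.
under eq_Rintegral do rewrite dotpDr addrC.
by rewrite Rintegral_sin_add addrC.
Qed.

Lemma cf_dirac0 t : cf (dirac (0 : V)) t = 1.
Proof.
rewrite /cf /Rintegral !integral_dirac//; last 2 first.
- by apply/measurable_EFinP; case: (bounded_sin_dotp t).
- by apply/measurable_EFinP; case: (bounded_cos_dotp t).
by rewrite diracT !mul1e/= dotp0r cos0 sin0.
Qed.

Lemma cf_convolution_pow K n t : cf (convolution_pow K n) t = cf K t ^+ n.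
Proof.
elim: n => [|n ih]; first exact: cf_dirac0.
by rewrite exprS -ih -cf_convolution.
Qed.

(** Cauchy-Schwarz in the plane: the squared modulus is the integral of the scalar product of
    [cf A t] with the unit vector of angle [dotp t x], which never exceeds the modulus. *)
Lemma normc_cf A t : normc (cf A t) <= 1.
Proof.
set r := normc _; have r0 : 0 <= r by exact: normc_ge0.
have r2 : r ^+ 2 <= r.
  rewrite normc_sqr !expr2 -Rintegral_cos_sin.
  rewrite (le_trans (ler_norm _))// le_norm_expectation//.
    apply: bounded_mfunD; first exact/bounded_mfunZ/bounded_cos_dotp.
    exact/bounded_mfunZ/bounded_sin_dotp.
  move=> x; set a := complex.Re _; set b := complex.Im _.
  rewrite -(@ler_pXn2r _ 2)// ?nnegrE// normc_sqr real_normK ?num_real//.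
  rewrite -/a -/b -subr_ge0.
  rewrite (_ : _ - _ = (a * sin (dotp t x) - b * cos (dotp t x)) ^+ 2)
    ?sqr_ge0//.
  by rewrite -[a ^+ 2 + b ^+ 2]mulr1 -(cos2Dsin2 (dotp t x)); ring.
have [//|r1] := leP r 1.
by move: r2; rewrite expr2 ger_pMl ?(lt_trans ltr01)// => /le_lt_trans/(_ r1);
  rewrite ltxx.
Qed.

End characteristic_functions.

(** * Laws of single steps of a walk *)

Section integrable_EFin.
Context {R : realType} d (T : measurableType d)
  (mu : {measure set T -> \bar R}).
Variables (D : set T) (mD : measurable D).
Implicit Types f g : T -> R.

Lemma integrableZl_EFin r f : mu.-integrable D (EFin \o f) ->
  mu.-integrable D (EFin \o (fun x => r * f x)).
Proof. exact: integrableZl. Qed.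

Lemma integrableD_EFin f g : mu.-integrable D (EFin \o f) ->
  mu.-integrable D (EFin \o g) ->
    mu.-integrable D (EFin \o (fun x => f x + g x)).
Proof. exact: integrableD. Qed.

End integrable_EFin.

Lemma ge0_integral_mrestr {R : realType} d (T : measurableType d)
    (nu : {measure set T -> \bar R}) (D : set T) (mD : measurable D)
    (f : T -> \bar R) : measurable_fun setT f -> (forall x, 0 <= f x)%E ->
  (\int[mrestr nu mD]_x f x = \int[nu]_(x in D) f x)%E.
Proof.
move=> mf f0; rewrite -(setUv D) ge0_integral_setU//; last 3 first.
- exact: measurableC.
- by rewrite setUv.
- exact/disj_setPCl.
rewrite [X in (_ + X)%E](_ : _ = 0%E) ?adde0.
  by apply: eq_measure_integral => A mA AD; rewrite /= /mrestr setIidl.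
rewrite null_set_integral//.
- exact: measurableC.
- exact: measurable_funTS.
- by rewrite /= /mrestr setICl measure0.
Qed.

Section step_law.
Context {R : realType} {p : nat}.
Local Notation V := 'rV[R]_p.
Variables (nu : {measure set V -> \bar R}) (D : set V) (n : nat) (u : nat -> V).
Hypothesis mD : measurable D.
Hypothesis nuD : (nu D < +oo)%E.

(* The law of one step of a random walk with [N] steps: with intensity [1 / N]
   it jumps by [nu] restricted to [D], or by [u k] or [- u k] with rate [w]
   each; otherwise it moves by the drift [b]. *)
Lemma step_law (b : V) (w N : R) :
  0 <= w -> 0 < N -> fine (nu D) + 2 * w * n%:R <= N ->
  let lam := fine (nu D) + 2 * w * n%:R in
  exists K : probability V R, forall f : V -> \bar R,
    measurable_fun setT f -> (forall x, 0 <= f x)%E ->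
    (\int[K]_x f x = (1 - lam / N)%:E * f b + (N^-1)%:E *
      (\int[nu]_(x in D) f x + \sum_(k < n) w%:E * (f (u k) + f (- u k)%R)))%E.
Proof.
move=> w0 N0 lamN lam.
have nuDf : nu D \is a fin_num by rewrite ge0_fin_numE.
have iN0 : 0 <= N^-1 by rewrite invr_ge0 ltW.
have c0 : 0 <= 1 - lam / N by rewrite subr_ge0 ler_pdivrMr// mul1r.
pose atom k : {measure set V -> \bar R} :=
  mscale (NngNum w0) (measure_add (dirac (u k)) (dirac (- u k))).
pose mu : {measure set V -> \bar R} :=
  measure_add (mscale (NngNum c0) (dirac b))
  (mscale (NngNum iN0) (measure_add (mrestr nu mD) (msum atom n))).
have muE (f : V -> \bar R) : measurable_fun setT f -> (forall x, 0 <= f x)%E ->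
    (\int[mu]_x f x = (1 - lam / N)%:E * f b + (N^-1)%:E *
      (\int[nu]_(x in D) f x + \sum_(k < n) w%:E * (f (u k) + f (- u k)%R)))%E.
  move=> mf f0; rewrite ge0_integral_measure_add// !ge0_integral_mscale//=.
  rewrite integral_dirac// diracT mul1e ge0_integral_measure_add//.
  rewrite ge0_integral_mrestr// ge0_integral_measure_sum//.
  congr (_ + _ * (_ + _))%E; apply: eq_bigr => k _.
  rewrite ge0_integral_mscale//= ge0_integral_measure_add//.
  by rewrite !integral_dirac// !diracT !mul1e.
have mu1 : mu setT = 1%E.
  have := muE (cst 1%E) (measurable_cst _) (fun=> lee01); rewrite /cst/=.
  rewrite integral_cst// mul1e => ->.
  rewrite mule1 integral_cst// mul1e -(fineK nuDf).
  under eq_bigr do rewrite -EFinD -EFinM.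
  rewrite sumEFin sumr_const card_ord -EFinD; congr EFin.
  by rewrite /lam -mulr_natr; field; exact: lt0r_neq0.
pose K := HB.pack_for (probability V R) (Measure.sort mu)
  (@Measure_isProbability.Build _ _ _ mu mu1).
by exists K => f mf f0; rewrite -muE.
Qed.

(** Positive and negative parts extend the formula from nonnegative to integrable functions, as
    needed for cosines, sines and means. *)
Lemma step_law_Rintegral (K : probability V R) (b : V) (c e w : R) :
  (forall f : V -> \bar R, measurable_fun setT f -> (forall x, 0 <= f x)%E ->
    (\int[K]_x f x = c%:E * f b + e%:E *
      (\int[nu]_(x in D) f x + \sum_(k < n) w%:E * (f (u k) + f (- u k)%R)))%E)
        ->
  forall f : V -> R, measurable_fun setT f -> nu.-integrable D (EFin \o f) ->
  K.-integrable setT (EFin \o f) /\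
  \int[K]_x f x = c * f b + e *
    (\int[nu]_(x in D) f x + \sum_(k < n) w * (f (u k) + f (- u k)%R)).
Proof.
move=> KE f mf nuf.
have ge0 (g : V -> R) : measurable_fun setT g -> (forall x, 0 <= g x) ->
    nu.-integrable D (EFin \o g) ->
    (\int[K]_x (g x)%:E = (c * g b + e * (\int[nu]_(x in D) g x +
      \sum_(k < n) w * (g (u k) + g (- u k)%R)))%:E)%E.
  move=> mg g0 nug; rewrite KE//; last exact/measurable_EFinP.
  rewrite -(fineK (integrable_fin_num _ nug))//.
  under eq_bigr do rewrite -EFinD -EFinM.
  by rewrite sumEFin.
have mp : measurable_fun setT f^\+ by exact: measurable_funrpos.
have mn : measurable_fun setT f^\- by exact: measurable_funrneg.
have np : nu.-integrable D (EFin \o f^\+) by exact: integrable_funrpos.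
have nn : nu.-integrable D (EFin \o f^\-) by exact: integrable_funrneg.
have Ep := ge0 _ mp (funrpos_ge0 f) np.
have En := ge0 _ mn (funrneg_ge0 f) nn.
have int (g : V -> R) r : measurable_fun setT g -> (forall x, 0 <= g x) ->
    (\int[K]_x (g x)%:E = r%:E)%E -> K.-integrable setT (EFin \o g).
  move=> mg g0 gr; apply/integrableP; split; first exact/measurable_EFinP.
  by under eq_integral do rewrite /= ger0_norm//; rewrite gr ltry.
have Kp := int _ _ mp (funrpos_ge0 f) Ep.
have Kn := int _ _ mn (funrneg_ge0 f) En.
have fE x : f x = f^\+ x - f^\- x by rewrite -{1}(funrposBneg f).
split.
  rewrite (_ : EFin \o f = (EFin \o f^\+%R) \- (EFin \o f^\-%R))%E.
    exact: integrableB.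
  by apply/funext => x /=; rewrite -EFinB -fE.
rewrite (_ : \int[K]_x f x = \int[K]_x (f^\+ x - f^\- x)); last first.
  by apply: eq_Rintegral => x _; rewrite -fE.
rewrite (_ : \int[nu]_(x in D) f x = \int[nu]_(x in D) (f^\+ x - f^\- x));
  last first.
  by apply: eq_Rintegral => x _; rewrite -fE.
rewrite (_ : \sum_(k < n) w * (f (u k) + f (- u k)) =
    \sum_(k < n) w * (f^\+ (u k) + f^\+ (- u k)) -
    \sum_(k < n) w * (f^\- (u k) + f^\- (- u k))); last first.
  by rewrite -sumrB; apply: eq_bigr => k _; rewrite !fE; ring.
rewrite !RintegralB// {1 2}/Rintegral Ep En/= fE.
by ring.
Qed.

End step_law.

(** * The Lyapunov estimate for one small step *)

Section lyapunov.
Context {R : realType} {p : nat}.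
Local Notation V := 'rV[R]_p.
Implicit Types x y : V.

Lemma cauchy_schwarz x y : dotp x y ^+ 2 <= dotp x x * dotp y y.
Proof.
have : 0 <= dotp (dotp y y *: x + (- dotp x y) *: y)
  (dotp y y *: x + (- dotp x y) *: y).
  exact: dotp_ge0.
rewrite !(dotpDl, dotpDr, dotpZl, dotpZr) (dotpC y x).
set B := dotp y y; set A := dotp x y; set Q := dotp x x.
rewrite (_ : _ + _ = B * (Q * B - A ^+ 2)); last by ring.
have [/eqP B0 _|B0] := eqVneq B 0; last first.
  by rewrite pmulr_rge0 ?subr_ge0// lt0r B0 dotp_ge0.
suff -> : A = 0 by rewrite expr0n/= mulr_ge0 ?dotp_ge0.
rewrite /A /dotp big1// => i _.
have : y ord0 i ^+ 2 == 0.
  move: B0; rewrite /B /dotp psumr_eq0; last by move=> j _;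
    rewrite -expr2 sqr_ge0.
  by move=> /allP/(_ i); rewrite mem_index_enum => /(_ isT); rewrite -expr2.
by rewrite sqrf_eq0 => /eqP ->; rewrite mulr0.
Qed.

(** The lower end [-1] of the range keeps [1 + w] nonnegative, so the induction may multiply an
    inequality by it. *)
Lemma expr_taylor2 (W : R) (L : nat) : 0 <= W -> exists2 C : R, 0 <= C &
  forall w : R, -1 <= w <= W -> (1 + w) ^+ L <= 1 + L%:R * w + C * w ^+ 2.
Proof.
move=> W0; elim: L => [|L [C C0 ih]].
  by exists 0 => // w _; rewrite expr0 !mul0r !addr0.
(* Multiplying out leaves the remainder [(L + C + C * w) * w ^+ 2], and [w <= W]. *)
exists (L%:R + C * (1 + W)).
  by rewrite addr_ge0// mulr_ge0// addr_ge0.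
move=> w /andP[w1 wW]; have w10 : 0 <= 1 + w by rewrite -lerBlDl sub0r.
have := ler_wpM2l w10 (ih w _); rewrite w1 wW => /(_ isT) h.
rewrite (exprS (1 + w)) -natr1; apply: (le_trans h).
have h2 : 0 <= C * w ^+ 2 * (W - w).
  by rewrite mulr_ge0 ?subr_ge0// mulr_ge0// sqr_ge0.
by rewrite -subr_ge0 (_ : _ - _ = C * w ^+ 2 * (W - w))//; ring.
Qed.

(** A relative expansion: [1 + dotp (x + y) (x + y) = (1 + dotp x x) * (1 + w)], where [w ^+ 2] is
    at most a multiple of [dotp y y], uniformly in [x]. *)
Lemma hpoly_taylor (rho : R) (L : nat) : 0 <= rho -> exists2 C : R, 0 <= C &
  forall x y, dotp y y <= rho ->
    hpoly L (x + y) <=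
    hpoly L x * (1 + 2 * L%:R / (1 + dotp x x) * dotp x y + C * dotp y y).
Proof.
move=> rho0.
(* The upper bound for [w] below, from [w <= 1 + w ^+ 2] and [w ^+ 2 <= (8 + 2 * rho) * rho]. *)
have W0 : 0 <= 1 + (8 + 2 * rho) * rho
  by rewrite addr_ge0// mulr_ge0// addr_ge0// mulr_ge0.
have [C C0 hC] := expr_taylor2 L W0.
exists (L%:R + C * (8 + 2 * rho)).
  by rewrite addr_ge0// mulr_ge0// addr_ge0// mulr_ge0.
move=> x y yrho.
have CS := cauchy_schwarz x y; have x0 := dotp_ge0 x; have y0 := dotp_ge0 y.
have xy0 := dotp_ge0 (x + y).
set q := dotp x x in CS x0 *; set s := dotp y y in CS y0 yrho *.
set a := dotp x y in CS *.
have q1 : 0 < 1 + q by rewrite ltr_wpDr.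
have xyE : dotp (x + y) (x + y) = q + 2 * a + s.
  by rewrite !(dotpDl, dotpDr) (dotpC y x) -/a -/q -/s; ring.
pose w := (2 * a + s) / (1 + q).
have hE : 1 + dotp (x + y) (x + y) = (1 + q) * (1 + w).
  by rewrite xyE /w; field; exact: lt0r_neq0.
have w1 : -1 <= w.
  have : 0 <= (1 + q) * (1 + w) by rewrite -hE addr_ge0.
  by rewrite pmulr_rge0// -lerBlDl sub0r.
have w2 : w ^+ 2 <= (8 + 2 * rho) * s.
  rewrite /w expr_div_n ler_pdivrMr ?exprn_gt0//.
  have h1 : (2 * a + s) ^+ 2 <= 8 * a ^+ 2 + 2 * s ^+ 2.
    by have := sqr_ge0 (2 * a - s); nra.
  have h2 : s ^+ 2 <= rho * s by rewrite expr2 ler_wpM2r.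
  have h3 : 1 <= (1 + q) ^+ 2 by rewrite exprn_ege1// lerDl.
  have h4 : q <= (1 + q) ^+ 2 by nra.
  have h5 : q * s <= (1 + q) ^+ 2 * s by rewrite ler_wpM2r.
  have h6 : rho * s <= (1 + q) ^+ 2 * (rho * s) by rewrite ler_peMl// mulr_ge0.
  nra.
have wW : w <= 1 + (8 + 2 * rho) * rho.
  have h : w ^+ 2 <= (8 + 2 * rho) * rho.
    by rewrite (le_trans w2)// ler_wpM2l// addr_ge0// mulr_ge0.
  have := sqr_ge0 (w - 1); nra.
rewrite /hpoly -/q hE exprMn ler_wpM2l ?exprn_ge0 ?(ltW q1)//.
rewrite (le_trans (hC w _)) ?w1//.
have h7 : C * w ^+ 2 <= C * ((8 + 2 * rho) * s) by rewrite ler_wpM2l.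
have h8 : L%:R * w <= 2 * L%:R / (1 + q) * a + L%:R * s.
  have -> : L%:R * w = 2 * L%:R / (1 + q) * a + L%:R * s / (1 + q).
    by rewrite /w; field; exact: lt0r_neq0.
  rewrite lerD2l ler_pdivrMr// ler_peMr ?lerDl//.
  exact: mulr_ge0.
rewrite mulrDl; move: h7 h8; rewrite -!mulrA; lra.
Qed.

(* The mean and the second moment of [K] are of order [1 / N], so one step of
   the walk multiplies the expectation of [hpoly L] by [1 + O(1 / N)]. *)
Lemma hpoly_lyapunov (rho M : R) (L : nat) : 0 <= rho -> 0 <= M ->
  exists2 C : R, 0 <= C & forall (K : probability V R) (N : R), 0 < N ->
    K [set y | rho < dotp y y] = 0%E ->
    K.-integrable setT (fun y => (dotp y y)%:E) ->
    (forall x, K.-integrable setT (fun y => (dotp x y)%:E)) ->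
    \int[K]_y dotp y y <= M / N ->
    (forall x, \int[K]_y dotp x y <= M * (1 + dotp x x) / N) ->
    forall x, (\int[K]_y (hpoly L (x + y))%:E <=
      ((1 + C / N) * hpoly L x)%:E)%E.
Proof.
move=> rho0 M0; have [C C0 hC] := hpoly_taylor L rho0.
exists (2 * L%:R * M + C * M); first by rewrite addr_ge0 ?mulr_ge0.
move=> K N N0 Krho i2 i1 m2 m1 x.
have q1 : 0 < 1 + dotp x x by rewrite ltr_wpDr// dotp_ge0.
pose U y : R :=
  hpoly L x * (1 + 2 * L%:R / (1 + dotp x x) * dotp x y + C * dotp y y).
have mq : measurable_fun setT (fun y : V => dotp y y).
  exact: measurable_dotp_diag.
have mU : measurable_fun setT U.
  apply: measurable_funM => //; apply: measurable_funD.
    apply: measurable_funD => //; apply: measurable_funM => //.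
    exact: measurable_dotp.
  exact: measurable_funM.
have iU1 : K.-integrable setT
  (EFin \o (fun y => 1 + 2 * L%:R / (1 + dotp x x) * dotp x y)).
  apply: integrableD_EFin => //.
    exact/(bounded_mfun_integrable K)/bounded_mfun_cst.
  by apply: integrableZl_EFin => //; exact: i1.
have iU2 : K.-integrable setT (EFin \o (fun y => C * dotp y y)).
  exact: integrableZl_EFin.
have iU3 := integrableD_EFin measurableT iU1 iU2.
have IU : \int[K]_y U y = hpoly L x * (1 + 2 * L%:R / (1 + dotp x x) *
    (\int[K]_y dotp x y) + C * \int[K]_y dotp y y).
  rewrite RintegralZl//.
  rewrite RintegralD// RintegralZl// RintegralD//; last 2 first.
  - exact/(bounded_mfun_integrable K)/bounded_mfun_cst.
  - by apply: integrableZl_EFin => //; exact: i1.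
  rewrite RintegralZl//; last exact: i1.
  by rewrite Rintegral_cst//; have /= -> := probability_setT K; rewrite mulr1.
have U0 : (forall y, dotp y y <= rho -> 0 <= U y).
  move=> y yrho; rewrite (le_trans _ (hC x y yrho))//.
  by rewrite (le_trans ler01)// hpoly_ge1.
have iU : K.-integrable setT (EFin \o U).
  exact: integrableZl_EFin.
(* [U] is known to be nonnegative only where [dotp y y <= rho], that is [K]-almost everywhere; its
   absolute value allows a comparison of nonnegative integrals. *)
apply: (@le_trans _ _ (\int[K]_y (`|U y|)%:E)%E).
  apply: ae_ge0_le_integral => //.
  - by move=> y _; rewrite lee_fin (le_trans ler01)// hpoly_ge1.
  - apply/measurable_EFinP.
    exact: (measurableT_comp (measurable_hpoly L) (measurable_translate x)).
  - by apply/measurable_EFinP; exact: measurableT_comp.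
  - exists [set y | rho < dotp y y]; split => //.
      rewrite -[X in measurable X]setTI; apply: measurable_fun_ltr => //.
    move=> y /= h; rewrite ltNge; apply/negP => yrho; apply: h => _.
    by rewrite lee_fin (le_trans (hC x y yrho))// ler_norm.
have -> : (\int[K]_y (`|U y|)%:E = \int[K]_y (U y)%:E)%E.
  apply: ae_eq_integral => //.
  - by apply/measurable_EFinP; exact: measurableT_comp.
  - exact/measurable_EFinP.
  - exists [set y | rho < dotp y y]; split => //.
      rewrite -[X in measurable X]setTI; apply: measurable_fun_ltr => //.
    move=> y /= h; rewrite ltNge; apply/negP => yrho; apply: h => _.
    by rewrite ger0_norm// U0.
rewrite -(fineK (integrable_fin_num measurableT iU))// -/(Rintegral K setT U) IU
  lee_fin.
rewrite mulrC ler_wpM2r ?(le_trans ler01 (hpoly_ge1 _ _))//.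
rewrite -addrA lerD2l [leRHS]mulrDl lerD//.
  rewrite (le_trans (ler_wpM2l _ (m1 x)))//.
    by rewrite mulr_ge0 ?mulr_ge0// invr_ge0 ltW.
  rewrite le_eqVlt; apply/orP; left; apply/eqP; field.
  by rewrite !lt0r_neq0.
by rewrite -mulrA ler_wpM2l.
Qed.

End lyapunov.

(** * Nonnegative quadratic forms as sums of squares *)

Section quadratic_forms.
Context {R : realType} {p : nat}.
Local Notation V := 'rV[R]_p.
Implicit Types (S : 'M[R]_p) (t u : V).

Definition qform S t : R := dotp t (t *m S).

Lemma dotp_mulmx_sym S t u : S^T = S -> dotp t (u *m S) = dotp u (t *m S).
Proof.
move=> S_sym; rewrite /dotp.
under eq_bigr => i _ do rewrite mxE mulr_sumr.
under [RHS]eq_bigr => i _ do rewrite mxE mulr_sumr.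
rewrite exchange_big; apply: eq_bigr => i _; apply: eq_bigr => j _ /=.
by rewrite -{1}S_sym mxE; ring.
Qed.

Lemma qformD S t u s : S^T = S ->
  qform S (t + s *: u) = qform S t + 2 * s * dotp u (t *m S) +
    s ^+ 2 * qform S u.
Proof.
move=> S_sym;
  rewrite /qform mulmxDl -scalemxAl !(dotpDl, dotpDr, dotpZl, dotpZr).
by rewrite (dotp_mulmx_sym t u S_sym); ring.
Qed.

Lemma qform_rank1 t u : qform (u^T *m u) t = dotp u t ^+ 2.
Proof.
rewrite /qform mulmxA (mx11_scalar (t *m u^T)) mul_scalar_mx dotpZr mxE.
rewrite (_ : \sum_j _ = dotp u t) ?(dotpC t) ?expr2//.
by apply: eq_bigr => j _; rewrite mxE mulrC.
Qed.

(* Gaussian elimination, one coordinate at a time from the last one. *)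
Lemma psd_sum_squares_supp k S : S^T = S ->
  (forall i j : 'I_p, (k <= i)%N -> S i j = 0) -> (forall t, 0 <= qform S t) ->
  exists vs : seq V, forall t, qform S t = \sum_(v <- vs) dotp v t ^+ 2.
Proof.
elim: k S => [|k ih] S S_sym supp S0.
  exists [::] => t; rewrite big_nil /qform (_ : S = 0) ?mulmx0 ?dotp0r//.
  by apply/matrixP => i j; rewrite mxE supp.
have [pk|kp] := leqP p k.
  apply: ih => // i j ki; apply: supp.
  by have := leq_trans (ltn_ord i) pk; rewrite ltnNge ki.
pose r := Ordinal kp.
have SrE t : dotp (delta_mx ord0 r) (t *m S) = dotp (row r S) t.
  by rewrite dotp_mulmx_sym// -rowE dotpC.
have a0 := S0 (delta_mx ord0 r).
set a := qform S (delta_mx ord0 r) in a0.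
have aE : a = S r r by rewrite /a /qform -rowE dotp_delta mxE.
have suppk S' : (forall i j : 'I_p, (k < i)%N -> S' i j = 0) ->
    (forall j, S' r j = 0) -> forall i j : 'I_p, (k <= i)%N -> S' i j = 0.
  move=> h hr i j; rewrite leq_eqVlt => /predU1P[ki|/h//].
  by rewrite (_ : i = r) ?hr//; apply: val_inj.
have [a_eq0|a_neq0] := eqVneq a 0.
  apply: ih => //; apply: suppk => // j; apply/eqP/negPn/negP => Srj.
  (* With a zero pivot the form is affine in the coefficient of the pivot direction; were [S r j]
     nonzero, this choice would give it the value -1. *)
  have := S0 (delta_mx ord0 j +
    (- (qform S (delta_mx ord0 j) + 1) / (2 * S r j)) *:
    delta_mx ord0 r).
  rewrite qformD// -/a a_eq0 mulr0 addr0 SrE dotpC dotp_delta mxE.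
  rewrite (_ : _ + _ = -1) ?ler0N1//; field.
  by rewrite Srj.
have {a_neq0}a0 : 0 < a by rewrite lt0r a_neq0.
(* The Schur complement: completing the square removes every term in coordinate [r]. *)
pose S' := S - a^-1 *: ((row r S)^T *m row r S).
have qS' t : qform S' t = qform S t - a^-1 * dotp (row r S) t ^+ 2.
  rewrite -qform_rank1 /qform /S' mulmxBr dotpDr dotpNr; congr (_ - _).
  by rewrite -scalemxAr dotpZr.
have [|i j ki|t|vs vsE] := ih S'.
- by rewrite /S' linearB/= linearZ/= trmx_mul trmxK S_sym.
- apply: suppk ki => [i' j' ki'|j'].
  + have Sri : S r i' = 0 by rewrite -S_sym mxE supp.
    by rewrite !mxE big_ord1 !mxE Sri (supp i')// mul0r mulr0 subr0.
  + rewrite !mxE big_ord1 !mxE -aE mulrA mulVf ?lt0r_neq0// mul1r.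
    by rewrite subrr.
(* [qform S' t] is the minimum of [qform S] on the line through [t] in direction [r], hence
   nonnegative. *)
- rewrite qS'; have := S0 (t + (- (dotp (row r S) t / a)) *: delta_mx ord0 r).
  rewrite qformD// -/a SrE; congr (0 <= _).
  by field; exact: lt0r_neq0.
exists ((Num.sqrt a)^-1 *: row r S :: vs) => t.
rewrite big_cons -vsE qS' dotpZl exprMn exprVn sqr_sqrtr ?ltW//.
by ring.
Qed.

(** Each [v] will yield the symmetric pair of small jumps that imitates the Gaussian part along
    [v]. *)
Lemma nonneg_quadratic_form_sum_squares (Q : V -> R) :
  nonneg_quadratic_form Q ->
  exists vs : seq V, forall t, Q t = \sum_(v <- vs) dotp v t ^+ 2.
Proof.
move=> [[A QA] Q0]; pose S : 'M[R]_p := 2^-1 *: (A + A^T).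
have QS t : Q t = qform S t.
  rewrite QA; set X := LHS.
  transitivity (\sum_(i < p) \sum_(j < p)
    (2^-1 * (A j i * t ord0 j * t ord0 i) +
      2^-1 * (A i j * t ord0 i * t ord0 j))); last first.
    apply: eq_bigr => i _; rewrite mxE mulr_sumr; apply: eq_bigr => j _.
    by rewrite !mxE; ring.
  under eq_bigr do rewrite big_split/= -!mulr_sumr.
  rewrite big_split/= -!mulr_sumr exchange_big/= -/X.
  by field.
have [|||vs vsE] := @psd_sum_squares_supp p S.
- by rewrite /S linearZ/= linearD/= trmxK addrC.
- by move=> i j; rewrite leqNgt ltn_ord.
- by move=> t; rewrite -QS.
by exists vs => t; rewrite QS vsE.
Qed.

End quadratic_forms.

(** * Integration against Levy measures *)

Section levy_measures.
Context {R : realType} {p : nat}.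
Local Notation V := 'rV[R]_p.
Variable nu : {measure set V -> \bar R}.
Hypothesis nuL : levy_measure nu.
Implicit Types (f : V -> R) (x : V) (s : R).

Lemma enorm_sqr x : enorm x ^+ 2 = dotp x x.
Proof. by rewrite /enorm sqr_sqrtr// dotp_ge0. Qed.

Lemma enorm_ge s x : 0 <= s -> (s <= enorm x) = (s ^+ 2 <= dotp x x).
Proof. by move=> s0; rewrite -enorm_sqr ler_pXn2r// nnegrE ?sqrtr_ge0. Qed.

Lemma measurable_sqr_norm_frac :
  measurable_fun setT (fun x : V => dotp x x / (1 + dotp x x)).
Proof.
have -> : (fun x : V => dotp x x / (1 + dotp x x)) =
    (fun r : R => r / (1 + `|r|)) \o (fun x => dotp x x).
  by apply/funext => x /=; rewrite ger0_norm// dotp_ge0.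
apply: measurableT_comp; last exact: measurable_dotp_diag.
apply: continuous_measurable_fun => r; apply: cvgM; first exact: cvg_id.
apply: cvgV; first by rewrite lt0r_neq0// ltr_wpDr.
by apply: cvgD; [exact: cvg_cst|exact: norm_continuous].
Qed.

Lemma integrable_sqr_norm_frac :
  nu.-integrable setT (fun x => (dotp x x / (1 + dotp x x))%:E).
Proof.
apply/integrableP; split.
  by apply/measurable_EFinP; exact: measurable_sqr_norm_frac.
have [_] := nuL; congr (_ < _)%E; apply: eq_integral => x _.
rewrite enorm_sqr abse_EFin ger0_norm//.
by rewrite divr_ge0 ?addr_ge0 ?dotp_ge0.
Qed.

(** Together the bounds give [C] times the minimum of 1 and [dotp x x], which is at most [2 * C]
    times the integrand of the Levy condition. *)
Lemma levy_integrable f C : measurable_fun setT f ->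
  (forall x, `|f x| <= C * dotp x x) -> (forall x, `|f x| <= C) ->
  nu.-integrable setT (EFin \o f).
Proof.
move=> mf fq fC; have :=
  integrableZl measurableT (2 * C) integrable_sqr_norm_frac.
apply: le_integrable => //; first exact/measurable_EFinP.
move=> x _; rewrite lee_fin (le_trans _ (ler_norm _))//.
have q0 := dotp_ge0 x; have q1 : 0 < 1 + dotp x x by rewrite ltr_wpDr.
have := fq x; have := fC x; rewrite mulrA ler_pdivlMr//.
have : 0 <= `|f x| by []. move: `|f x| (dotp x x) q0 q1 => y q q0 q1 y0 yC yq.
have [q_le1|/ltW q_ge1] := leP q 1; nra.
Qed.

(** Markov's inequality: on this set the integrand of the Levy condition is at least
    [s ^+ 2 / (1 + s ^+ 2)]. *)
Lemma levy_tail_lty s : 0 < s -> (nu [set x | (s <= enorm x)%R] < +oo)%E.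
Proof.
move=> s0; have mD := measurable_enorm_ge (p := p) s.
have k0 : 0 <= (1 + s ^+ 2) / s ^+ 2 by rewrite divr_ge0 ?addr_ge0 ?sqr_ge0.
have /integrableP[_] := integrableZl measurableT ((1 + s ^+ 2) / s ^+ 2)
  integrable_sqr_norm_frac.
apply: le_lt_trans; rewrite -[X in (X <= _)%E]mul1e -integral_cst//.
rewrite [X in (X <= _)%E]integral_mkcond; apply: ge0_le_integral => //.
- by move=> x _; rewrite patchE; case: ifP.
- by apply/(measurable_restrictT _ mD).
- apply: measurableT_comp => //; apply/measurable_EFinP;
    apply: measurable_funM => //.
  exact: measurable_sqr_norm_frac.
- move=> x _; rewrite patchE; case: ifPn => [|_]; last first.
    by rewrite abse_ge0.
  rewrite inE/= enorm_ge ?(ltW s0)// lee_fin => sx.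
  rewrite (le_trans _ (ler_norm _))//.
  have q1 : 0 < 1 + dotp x x by rewrite ltr_wpDr// dotp_ge0.
  rewrite mulrA ler_pdivlMr// mul1r mulrAC ler_pdivlMr ?exprn_gt0//.
  by rewrite mulrDl mulrDl !mul1r lerD// mulrC.
Qed.

Lemma integrable_bounded_on (D : set V) f C : measurable D -> (nu D < +oo)%E ->
  measurable_fun setT f -> (forall x, D x -> `|f x| <= C) ->
  nu.-integrable D (EFin \o f).
Proof.
move=> mD nuD mf fC; apply: measurable_bounded_integrable => //.
  exact: measurable_funTS.
by exists C; split; [exact: num_real|move=> A CA x /fC xC;
  exact/(le_trans xC)/ltW].
Qed.

(** Dominated convergence with the absolute value of [f] as majorant. At the origin, which [D n] may
    or may not contain, the quadratic bound makes [f] vanish. *)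
Lemma levy_Rintegral_cvg (D : nat -> set V) f C :
  (forall n, measurable (D n)) ->
  (forall n x, n.+1%:R^-1 <= enorm x -> D n x) ->
  measurable_fun setT f ->
  (forall x, `|f x| <= C * dotp x x) -> (forall x, `|f x| <= C) ->
  \int[nu]_(x in D n) f x @[n --> \oo] --> \int[nu]_x f x.
Proof.
move=> mD D_large mf fq fC; have fi := levy_integrable mf fq fC.
have [|||||_ _] := @dominated_convergence _ _ _ nu setT measurableT
  (fun n x => ((f \_ (D n)) x)%:E) (EFin \o f) (fun x => `|f x|%:E).
- move=> n; apply/measurable_EFinP; apply/(measurable_restrictT _ (mD n)).
  exact: measurable_funTS.
- exact/measurable_EFinP.
- apply/aeW => x _; apply: cvg_EFin; first exact: nearW.
  have [x0|x0] := eqVneq (dotp x x) 0.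
    have fx0 : f x = 0.
      by apply/eqP; rewrite -normr_le0 (le_trans (fq x))// x0 mulr0.
    rewrite fx0; apply: cvg_near_cst; apply: nearW => n /=.
    by rewrite patchE; case: ifP.
  have e0 : 0 < enorm x.
    by rewrite sqrtr_gt0 lt0r x0 dotp_ge0.
  apply: cvg_near_cst; have := @cvg_harmonic R => /cvgrPdist_lt/(_ _ e0).
  apply: filterS => n;
    rewrite /harmonic/= sub0r normrN ger0_norm ?invr_ge0// => nx.
  by rewrite patchE mem_set//; apply: D_large; exact: ltW.
- exact: (integrable_abse fi).
- apply/aeW => x n _; rewrite lee_fin patchE; case: ifP => // _.
  by rewrite normr0.
rewrite -(fineK (integrable_fin_num measurableT fi)) => /fine_cvgP[_].
rewrite -[X in X @ _ --> _]/(fun n => \int[nu]_x (f \_ (D n)) x).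
by under eq_cvg do rewrite -Rintegral_mkcond.
Qed.

End levy_measures.

(** * The approximating steps and their moments *)

Section approximation_row.
Context {R : realType} {p : nat}.
Local Notation V := 'rV[R]_p.
Variables (nu : {measure set V -> \bar R}) (a : V) (vs : seq V) (tau : R).
Hypotheses (nuL : levy_measure nu) (tau0 : 0 < tau).
Implicit Types (x y t : V) (n N : nat) (K : probability V R).

Lemma norm_dotp_le x y : `|dotp x y| <= (1 + dotp x x) * (1 + dotp y y).
Proof.
have := cauchy_schwarz x y; rewrite -real_normK ?num_real//.
move: (normr_ge0 (dotp x y)) (dotp_ge0 x) (dotp_ge0 y).
move: `|_| (dotp x x) (dotp y y) => d X Y d0 X0 Y0 h.
have := sqr_ge0 (d - 1); nra.
Qed.

Lemma norm_dotp_frac_le x y : `|dotp x y / (1 + dotp y y)| <= 1 + dotp x x.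
Proof.
have q1 : 0 < 1 + dotp y y by rewrite ltr_wpDr// dotp_ge0.
by rewrite normrM normfV (gtr0_norm q1) ler_pdivrMr// norm_dotp_le.
Qed.

Lemma measurable_dotp_frac x :
  measurable_fun setT (fun y : V => dotp x y / (1 + dotp y y)).
Proof.
have -> : (fun y : V => dotp x y / (1 + dotp y y)) =
    (fun y => dotp x y * (1 - dotp y y / (1 + dotp y y))).
  apply/funext => y; have q1 : 0 < 1 + dotp y y by rewrite ltr_wpDr// dotp_ge0.
  by field; exact: lt0r_neq0.
apply: measurable_funM; first exact: measurable_dotp.
by apply: measurable_funB => //; exact: measurable_sqr_norm_frac.
Qed.

Definition tail_set : set V := [set x | tau <= enorm x].
Definition ring_set n : set V := [set x | n.+1%:R^-1 <= enorm x] `\` tail_set.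
(** A union, because for small [n] the cutoff [1 / (n + 1)] may exceed [tau], and the tail has to
    belong to every [outer_set n]. *)
Definition outer_set n : set V := ring_set n `|` tail_set.

Lemma measurable_tail_set : measurable tail_set.
Proof. exact: measurable_enorm_ge. Qed.

Lemma measurable_ring_set n : measurable (ring_set n).
Proof. by apply: measurableD; exact: measurable_enorm_ge. Qed.

Lemma measurable_outer_set n : measurable (outer_set n).
Proof. exact: measurableU (measurable_ring_set n) measurable_tail_set. Qed.

Lemma tail_set_lty : (nu tail_set < +oo)%E.
Proof. exact: (levy_tail_lty nuL tau0). Qed.

Lemma ring_set_lty n : (nu (ring_set n) < +oo)%E.
Proof.
apply: le_lt_trans (levy_tail_lty nuL (s := n.+1%:R^-1) _);
  last by rewrite invr_gt0.
apply: le_measure; rewrite ?inE.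
- exact: measurable_ring_set.
- exact: measurable_enorm_ge.
- by move=> x [].
Qed.

Lemma outer_set_lty n : (nu (outer_set n) < +oo)%E.
Proof.
apply: (@le_lt_trans _ _ (nu (ring_set n) + nu tail_set)%E).
  by apply: measureU2; [exact: measurable_ring_set|exact: measurable_tail_set].
by rewrite lte_add_pinfty// ?ring_set_lty// tail_set_lty.
Qed.

Lemma disj_ring_tail n : [disjoint ring_set n & tail_set].
Proof. by apply/disj_setPS => x [[_ xt] /xt]. Qed.

Lemma ring_set_sqr n x : ring_set n x -> dotp x x <= tau ^+ 2.
Proof.
move=> [_ /negP]; rewrite -ltNge => xt.
by rewrite -enorm_sqr lerXn2r ?nnegrE ?sqrtr_ge0// ltW.
Qed.

Lemma Rintegral_outer n (f : V -> R) (C : R) : measurable_fun setT f ->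
  (forall x, `|f x| <= C) ->
  \int[nu]_(x in outer_set n) f x =
  \int[nu]_(x in ring_set n) f x + \int[nu]_(x in tail_set) f x.
Proof.
move=> mf fC; rewrite Rintegral_setU//.
- exact: measurable_ring_set.
- exact: measurable_tail_set.
- apply: (@integrable_bounded_on _ _ _ _ _ C) => //;
    first exact: measurable_outer_set.
  exact: outer_set_lty.
- exact: disj_ring_tail.
Qed.

(** Away from the origin the compensator integrates to a vector; moving it into the drift leaves
    uncompensated jumps, which a random walk can realise. *)
Lemma Rintegral_dotp_frac_barycenter n : exists c : V, forall t,
  dotp t c = \int[nu]_(x in outer_set n) (dotp t x / (1 + dotp x x)).
Proof.
exists (\row_i \int[nu]_(x in outer_set n) (x ord0 i / (1 + dotp x x))) => t.
have fi (u : V) : nu.-integrable (outer_set n)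
  (EFin \o (fun x => dotp u x / (1 + dotp x x))).
  apply: (@integrable_bounded_on _ _ _ _ _ (1 + dotp u u)) => //.
  - exact: measurable_outer_set.
  - exact: outer_set_lty.
  - exact: measurable_dotp_frac.
  - by move=> x _; exact: norm_dotp_frac_le.
pose tr (s : seq 'I_p) : V := \sum_(i <- s) t ord0 i *: delta_mx ord0 i.
have dl i : \int[nu]_(x in outer_set n) (x ord0 i / (1 + dotp x x)) =
    \int[nu]_(x in outer_set n) (dotp (delta_mx ord0 i) x / (1 + dotp x x)).
  by apply: eq_Rintegral => x _; rewrite dotp_delta.
have h s : \sum_(i <- s) t ord0 i *
      \int[nu]_(x in outer_set n) (x ord0 i / (1 + dotp x x)) =
    \int[nu]_(x in outer_set n) (dotp (tr s) x / (1 + dotp x x)).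
  elim: s => [|i s ih].
    rewrite big_nil /tr big_nil; under eq_Rintegral do
      rewrite dotpC dotp0r mul0r.
    by rewrite Rintegral_cst ?mul0r//; exact: measurable_outer_set.
  rewrite big_cons ih dl -RintegralZl//; last exact: measurable_outer_set.
  rewrite -RintegralD//; last 2 first.
  - exact: measurable_outer_set.
  - by apply: integrableZl_EFin => //; exact: measurable_outer_set.
  apply: eq_Rintegral => x _; rewrite /tr big_cons dotpDl dotpZl.
  by rewrite mulrDl mulrA.
rewrite /dotp; under eq_bigr do rewrite mxE; rewrite h.
suff -> : tr (index_enum 'I_p) = t by [].
by rewrite /tr [RHS]row_sum_delta.
Qed.

Lemma Re_cf_sub1 K t : complex.Re (cf K t) - 1 = \int[K]_x (cos (dotp t x) - 1).
Proof.
rewrite RintegralB//.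
- by rewrite Rintegral_cst//; have /= -> := probability_setT K; rewrite mulr1.
- exact/(bounded_mfun_integrable K)/bounded_cos_dotp.
- exact/(bounded_mfun_integrable K)/bounded_mfun_cst.
Qed.

Definition levy_mass : R := \int[nu]_x (dotp x x / (1 + dotp x x)).
Definition tail_mass : R := fine (nu tail_set).
Definition gauss_mass : R := \sum_(v <- vs) dotp v v.
(** The terms bound in turn the squared lengths of the drift step, of a jump in the ring and of a
    Gaussian jump. *)
Definition radius2 : R := 1 + tau ^+ 2 + gauss_mass.
(** Collects, independently of [n], the contributions to [N] times the second moment and to [N]
    times the mean of a step. *)
Definition moment_bound : R :=
  1 + dotp a a + tail_mass + (1 + tau ^+ 2) * levy_mass + 1 + gauss_mass.

Lemma levy_mass_ge0 : 0 <= levy_mass.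
Proof. by apply: Rintegral_ge0 => x _;
  rewrite divr_ge0 ?addr_ge0 ?dotp_ge0. Qed.

Lemma tail_mass_ge0 : 0 <= tail_mass.
Proof. by rewrite fine_ge0. Qed.

Lemma gauss_mass_ge0 : 0 <= gauss_mass.
Proof. by apply: sumr_ge0 => v _; exact: dotp_ge0. Qed.

(** On the ring [dotp x x] is at most [1 + tau ^+ 2] times the Levy integrand, so quadratic
    functions stay under control however small the cutoff. *)
Lemma Rintegral_ring_le n (f : V -> R) (C : R) : 0 <= C ->
  measurable_fun setT f -> (forall x, ring_set n x -> `|f x| <= C * dotp x x) ->
  \int[nu]_(x in ring_set n) f x <= C * ((1 + tau ^+ 2) * levy_mass).
Proof.
move=> C0 mf fq; have mD := measurable_ring_set n.
have qi := integrableS measurableT mD (@subsetT _ _)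
  (integrable_sqr_norm_frac nuL).
have t1 : 0 <= 1 + tau ^+ 2 by rewrite addr_ge0// sqr_ge0.
apply: (@le_trans _ _ (\int[nu]_(x in ring_set n)
    (C * (1 + tau ^+ 2) * (dotp x x / (1 + dotp x x))))).
  apply: le_Rintegral => //.
  - apply: (@integrable_bounded_on _ _ _ _ _ (C * tau ^+ 2)) => //.
      exact: ring_set_lty.
    by move=> x xr; rewrite (le_trans (fq x xr))// ler_wpM2l//;
      exact: ring_set_sqr xr.
  - exact: integrableZl_EFin.
  move=> x xr; rewrite (le_trans (ler_norm _))// (le_trans (fq x xr))//.
  rewrite -mulrA ler_wpM2l//.
  have q0 := dotp_ge0 x; have q1 : 0 < 1 + dotp x x by rewrite ltr_wpDr.
  rewrite mulrA ler_pdivlMr// mulrC ler_wpM2r// lerD2l.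
  exact: ring_set_sqr xr.
rewrite RintegralZl// -mulrA ler_wpM2l// ler_wpM2l//.
rewrite /levy_mass /Rintegral fine_le//.
- exact: integrable_fin_num.
- exact/integrable_fin_num/integrable_sqr_norm_frac.
apply: ge0_subset_integral => //.
- exact: (measurable_int _ (integrable_sqr_norm_frac nuL)).
- by move=> x _; rewrite lee_fin divr_ge0 ?addr_ge0 ?dotp_ge0.
Qed.

(* [K] carries the drift, the Gaussian part and the jumps in [ring_set n], [L]
   the jumps of norm at least [tau]: [n.+1] sets the jump cutoff and the size
   of the Gaussian steps, and [N] is the number of steps of the walk. *)
Definition row_approximation n N (K L : probability V R) : Prop :=
  [/\ (n < N)%N, 2 * tail_mass <= N%:R,
   (forall t,
    `|N%:R * (complex.Re (cf K t) - 1) + \int[nu]_(x in tail_set)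
      (cos (dotp t x) - 1) -
      (\int[nu]_(x in outer_set n) (cos (dotp t x) - 1) +
       \sum_(v <- vs) n.+1%:R ^+ 2 * (cos (dotp v t / n.+1%:R) - 1))|
      <= dotp t t / n.+1%:R) /\
   (forall t,
    `|N%:R * complex.Im (cf K t) + \int[nu]_(x in tail_set) sin (dotp t x) -
      (dotp t a + \int[nu]_(x in outer_set n)
        (sin (dotp t x) - dotp t x / (1 + dotp x x)))| <= dotp t t / n.+1%:R),
   [/\ K [set y | radius2 < dotp y y] = 0%E,
     K.-integrable setT (fun y => (dotp y y)%:E),
     (forall x, K.-integrable setT (fun y => (dotp x y)%:E)),
     \int[K]_y dotp y y <= moment_bound / N%:R &
     (forall x, \int[K]_y dotp x y <= moment_bound * (1 + dotp x x) / N%:R)] &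
   forall f : V -> \bar R, measurable_fun setT f -> (forall x, 0 <= f x)%E ->
    (\int[L]_x f x = (1 - tail_mass / N%:R)%:E * f 0%R +
      (N%:R^-1)%:E * \int[nu]_(x in tail_set) f x)%E].

(** The jumps reproduce the truncated exponent exactly; only the drift step contributes an error,
    made small by choosing [N] after [n]. *)
Lemma row_approximation_exists n : exists N K L, row_approximation n N K L.
Proof.
have [c cE] := Rintegral_dotp_frac_barycenter n.
pose b := a - c; pose m := size vs; pose u k : V := n.+1%:R^-1 *: nth 0 vs k.
(* Jumps [v / (n + 1)] in both directions at this rate add [(n + 1) ^+ 2 * (cos (dotp v t / (n + 1))
   - 1)] to the exponent, which tends to the Gaussian term. *)
pose w : R := n.+1%:R ^+ 2 / 2.
have mD := measurable_ring_set n; have nuD := ring_set_lty n.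
have n0 : 0 < n.+1%:R :> R by rewrite ltr0n.
have w0 : 0 <= w by rewrite divr_ge0// sqr_ge0.
pose lam := fine (nu (ring_set n)) + 2 * w * m%:R.
have lam0 : 0 <= lam by rewrite addr_ge0 ?fine_ge0// !mulr_ge0.
(* The three summands secure a nonnegative drift probability, a small drift error, and
   [2 * tail_mass <= N] for the large-jump walk. *)
have [N [nN NE]] : exists N, (n < N)%N /\
    lam + (1 + n.+1%:R * dotp b b) + 2 * tail_mass <= N%:R.
  exists (maxn n.+1
    (Num.truncn (lam + (1 + n.+1%:R * dotp b b) + 2 * tail_mass)).+1).
  split; first by rewrite leq_max leqnn.
  by rewrite natr_max le_max (ltW (truncnS_gt _)) orbT.
have qb0 := dotp_ge0 b; have tm0 := tail_mass_ge0.
have N0 : 0 < N%:R :> R by rewrite ltr0n (leq_ltn_trans _ nN).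
(* [N'] is [N] times the probability of the drift step, so drift steps of [b / N'] have total mean
   [b] over the [N] steps. *)
pose N' := N%:R - lam.
have nqb0 : 0 <= n.+1%:R * dotp b b by rewrite mulr_ge0.
have N'ge : 1 + n.+1%:R * dotp b b <= N' by rewrite /N'; lra.
have N'0 : 0 < N' by lra.
have lamN : lam <= N%:R by lra.
have tmN : 2 * tail_mass <= N%:R by lra.
have [K KE] := step_law u mD nuD (N'^-1 *: b) w0 N0 lamN.
have KR := step_law_Rintegral mD KE.
have tmN1 : fine (nu tail_set) + 2 * 0 * 0%N%:R <= N%:R.
  by rewrite !mulr0 addr0 -/tail_mass; lra.
have [L LE] := step_law u measurable_tail_set tail_set_lty 0 (lexx 0) N0 tmN1.
have NKE (f : V -> R) : measurable_fun setT f ->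
  nu.-integrable (ring_set n) (EFin \o f) ->
    N%:R * \int[K]_x f x = N' * f (N'^-1 *: b) +
      (\int[nu]_(x in ring_set n) f x +
      \sum_(v <- vs) w * (f (n.+1%:R^-1 *: v) + f (- (n.+1%:R^-1 *: v)))).
  move=> mf fi; have [_ ->] := KR f mf fi.
  rewrite (big_nth 0) big_mkord /N' -/m -/lam mulrDr !mulrA.
  congr (_ * _ + _).
    by field; exact: lt0r_neq0.
  by rewrite divff ?mul1r// lt0r_neq0.
have bi (f : V -> R) C : measurable_fun setT f ->
  (forall x, ring_set n x -> `|f x| <= C) ->
    nu.-integrable (ring_set n) (EFin \o f).
  by move=> mf fC; exact: (integrable_bounded_on mD nuD mf fC).
have yb t : dotp t b ^+ 2 / N' <= dotp t t / n.+1%:R.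
  rewrite ler_pdivrMr// mulrAC ler_pdivlMr//.
  rewrite (le_trans (ler_wpM2r (ltW n0) (cauchy_schwarz t b)))//.
  rewrite -mulrA ler_wpM2l ?dotp_ge0// mulrC; lra.
have rq x : ring_set n x -> `|dotp x x| <= tau ^+ 2.
  by move=> xr; rewrite ger0_norm ?dotp_ge0// (ring_set_sqr xr).
have rq1 x : ring_set n x -> `|dotp x x| <= 1 * dotp x x.
  by move=> _; rewrite mul1r ger0_norm// dotp_ge0.
have rx x y : ring_set n y -> `|dotp x y| <= (1 + dotp x x) * (1 + tau ^+ 2).
  move=> yr; rewrite (le_trans (norm_dotp_le x y))// ler_wpM2l ?addr_ge0
    ?dotp_ge0//.
  by rewrite lerD2l (ring_set_sqr yr).
exists N, K, L; split=> //.
- split=> t.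
  + have mc1 : measurable_fun setT (fun x : V => cos (dotp t x) - 1).
      by apply: measurable_funB => //; have [] := bounded_cos_dotp t.
    have c1 x : `|cos (dotp t x) - 1| <= 2.
      rewrite (le_trans (ler_normB _ _))// normr1 (_ : 2 = 1 + 1)//.
      by rewrite lerD2r cos_max.
    rewrite Re_cf_sub1 NKE//; last exact: (bi _ 2).
    rewrite (Rintegral_outer n mc1 c1).
    rewrite (eq_bigr (fun v => n.+1%:R ^+ 2 * (cos (dotp v t / n.+1%:R) - 1)));
      last first.
      move=> v _; rewrite dotpNr cosN dotpZr (dotpC t) [_^-1 * _]mulrC /w.
      by field.
    (* Ring, tail and Gaussian terms cancel; the drift step alone remains. *)
    rewrite (_ : _ - _ = N' * (cos (dotp t (N'^-1 *: b)) - 1)); last by ring.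
    rewrite normrM (gtr0_norm N'0)
      (le_trans (ler_wpM2l (ltW N'0) (cos_sub1_le _)))//.
    rewrite (le_trans _ (yb t))// dotpZr exprMn.
    rewrite (_ : N' * _ = dotp t b ^+ 2 / N' / 2); last by field;
      exact: lt0r_neq0.
    rewrite ler_pdivrMr// ler_peMr ?ler1n//.
    by rewrite divr_ge0 ?sqr_ge0// ltW.
  + have [ms _] := bounded_sin_dotp t.
    have s1 x : `|sin (dotp t x)| <= 1 by exact: sin_max.
    rewrite /cf/= NKE//; last exact: (bi _ 1).
    rewrite big1 ?addr0; last first.
      by move=> v _; rewrite dotpNr sinN subrr mulr0.
    have E : \int[nu]_(x in outer_set n) sin (dotp t x) =
        \int[nu]_(x in ring_set n) sin (dotp t x) +
        \int[nu]_(x in tail_set) sin (dotp t x) := Rintegral_outer n ms s1.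
    rewrite RintegralB//; last 3 first.
    - exact: measurable_outer_set.
    - by apply: (integrable_bounded_on (measurable_outer_set n)
        (outer_set_lty n) ms (C := 1)).
    - apply: (integrable_bounded_on (measurable_outer_set n) (outer_set_lty n)
        (measurable_dotp_frac t) (C := 1 + dotp t t)) => x _.
      exact: norm_dotp_frac_le.
    rewrite -cE.
    have tb : dotp t b = dotp t a - dotp t c by rewrite dotpDr dotpNr.
    rewrite (_ : _ - _ =
      N' * (sin (dotp t (N'^-1 *: b)) - dotp t (N'^-1 *: b))); last first.
      by rewrite E !dotpZr tb; field; exact: lt0r_neq0.
    rewrite normrM (gtr0_norm N'0)
      (le_trans (ler_wpM2l (ltW N'0) (sin_sub_le _)))//.
    rewrite (le_trans _ (yb t))// dotpZr exprMn.
    by rewrite (_ : N' * _ = dotp t b ^+ 2 / N')//; field; exact: lt0r_neq0.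
- split.
  + pose A : set V := [set y | radius2 < dotp y y].
    have mA : measurable A.
      rewrite -[A]setTI; apply: measurable_fun_ltr => //;
        exact: measurable_dotp_diag.
    have nA y : dotp y y <= radius2 -> (\1_A y)%:E = 0%E :> \bar R.
      by move=> yr; rewrite indicE memNset//= => /lt_geF; rewrite yr.
    rewrite -/A -(setIT A) -integral_indic// KE//; last first.
      by apply/measurable_EFinP; exact: measurable_indic.
    rewrite nA ?mule0 ?add0e; last first.
      rewrite dotpZl dotpZr mulrA -invfM mulrC ler_pdivrMr ?mulr_gt0//.
      rewrite (@le_trans _ _ (1 * (N' * N')))//; last first.
        by rewrite ler_wpM2r ?mulr_ge0 ?(ltW N'0)// /radius2 -addrA lerDl
          addr_ge0 ?sqr_ge0 ?gauss_mass_ge0.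
      have : dotp b b <= n.+1%:R * dotp b b by rewrite ler_peMl// ler1n.
      by nra.
    rewrite integral0_eq ?add0e; last first.
      move=> y yr; apply: nA; rewrite (le_trans (ring_set_sqr yr))//.
      by rewrite /radius2 addrAC lerDr addr_ge0// gauss_mass_ge0.
    rewrite big1 ?mule0// => k _.
    have uk : dotp (u k) (u k) <= radius2.
      rewrite /u dotpZl dotpZr mulrA.
      apply: (@le_trans _ _ (dotp (nth 0 vs k) (nth 0 vs k))).
        by rewrite ler_piMl ?dotp_ge0// mulr_ile1 ?invr_ge0// invf_le1// ler1n.
      apply: (@le_trans _ _ gauss_mass); last first.
        by rewrite /radius2 lerDr addr_ge0// sqr_ge0.
      rewrite /gauss_mass (big_nth 0) big_mkord (bigD1 k)//= lerDl.
      by apply: sumr_ge0 => i _; exact: dotp_ge0.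
    by rewrite !nA ?adde0 ?mule0// dotpNl dotpNr opprK.
  + by have [] := KR _ measurable_dotp_diag (bi _ _ measurable_dotp_diag rq).
  + by move=> x; have [] := KR _ (measurable_dotp x)
      (bi _ _ (measurable_dotp x) (rx x)).
  + rewrite ler_pdivlMr// mulrC NKE//; last first.
      by apply: (bi _ (tau ^+ 2)) => //; exact: measurable_dotp_diag.
      exact: measurable_dotp_diag.
    rewrite (eq_bigr (fun v => dotp v v)); last first.
      move=> v _; rewrite dotpNl dotpNr opprK dotpZl dotpZr /w.
      by field.
    rewrite -/gauss_mass addrA /moment_bound lerD2r.
    have h1 : N' * dotp (N'^-1 *: b) (N'^-1 *: b) <= 1.
      rewrite dotpZl dotpZr (_ : N' * _ = dotp b b / N'); last first.
        by field; exact: lt0r_neq0.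
      rewrite ler_pdivrMr// mul1r.
      have : dotp b b <= n.+1%:R * dotp b b by rewrite ler_peMl// ler1n.
      lra.
    have h2 := Rintegral_ring_le ler01 measurable_dotp_diag rq1.
    have := dotp_ge0 a; rewrite mul1r in h2; lra.
  + move=> x; rewrite ler_pdivlMr// mulrC NKE//; last first.
      exact: (bi _ _ (measurable_dotp x) (rx x)).
      exact: measurable_dotp.
    rewrite big1 ?addr0; last first.
      by move=> v _; rewrite dotpNr subrr mulr0.
    rewrite dotpZr mulrA divff ?lt0r_neq0// mul1r.
    rewrite /b dotpDr dotpNr cE.
    rewrite (Rintegral_outer n (measurable_dotp_frac x) (norm_dotp_frac_le x)).
    have fi : nu.-integrable (ring_set n)
      (EFin \o (fun y => dotp x y / (1 + dotp y y))).
      by apply: (bi _ (1 + dotp x x)) => [|y _];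
        [exact: measurable_dotp_frac|exact: norm_dotp_frac_le].
    (* The mean of the ring jumps and their compensator are taken together: the difference is of
       second order near 0, while each alone may diverge as the cutoff shrinks. *)
    have h1 : \int[nu]_(y in ring_set n)
      (dotp x y - dotp x y / (1 + dotp y y)) <=
        (1 + dotp x x) * ((1 + tau ^+ 2) * levy_mass).
      apply: Rintegral_ring_le; first by rewrite addr_ge0// dotp_ge0.
        by apply: measurable_funB;
          [exact: measurable_dotp|exact: measurable_dotp_frac].
      move=> y _; have q1 : 0 < 1 + dotp y y by rewrite ltr_wpDr// dotp_ge0.
      rewrite (_ : _ - _ = dotp x y / (1 + dotp y y) * dotp y y); last first.
        by field; exact: lt0r_neq0.
      by rewrite normrM (ger0_norm (dotp_ge0 y)) ler_wpM2r
        ?dotp_ge0// norm_dotp_frac_le.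
    rewrite RintegralB// in h1; last exact: (bi _ _ (measurable_dotp x) (rx x)).
    have h2 : - (\int[nu]_(y in tail_set) (dotp x y / (1 + dotp y y))) <=
        (1 + dotp x x) * tail_mass.
      rewrite (le_trans (ler_norm _))// normrN.
      have ti : nu.-integrable tail_set
        (EFin \o (fun y => dotp x y / (1 + dotp y y))).
        apply: (integrable_bounded_on measurable_tail_set tail_set_lty
          (measurable_dotp_frac x) (C := 1 + dotp x x)) => y _.
        exact: norm_dotp_frac_le.
      rewrite (le_trans (le_normr_Rintegral measurable_tail_set ti))//.
      rewrite -Rintegral_cst; last exact: measurable_tail_set.
      apply: le_Rintegral.
      - exact: measurable_tail_set.
      - exact: integrable_norm.
      - apply: (integrable_bounded_on measurable_tail_set tail_set_lty
          (measurable_cst _) (C := `|1 + dotp x x|)) => //.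
      - by move=> y _; exact: norm_dotp_frac_le.
    have h3 : dotp x a <= (1 + dotp x x) * (1 + dotp a a).
      by rewrite (le_trans (ler_norm _))// norm_dotp_le.
    have h4 : 0 <= (1 + dotp x x) * (1 + gauss_mass).
      by rewrite mulr_ge0 ?addr_ge0 ?dotp_ge0 ?gauss_mass_ge0.
    rewrite /moment_bound; move: h1 h2 h3 h4; lra.
- by move=> f mf f0; rewrite LE// big_ord0 adde0 !mulr0 addr0.
Qed.

End approximation_row.

(** * Exponential bounds and the Gaussian limit *)

Section exponential_bounds.
Context {R : realType}.

Lemma one_plus_expn_le (C : R) N : 0 <= C -> (0 < N)%N ->
  (1 + C / N%:R) ^+ N <= expR C.
Proof.
move=> C0 N0; have N0' : 0 < N%:R :> R by rewrite ltr0n.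
rewrite -[leRHS](_ : expR (N%:R * (C / N%:R)) = _); last first.
  by congr expR; rewrite mulrC divfK// lt0r_neq0.
rewrite expRM_natl lerXn2r ?nnegrE ?expR_ge0 ?expR_ge1Dx//.
by rewrite addr_ge0// divr_ge0.
Qed.

(** For [0 <= u <= 1 / 2], [(1 - u) * (1 + 2 * u) >= 1] gives [1 - u >= expR (- (2 * u))]; hence the
    requirement [2 * tail_mass <= N] on the walks. *)
Lemma one_minus_expn_ge (c : R) N : 0 <= c -> (0 < N)%N -> 2 * c <= N%:R ->
  expR (- (2 * c)) <= (1 - c / N%:R) ^+ N.
Proof.
move=> c0 N0 cN; have N0' : 0 < N%:R :> R by rewrite ltr0n.
set u := c / N%:R.
have u0 : 0 <= u by rewrite divr_ge0.
have u2 : 2 * u <= 1 by rewrite /u mulrA ler_pdivrMr// mul1r.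
have -> : - (2 * c) = N%:R * (- (2 * u)).
  by rewrite /u; field; exact: lt0r_neq0.
rewrite expRM_natl lerXn2r ?nnegrE ?expR_ge0//; first by lra.
rewrite expRN -[leLHS]mul1r ler_pdivrMr ?expR_gt0//.
rewrite (@le_trans _ _ ((1 - u) * (1 + 2 * u)))//; first by nra.
by rewrite ler_wpM2l ?expR_ge1Dx//; lra.
Qed.

(** The half-angle formula and the quadratic bound on [sin z - z] leave an error of at most the cube
    of the absolute value of [y], divided by [n + 1]. *)
Lemma cvg_sqr_cos_scaled (y : R) :
  n.+1%:R ^+ 2 * (cos (y / n.+1%:R) - 1) @[n --> \oo] --> - (y ^+ 2 / 2).
Proof.
have s0 n : 0 < n.+1%:R :> R by rewrite ltr0n.
apply: (@squeeze_cvgr _ _ _ _ (fun n => - (y ^+ 2 / 2))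
  (fun n => - (y ^+ 2 / 2) + `|y| ^+ 3 * n.+1%:R^-1)) => //; last 2 first.
- exact: cvg_cst.
- rewrite -[X in _ --> X]addr0 -(mulr0 (`|y| ^+ 3)).
  apply: cvgD; first exact: cvg_cst.
  by apply: cvgM; [exact: cvg_cst|exact: cvg_harmonic].
apply: nearW => n; set s := n.+1%:R; have {}s0 : 0 < s by exact: s0.
pose z := y / s / 2.
have zE : cos (y / s) - 1 = - (2 * sin z ^+ 2) by rewrite -opprB one_sub_cos.
have yE : y ^+ 2 / 2 = s ^+ 2 * (2 * z ^+ 2).
  by rewrite /z; field; exact: lt0r_neq0.
have y3 : `|y| ^+ 3 / s = s ^+ 2 * (8 * `|z| ^+ 3).
  rewrite /z !normrM !normfV (gtr0_norm s0) (ger0_norm (ler0n _ 2)).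
  by field; exact: lt0r_neq0.
rewrite zE yE y3 -mulrN -mulrDr !ler_pM2l ?exprn_gt0//.
have h1 := norm_sin_le z; have h2 := sin_sub_le z.
have z2 : sin z ^+ 2 <= z ^+ 2.
  by rewrite -(real_normK (num_real (sin z))) -(real_normK (num_real z))
    lerXn2r ?nnegrE.
have h3 : z ^+ 2 - sin z ^+ 2 <= 2 * `|z| ^+ 3.
  have -> : z ^+ 2 - sin z ^+ 2 = - (sin z - z) * (z + sin z) by ring.
  rewrite (le_trans (ler_norm _))// normrM normrN.
  have h4 : `|z + sin z| <= 2 * `|z|.
    by rewrite (le_trans (ler_normD _ _))// mulr_natl mulr2n lerD2l.
  rewrite (le_trans (ler_pM _ _ h2 h4))//.
  by rewrite -(real_normK (num_real z)) le_eqVlt; apply/orP; left;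
    apply/eqP; ring.
have := exprn_ge0 3 (normr_ge0 z); move: z2 h3; set z3 := `|z| ^+ 3; lra.
Qed.

End exponential_bounds.

(** * Convergence to the Levy exponent *)

Section levy_exponent.
Context {R : realType} {p : nat}.
Local Notation V := 'rV[R]_p.
Local Open Scope complex_scope.
Import Normc.
Variables (nu : {measure set V -> \bar R}) (a : V) (vs : seq V) (tau : R).
Variable (Q : V -> R).
Hypotheses (nuL : levy_measure nu) (tau0 : 0 < tau).
Hypothesis QE : forall t, Q t = \sum_(v <- vs) dotp v t ^+ 2.
Implicit Types (x t : V) (K L : probability V R).

Definition levy_exponent t : R[i] :=
  (- (2^-1 * Q t) + \int[nu]_x (cos (dotp t x) - 1)) +i*
  (dotp t a + \int[nu]_x (sin (dotp t x) - dotp t x / (1 + dotp x x))).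

Lemma levy_khintchineE t : levy_khintchine a Q nu t = cexp (levy_exponent t).
Proof.
rewrite /levy_khintchine /cintegral /levy_exponent; congr cexp; simpc.
congr (_ +i* _).
  congr (_ + _); apply: eq_Rintegral => x _.
  by rewrite -fmorphV /=; simpc; rewrite /= expR0 mul1r.
rewrite dotpC; congr (_ + _); apply: eq_Rintegral => x _.
by rewrite -fmorphV /=; simpc; rewrite /= expR0 mul1r enorm_sqr.
Qed.

Lemma levy_exponent_Re_le0 t : complex.Re (levy_exponent t) <= 0.
Proof.
rewrite /= -[leRHS]addr0 lerD//.
  by rewrite oppr_le0 QE mulr_ge0// sumr_ge0// => v _; exact: sqr_ge0.
have -> : \int[nu]_x (cos (dotp t x) - 1) = - \int[nu]_x (1 - cos (dotp t x)).
  rewrite /Rintegral; under eq_integral do rewrite -opprB EFinN.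
  rewrite integral_ge0N ?fineN//.
by rewrite oppr_le0; apply: Rintegral_ge0 => x _; rewrite subr_ge0 cos_le1.
Qed.

Lemma measurable_cos_sub1 t : measurable_fun setT
  (fun x : V => cos (dotp t x) - 1).
Proof. by apply: measurable_funB => //; have [] := bounded_cos_dotp t. Qed.

Lemma cvg_levy_exponent_Re t :
  \int[nu]_(x in outer_set tau n) (cos (dotp t x) - 1) +
    \sum_(v <- vs) n.+1%:R ^+ 2 * (cos (dotp v t / n.+1%:R) - 1)
      @[n --> \oo] -->
  complex.Re (levy_exponent t).
Proof.
rewrite /= addrC; apply: cvgD.
  apply: (levy_Rintegral_cvg nuL (C := 2 + dotp t t)).
  - exact: measurable_outer_set.
  - move=> n x nx; have [xt|/negP xt] := boolP (tau <= enorm x); first by right.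
    by left; split.
  - exact: measurable_cos_sub1.
  - move=> x; have := cos_sub1_le (dotp t x); have := cauchy_schwarz t x.
    have := sqr_ge0 (dotp t x); have := dotp_ge0 x; have := dotp_ge0 t; nra.
  - move=> x; rewrite (le_trans (ler_normB _ _))// normr1.
    by have := cos_max (dotp t x); have := dotp_ge0 t; lra.
have -> : - (2^-1 * Q t) = \sum_(v <- vs) - (dotp v t ^+ 2 / 2).
  by rewrite QE sumrN mulr_sumr; congr (- _); apply: eq_bigr => v _;
    rewrite mulrC.
apply: cvg_big => [|v _]; last exact: cvg_sqr_cos_scaled.
exact: add_continuous.
Qed.

Lemma cvg_levy_exponent_Im t :
  dotp t a + \int[nu]_(x in outer_set tau n)
      (sin (dotp t x) - dotp t x / (1 + dotp x x)) @[n --> \oo] -->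
  complex.Im (levy_exponent t).
Proof.
apply: cvgD; first exact: cvg_cst.
have [ms _] := bounded_sin_dotp t.
apply: (levy_Rintegral_cvg nuL (C := 2 + 2 * dotp t t)).
- exact: measurable_outer_set.
- move=> n x nx; have [xt|/negP xt] := boolP (tau <= enorm x); first by right.
  by left; split.
- by apply: measurable_funB => //; exact: measurable_dotp_frac.
- move=> x; have q1 : 0 < 1 + dotp x x by rewrite ltr_wpDr// dotp_ge0.
  have -> : sin (dotp t x) - dotp t x / (1 + dotp x x) =
      (sin (dotp t x) - dotp t x) + dotp t x / (1 + dotp x x) * dotp x x.
    by field; exact: lt0r_neq0.
  rewrite (le_trans (ler_normD _ _))//.
  have h1 := sin_sub_le (dotp t x); have h2 := cauchy_schwarz t x.
  have h3 : `|dotp t x / (1 + dotp x x) * dotp x x| <=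
    (1 + dotp t t) * dotp x x.
    by rewrite normrM (ger0_norm (dotp_ge0 x)) ler_wpM2r
      ?dotp_ge0// norm_dotp_frac_le.
  by have := dotp_ge0 x; have := dotp_ge0 t; nra.
- move=> x; rewrite (le_trans (ler_normB _ _))//.
  have := norm_dotp_frac_le t x; have := sin_max (dotp t x); have := dotp_ge0 t.
  lra.
Qed.

(** The large-jump step has no drift, so its rescaled increment is the compound Poisson exponent
    already at finite [N]. *)
Lemma cf_tail_step N L : (0 < N)%N ->
  (forall f : V -> \bar R, measurable_fun setT f -> (forall x, 0 <= f x)%E ->
    (\int[L]_x f x = (1 - tail_mass nu tau / N%:R)%:E * f 0%R +
      (N%:R^-1)%:E * \int[nu]_(x in tail_set tau) f x)%E) ->
  forall t, N%:R * (cf L t - 1) =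
    (\int[nu]_(x in tail_set tau) (cos (dotp t x) - 1))%R +i*
    (\int[nu]_(x in tail_set tau) sin (dotp t x))%R.
Proof.
move=> N0 LE t; have N0' : N%:R != 0 :> R by rewrite pnatr_eq0 -lt0n.
have mD := measurable_tail_set (p := p) tau; have nuD := tail_set_lty nuL tau0.
have LR := step_law_Rintegral (nu := nu) (n := 0%N) (u := fun=> 0) (w := 0) mD
  (K := L) (b := 0)
  (c := 1 - tail_mass nu tau / N%:R) (e := N%:R^-1).
have {}LR (f : V -> R) : measurable_fun setT f ->
  nu.-integrable (tail_set tau) (EFin \o f) ->
    \int[L]_x f x = (1 - tail_mass nu tau / N%:R) * f 0 +
      N%:R^-1 * \int[nu]_(x in tail_set tau) f x.
  move=> mf fi; have [|_ ->] := LR _ f mf fi; last by rewrite big_ord0 addr0.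
  by move=> g mg g0; rewrite LE// big_ord0 adde0.
have NC : (N%:R : R[i]) = (N%:R)%:C by rewrite rmorph_nat.
have cfE : cf L t - 1 = (complex.Re (cf L t) - 1) +i* complex.Im (cf L t).
  by rewrite /cf; simpc.
rewrite cfE NC; simpc; congr (_ +i* _).
  rewrite Re_cf_sub1 LR ?dotp0r ?cos0 ?subrr ?mulr0 ?add0r ?mulrA
    ?divff ?mul1r//.
    exact: measurable_cos_sub1.
  apply: (integrable_bounded_on mD nuD (measurable_cos_sub1 t) (C := 2)) => x _.
  rewrite (le_trans (ler_normB _ _))// normr1 (_ : 2 = 1 + 1)//.
  by rewrite lerD2r cos_max.
have [ms _] := bounded_sin_dotp t.
rewrite /cf/= LR ?dotp0r ?sin0 ?mulr0 ?add0r ?mulrA ?divff ?mul1r//.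
by apply: (integrable_bounded_on mD nuD ms (C := 1)) => x _; exact: sin_max.
Qed.

Lemma normc_cvg0 (z : nat -> R[i]) (w : R[i]) :
  complex.Re (z n) @[n --> \oo] --> complex.Re w ->
  complex.Im (z n) @[n --> \oo] --> complex.Im w ->
  normc (z n - w) @[n --> \oo] --> 0.
Proof.
move=> cRe cIm.
apply: (@squeeze_cvgr _ _ _ _ (fun=> 0) (fun n =>
  `|complex.Re (z n) - complex.Re w| + `|complex.Im (z n) - complex.Im w|)).
- apply: nearW => n; rewrite normc_ge0/= (le_trans (normc_le _))//.
  by case: (z n) (w) => [x y] [x' y'].
- exact: cvg_cst.
- rewrite -[X in _ --> X](addr0 0) -(normr0 R) -{1}(subrr (complex.Re w)).
  rewrite -(subrr (complex.Im w)).
  by apply: cvgD; apply: cvg_norm; apply: cvgB => //; exact: cvg_cst.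
Qed.

(** Both walks have the same number of steps, so their joint characteristic function is the [N n]-th
    power of one product, to which [cexp_power_limit] applies. *)
Lemma cf_approximation (N : nat -> nat) (K L : nat -> probability V R) t :
  (forall n, row_approximation nu a vs tau n (N n) (K n) (L n)) ->
  normc (cf (convolution (convolution_pow (K n) (N n))
                         (convolution_pow (L n) (N n))) t -
         levy_khintchine a Q nu t) @[n --> \oo] --> 0.
Proof.
move=> row; rewrite levy_khintchineE; set z := levy_exponent t.
under eq_cvg do rewrite cf_convolution !cf_convolution_pow -exprMn.
have nN n : (n < N n)%N by have [] := row n.
have N0 n : (0 < N n)%N by exact: leq_ltn_trans (nN n).
apply: cexp_power_limit => //.
  by move=> n; rewrite normcM mulr_ile1 ?normc_ge0 ?normc_cf.
  exact: levy_exponent_Re_le0.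
pose beta : R[i] := (\int[nu]_(x in tail_set tau) (cos (dotp t x) - 1))%R +i*
    (\int[nu]_(x in tail_set tau) sin (dotp t x))%R.
have LE n : (N n)%:R * (cf (L n) t - 1) = beta.
  by have [_ _ _ _ LE] := row n; rewrite (cf_tail_step (N0 n) LE).
pose d n := (N n)%:R * (cf (K n) t - 1) + beta.
have NC n : ((N n)%:R : R[i]) = ((N n)%:R)%:C by rewrite rmorph_nat.
have har : dotp t t / n.+1%:R @[n --> \oo] --> 0.
  by rewrite -(mulr0 (dotp t t));
    apply: cvgM; [exact: cvg_cst|exact: cvg_harmonic].
have close (u v : nat -> R) (l : R) : v n @[n --> \oo] --> l ->
    (forall n, `|u n - v n| <= dotp t t / n.+1%:R) -> u n @[n --> \oo] --> l.
  move=> cv uv; rewrite -(add0r l) (_ : u = fun n => (u n - v n) + v n);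
    last first.
    by apply/funext => n; rewrite subrK.
  apply: cvgD => //; apply: norm_cvg0.
  apply: (@squeeze_cvgr _ _ _ _ (fun=> 0) (fun n => dotp t t / n.+1%:R)) => //.
    by apply: nearW => n; rewrite normr_ge0 uv.
  exact: cvg_cst.
have dz : normc (d n - z) @[n --> \oo] --> 0.
  apply: normc_cvg0.
    apply: (close (fun n => complex.Re (d n)) _ _ (@cvg_levy_exponent_Re t)) =>
      n.
    have [_ _ [/(_ t) h _] _ _] := row n; move: h; congr (`|_ - _| <= _).
    by rewrite /d NC /beta; case: (cf (K n) t) => x y; simpc.
  apply: (close (fun n => complex.Im (d n)) _ _ (@cvg_levy_exponent_Im t)) => n.
  have [_ _ [_ /(_ t) h] _ _] := row n; move: h; congr (`|_ - _| <= _).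
  by rewrite /d NC /beta; case: (cf (K n) t) => x y; simpc.
(* The cross term [N * (cf K - 1) * (cf L - 1)] is of order [1 / N], each of the two differences
   being of that order. *)
have dE n : (N n)%:R * (cf (K n) t * cf (L n) t - 1) - z =
    (d n - z) + (d n - beta) * beta * ((N n)%:R)^-1.
  have N0' : (N n)%:R != 0 :> R[i] by rewrite NC fmorph_eq0 pnatr_eq0 -lt0n.
  by rewrite /d -(LE n); field.
pose bound n := normc (d n - z) +
  (normc (d n - z) + normc (z - beta)) * normc beta * n.+1%:R^-1.
apply: (@squeeze_cvgr _ _ _ _ (fun=> 0) bound).
- apply: nearW => n; rewrite normc_ge0/= dE (le_trans (normc_triangle _ _))//.
  rewrite lerD2l !normcM ler_pM ?mulr_ge0 ?normc_ge0//.
    by rewrite ler_wpM2r ?normc_ge0// normc_dist.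
  rewrite normcV NC normc_real ger0_norm// lef_pV2 ?posrE ?ltr0n//.
  by rewrite ler_nat.
- exact: cvg_cst.
- rewrite -[X in _ --> X](addr0 0); apply: cvgD => //.
  rewrite -[X in _ --> X](mulr0 ((0 + normc (z - beta)) * normc beta)).
  apply: cvgM; last exact: cvg_harmonic.
  by apply: cvgM; [apply: cvgD => //|]; exact: cvg_cst.
Qed.

End levy_exponent.

(** * The two walks and the bounds uniform in their length *)

Section levy_approximation.
Context {R : realType} {p : nat}.
Local Notation V := 'rV[R]_p.
Import Normc.

Lemma levy_approximation (nu : {measure set V -> \bar R}) (a : V) (Q : V -> R)
    (tau : R) (l : nat) :
  levy_measure nu -> nonneg_quadratic_form Q -> 0 < tau ->
  exists (A B : nat -> probability V R) (CA cB : R), [/\ 0 < CA /\ 0 < cB,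
    forall t, normc (cf (convolution (A n) (B n)) t - levy_khintchine a Q nu t)
      @[n --> \oo] --> 0,
    forall n, (\int[A n]_x (hpoly l x)%:E <= CA%:E)%E,
    forall n (f : V -> \bar R), measurable_fun setT f ->
      (forall x, 0 <= f x)%E ->
      (cB%:E * \int[nu]_(x in tail_set tau) f x <= \int[B n]_x f x)%E &
    forall (g : V -> R) (K I : R), measurable_fun setT g ->
      (forall x, 0 <= g x) ->
      0 <= K -> (forall x y, g (x + y) <= K * g x * g y) ->
      (\int[nu]_(x in tail_set tau) (g x)%:E = I%:E)%E ->
      forall n, (\int[B n]_x (g x)%:E <= (expR (K * I) * g 0)%:E)%E].
Proof.
move=> nuL QQ tau0; have [vs QE] := nonneg_quadratic_form_sum_squares QQ.
have H n : {NKL : nat * (probability V R * probability V R) |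
    row_approximation nu a vs tau n NKL.1 NKL.2.1 NKL.2.2}.
  apply: cid; have [N [K [L h]]] := row_approximation_exists a vs nuL tau0 n.
  by exists (N, (K, L)).
pose N n := (sval (H n)).1; pose K n := (sval (H n)).2.1; pose L n :=
  (sval (H n)).2.2.
have row n : row_approximation nu a vs tau n (N n) (K n) (L n)
  by exact: (svalP (H n)).
have N0 n : (0 < N n)%N by have [nN _ _ _ _] := row n; exact: leq_ltn_trans nN.
have N0' n : 0 < (N n)%:R :> R by rewrite ltr0n.
have r0 : 0 <= radius2 vs tau.
  by rewrite /radius2 !addr_ge0 ?sqr_ge0// gauss_mass_ge0.
have M0 : 0 <= moment_bound nu a vs tau.
  rewrite /moment_bound !addr_ge0 ?dotp_ge0 ?tail_mass_ge0 ?gauss_mass_ge0//.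
  by rewrite mulr_ge0 ?levy_mass_ge0// addr_ge0// sqr_ge0.
have [C C0 hC] := @hpoly_lyapunov R p _ _ l r0 M0.
exists (fun n => convolution_pow (K n) (N n)),
  (fun n => convolution_pow (L n) (N n)).
exists (expR C), (expR (- (2 * tail_mass nu tau))); split.
- by rewrite !expR_gt0.
- by move=> t; exact: (cf_approximation nuL tau0 QE t row).
- move=> n; have [_ _ _ [K1 K2 K3 K4 K5] _] := row n.
  have h0 (x : V) : 0 <= hpoly l x by rewrite (le_trans ler01)// hpoly_ge1.
  have CN : 0 <= 1 + C / (N n)%:R by rewrite addr_ge0// divr_ge0.
  have := ge0_integral_convolution_pow_le (N n) 0 (measurable_hpoly l) h0 CN
    (hC (K n) _ (N0' n) K1 K2 K3 K4 K5).
  under eq_integral do rewrite add0r.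
  move=> /le_trans; apply; rewrite lee_fin /hpoly dotp0r addr0 expr1n mulr1.
  exact: one_plus_expn_le.
- move=> n f mf f0; have [_ tmN _ _ LE] := row n.
  have tm0 := tail_mass_ge0 nu tau.
  have q01 : 0 <= 1 - tail_mass nu tau / (N n)%:R <= 1.
    rewrite gerBl divr_ge0// andbT subr_ge0 ler_pdivrMr// mul1r.
    lra.
  have e0 : 0 <= (N n)%:R^-1 :> R by rewrite invr_ge0.
  have fT : (0 <= \int[nu]_(x in tail_set tau) f x)%E by exact: integral_ge0.
  have LEm (g : V -> \bar R) : measurable_fun setT g ->
    (forall x, 0 <= g x)%E ->
      ((1 - tail_mass nu tau / (N n)%:R)%:E * g 0%R + ((N n)%:R^-1)%:E *
       \int[mrestr nu (measurable_tail_set tau)]_y g y <= \int[L n]_y g y)%E.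
    by move=> mg g0; rewrite LE// ge0_integral_mrestr.
  have [_] := ge0_integral_convolution_pow_ge (N n) 0 mf f0 q01 e0 LEm.
  rewrite ge0_integral_mrestr//; last first.
    exact: measurable_comp_add.
  under eq_integral do rewrite add0r.
  under [X in (_ <= X)%E -> _]eq_integral do rewrite add0r.
  apply: le_trans; apply: lee_wpmul2r => //.
  (* [N] steps of intensity [1 / N] cancel, leaving the probability of no large jump, bounded below
     by an exponential. *)
  rewrite divff ?lt0r_neq0// mul1r lee_fin.
  exact: one_minus_expn_ge.
- move=> g k I mg g0 k0 gk gI n; have [_ tmN _ _ LE] := row n.
  have I0 : 0 <= I by rewrite -lee_fin -gI; apply: integral_ge0 => x _;
    rewrite lee_fin.
  have kI : 0 <= 1 + k * I / (N n)%:R by rewrite addr_ge0// divr_ge0// mulr_ge0.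
  (* Standing still contributes at most [g x], and a jump, by submultiplicativity, at most
     [k * g x * I] with weight [1 / N]. *)
  have step (x : V) : (\int[L n]_y (g (x + y))%:E <=
    ((1 + k * I / (N n)%:R) * g x)%:E)%E.
    have mgx : measurable_fun setT (fun y => (g (x + y))%:E).
      by apply/measurable_EFinP;
        exact: (measurableT_comp mg (measurable_translate x)).
    rewrite LE//; last by move=> y; rewrite lee_fin.
    rewrite addr0.
    apply: (@le_trans _ _ ((1 - tail_mass nu tau / (N n)%:R)%:E * (g x)%:E +
      ((N n)%:R^-1)%:E * ((k * g x)%:E * I%:E))%E).
      apply: leeD => //; apply: lee_wpmul2l; first by rewrite lee_fin invr_ge0.
      rewrite -gI -ge0_integralZl//; last 4 first.
      - exact: measurable_tail_set.
      - by apply/measurable_EFinP; exact: measurable_funTS.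
      - by move=> y _; rewrite lee_fin.
      - by rewrite lee_fin mulr_ge0.
      apply: ge0_le_integral.
      - exact: measurable_tail_set.
      - by move=> y _; rewrite lee_fin.
      - exact: measurable_funTS.
      - by apply/measurable_EFinP; apply: measurable_funTS;
          apply: measurable_funM.
      - by move=> y _; rewrite -EFinM lee_fin.
    rewrite -!EFinM -EFinD lee_fin.
    have tN : 0 <= tail_mass nu tau / (N n)%:R * g x.
      by rewrite mulr_ge0 ?divr_ge0 ?tail_mass_ge0.
    rewrite !mulrDl mulNr !mul1r -subr_ge0.
    rewrite (_ : _ - _ = tail_mass nu tau / (N n)%:R * g x)//.
    by ring.
  have := ge0_integral_convolution_pow_le (N n) 0 mg g0 kI step.
  under eq_integral do rewrite add0r.
  move=> /le_trans; apply; rewrite lee_fin ler_wpM2r//.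
  by apply: one_plus_expn_le => //; exact: mulr_ge0.
Qed.

(** The entry point for multipliers: for the constant 1 the test integrals are combinations of the
    real and imaginary parts of the characteristic function. *)
Lemma trig_cvg_cst1 (L : nat -> probability V R) (mu : probability V R) :
  (forall t, normc (cf (L n) t - cf mu t) @[n --> \oo] --> 0) ->
  trig_cvg L mu (fun=> 1).
Proof.
move=> cL; split=> [|t s]; first exact: bounded_mfun_cst.
have h (P : probability V R) : \int[P]_x (1 * cos (dotp t x + s)) =
    complex.Re (cf P t) * cos s - complex.Im (cf P t) * sin s.
  by rewrite -Rintegral_cos_add; apply: eq_Rintegral => x _; rewrite mul1r.
under eq_cvg do rewrite h; rewrite h.
have c (pr : R[i] -> R) : (forall z, `|pr z| <= normc z) ->
    (forall z w, pr (z - w) = pr z - pr w) ->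
    pr (cf (L n) t) @[n --> \oo] --> pr (cf mu t).
  move=> prle prB; apply/cvgrPdist_le => e e0.
  have /cvgrPdist_le/(_ _ e0) := cL t; apply: filterS => n.
  rewrite sub0r normrN (ger0_norm (normc_ge0 _)); apply: le_trans.
  by rewrite distrC -prB.
apply: cvgB; apply: cvgM; try exact: cvg_cst.
  by apply: c => [z|[x y] [x' y']//]; exact: norm_Re_le.
by apply: c => [z|[x y] [x' y']//]; exact: norm_Im_le.
Qed.

Lemma char_fun_distribution d (T : measurableType d) (P : probability T R)
    (X : {RV P >-> V}) t : char_fun P X t = cf (distribution P X) t.
Proof.
have [mc _] := bounded_cos_dotp t; have [ms _] := bounded_sin_dotp t.
have h (f : V -> R) : bounded_mfun f ->
    \int[P]_w f (X w) = \int[distribution P X]_x f x.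
  move=> [mf [C fC]]; rewrite /Rintegral integral_distribution//.
    exact/measurable_EFinP.
  apply: (bounded_mfun_integrable P); split; last by exists C => w; exact: fC.
  exact: measurableT_comp.
rewrite /char_fun /cintegral /cf -(h _ (bounded_cos_dotp t))
  -(h _ (bounded_sin_dotp t)).
congr (Complex _ _); apply: eq_Rintegral => w _.
  by simpc; rewrite /cexp/= expR0; simpc.
by simpc; rewrite /cexp/= expR0; simpc.
Qed.

End levy_approximation.

(** * From moments to the weight, and the equivalence *)

Section moments.
Context {R : realType} {p : nat}.
Local Notation V := 'rV[R]_p.
Implicit Types (x : V) (mu : {measure set V -> \bar R}).

Lemma measurable_moment (al : 'I_p -> R) :
  measurable_fun setT (fun x : V => \prod_(r < p) `|x ord0 r| `^ al r).
Proof.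
apply: measurable_prod => r _.
apply: (measurableT_comp (f := @powR R ^~ (al r)));
  first exact: measurable_powR.
by apply: measurableT_comp => //; exact: measurable_coord.
Qed.

Lemma moment_ge0 (al : 'I_p -> R) x : 0 <= \prod_(r < p) `|x ord0 r| `^ al r.
Proof. by apply: prodr_ge0 => r _; exact: powR_ge0. Qed.

Lemma expectation_moment d (T : measurableType d) (P : probability T R)
    (X : {RV P >-> V}) (al : 'I_p -> R) :
  ('E_P[(fun w => \prod_(r < p) `|X w ord0 r| `^ al r)%R])%E =
  (\int[distribution P X]_x (\prod_(r < p) `|x ord0 r| `^ al r)%:E)%E.
Proof.
rewrite unlock ge0_integral_distribution//.
- by apply/measurable_EFinP; exact: measurable_moment.
- by move=> x; rewrite lee_fin moment_ge0.
Qed.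

Lemma sqrt_one_sqr_ge1 (y : R) : 1 <= Num.sqrt (1 + y ^+ 2).
Proof. by rewrite -{1}(@sqrtr1 R) ler_sqrt ?lerDl ?addr_ge0 ?sqr_ge0. Qed.

Lemma vtrunc0E (y b : R) : vtrunc 0 y `^ (b / 2) = Num.sqrt (1 + y ^+ 2) `^ b.
Proof.
rewrite /vtrunc mul0r addr0 divr1 mulrC powRrM powR12_sqrt//.
by rewrite addr_ge0// sqr_ge0.
Qed.

(** Each factor of the weight is at most a constant times 1 plus the [beta r]-th power of the
    coordinate; expanding the product over subsets [J] produces only exponents 0 and [beta r], which
    lie in the box. *)
Lemma moment_lty_weight mu (beta : 'I_p -> R) : (forall r, 0 <= beta r) ->
  (forall al : 'I_p -> R, (forall r, 0 <= al r <= beta r) ->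
    (\int[mu]_x (\prod_(r < p) `|x ord0 r| `^ al r)%:E < +oo)%E) <->
  (\int[mu]_x (weight (fun r => (beta r / 2)%R) 0 x)%:E < +oo)%E.
Proof.
move=> beta0; set gam := fun r : 'I_p => (beta r / 2)%R.
have gam0 r : 0 <= gam r by rewrite divr_ge0.
have mw : measurable_fun setT (weight gam 0) by exact: measurable_weight.
split=> [momentlty|wlty al al_beta]; last first.
  apply: le_lt_trans wlty; apply: ge0_le_integral => //.
  - by move=> x _; rewrite lee_fin moment_ge0.
  - by apply/measurable_EFinP; exact: measurable_moment.
  - exact/measurable_EFinP.
  move=> x _; rewrite lee_fin; apply: ler_prod => r _;
    rewrite powR_ge0/= vtrunc0E.
  have /andP[al0 alb] := al_beta r.
  rewrite (@le_trans _ _ (Num.sqrt (1 + x ord0 r ^+ 2) `^ al r))//.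
    rewrite ge0_ler_powR// ?nnegrE ?sqrtr_ge0//.
    by rewrite -sqrtr_sqr ler_sqrt ?lerDr// addr_ge0// sqr_ge0.
  by rewrite ler_powR// sqrt_one_sqr_ge1.
pose C : R := \prod_(r < p) 2 `^ beta r.
have C0 : 0 <= C by apply: prodr_ge0 => r _; exact: powR_ge0.
pose al (J : {set 'I_p}) r : R := if r \in J then beta r else 0.
have wle x : weight gam 0 x <=
    C * \sum_(J in {set 'I_p}) \prod_(r < p) `|x ord0 r| `^ al J r.
  have -> : \sum_(J in {set 'I_p}) \prod_(r < p) `|x ord0 r| `^ al J r =
      \prod_(r < p) (`|x ord0 r| `^ beta r + 1).
    rewrite bigA_distr; apply: eq_bigr => J _; apply: eq_bigr => r _.
    by rewrite /al; case: ifP => // _; rewrite powRr0.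
  rewrite /C -big_split/=; apply: ler_prod => r _; rewrite powR_ge0/= vtrunc0E.
  set y := x ord0 r; have s1 := sqrt_one_sqr_ge1 y.
  have y0 := normr_ge0 y.
  have mx0 : 0 <= 2 * Num.max `|y| 1 by rewrite mulr_ge0// le_max y0.
  have sy : Num.sqrt (1 + y ^+ 2) <= 2 * Num.max `|y| 1.
    rewrite -(@ler_pXn2r _ 2) ?nnegrE ?sqrtr_ge0//.
    rewrite sqr_sqrtr ?addr_ge0 ?sqr_ge0// exprMn -(real_normK (num_real y)).
    by have [y1|y1] := leP `|y| 1; nra.
  rewrite (@le_trans _ _ ((2 * Num.max `|y| 1) `^ beta r))//.
    by rewrite ge0_ler_powR// nnegrE ?sqrtr_ge0.
  rewrite powRM// ?le_max ?y0// ler_wpM2l ?powR_ge0//.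
  have [y1|y1] := leP `|y| 1; first by rewrite powR1 lerDr powR_ge0.
  by rewrite lerDl.
apply: (@le_lt_trans _ _ (\int[mu]_x (C%:E *
    \sum_(J in {set 'I_p}) (\prod_(r < p) `|x ord0 r| `^ al J r)%:E))%E).
  apply: ge0_le_integral => //.
  - by move=> x _; rewrite lee_fin weight_ge0.
  - exact/measurable_EFinP.
  - under eq_fun do rewrite sumEFin.
    apply: measurable_funeM; apply/measurable_EFinP.
    by apply: measurable_sum => J; exact: measurable_moment.
  - by move=> x _; rewrite sumEFin -EFinM lee_fin.
rewrite ge0_integralZl//; last 2 first.
- under eq_fun do rewrite sumEFin; apply/measurable_EFinP.
  by apply: measurable_sum => J; exact: measurable_moment.
- by move=> x _; apply: sume_ge0 => J _; rewrite lee_fin moment_ge0.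
rewrite ge0_integral_sum//; last 2 first.
- by move=> J; apply/measurable_EFinP; exact: measurable_moment.
- by move=> J x _; rewrite lee_fin moment_ge0.
apply: lte_mul_pinfty => //.
apply: lte_sum_pinfty => J _; apply: momentlty => r.
by rewrite /al; case: ifP; rewrite ?lexx beta0.
Qed.

(** Removes the truncation by monotone convergence along [m = 1 / (n + 1)]. *)
Lemma integral_weight_le mu (D : set V) (gam : 'I_p -> R) (C : \bar R) :
  measurable D -> (forall r, 0 <= gam r) ->
  (forall n, (\int[mu]_(x in D) (weight gam n.+1%:R^-1 x)%:E <= C)%E) ->
  (\int[mu]_(x in D) (weight gam 0 x)%:E <= C)%E.
Proof.
move=> mD gam0 wC.
have m0 n : 0 <= n.+1%:R^-1 :> R by rewrite invr_ge0.
have mw n : measurable_fun D (fun x => (weight gam n.+1%:R^-1 x)%:E).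
  by apply/measurable_EFinP/measurable_funTS; exact: measurable_weight.
have w0 n x : D x -> (0 <= (weight gam n.+1%:R^-1 x)%:E)%E.
  by rewrite lee_fin weight_ge0.
have ndw x : D x -> nondecreasing_seq (fun n => (weight gam n.+1%:R^-1 x)%:E).
  move=> _ m n mn; rewrite lee_fin weight_le// invr_ge0 ler0n/=.
  by rewrite lef_pV2 ?posrE ?ltr0n// ler_nat.
have := @cvg_monotone_convergence _ _ _ mu D mD _ mw w0 ndw.
rewrite (_ : (\int[mu]_(x in D) _)%E =
  (\int[mu]_(x in D) (weight gam 0 x)%:E)%E); last first.
  apply: eq_integral => x _; apply/cvg_lim => //.
  by apply: cvg_EFin; [exact: nearW|exact: weight_cvg].
move=> /cvg_lim <-//; apply: lime_le; last exact: nearW.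
apply: ereal_nondecreasing_is_cvgn => m n mn; apply: ge0_le_integral => //.
- by move=> x Dx; exact: w0.
- by move=> x Dx; exact: ndw.
Qed.

(** A summand drawn from [A] cannot destroy the integral of [w] under [B]: shifting back by [- x]
    gives [w y <= K * h x * w (x + y)], and the mean of [1 / h] under [A] is at least [1 / CA]. *)
Lemma ge0_integral_translate_ge (A B : probability V R) (h w : V -> R)
  (CA K : R) :
  measurable_fun setT h -> measurable_fun setT w ->
  (forall x, 1 <= h x) -> (forall x, h (- x) = h x) -> (forall x, 0 <= w x) ->
  0 < CA -> 0 < K -> (forall x y, w (x + y) <= K * h x * w y) ->
  (\int[A]_x (h x)%:E <= CA%:E)%E ->
  (((K * CA)^-1)%:E * \int[B]_x (w x)%:E <= \int[convolution A B]_x (w x)%:E)%E.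
Proof.
move=> mh mw h1 hN w0 CA0 K0 wh hA.
have h0 x : 0 < h x by exact: lt_le_trans (h1 x).
have mhV : measurable_fun setT (fun x => (h x)^-1).
  rewrite (_ : (fun x => _) = (fun x => h x `^ (-1))); last first.
    by apply/funext => x; rewrite powR_inv1// ltW.
  apply: (measurableT_comp (f := @powR R ^~ (-1))) => //;
    exact: measurable_powR.
have wE : measurable_fun setT (EFin \o w) by exact/measurable_EFinP.
have IB0 : (0 <= \int[B]_x (w x)%:E)%E by apply: integral_ge0 => x _;
  rewrite lee_fin.
(* Jensen's inequality for [1 / h], through its tangent at [1 / c]:
   [2 c - c ^+ 2 * h <= 1 / h]. *)
have hV : ((CA^-1)%:E <= \int[A]_x ((h x)^-1)%:E)%E.
  have : ((2 * CA^-1)%:E <= \int[A]_x ((h x)^-1)%:E +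
    (CA^-1 ^+ 2)%:E * CA%:E)%E.
    apply: (@le_trans _ _ (\int[A]_x ((h x)^-1 + CA^-1 ^+ 2 * h x)%:E)%E).
      rewrite -[leLHS](_ : (\int[A]_x (2 * CA^-1)%:E = _)%E); last first.
        by rewrite integral_cst//; have /= -> := probability_setT A;
          rewrite mule1.
      apply: ge0_le_integral => //.
      - by move=> x _; rewrite lee_fin mulr_ge0// invr_ge0 ltW.
      - apply/measurable_EFinP; apply: measurable_funD => //.
        exact: measurable_funM.
      - move=> x _; rewrite lee_fin -subr_ge0.
        rewrite (_ : _ - _ = (1 - CA^-1 * h x) ^+ 2 / h x); last first.
          by field; rewrite !lt0r_neq0.
        by rewrite divr_ge0 ?sqr_ge0// ltW.
    under eq_integral do rewrite EFinD EFinM.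
    rewrite ge0_integralD//; last 4 first.
    - by move=> x _; rewrite lee_fin invr_ge0 ltW.
    - exact/measurable_EFinP.
    - by move=> x _; rewrite -EFinM lee_fin mulr_ge0 ?sqr_ge0// ltW.
    - by apply: measurable_funeM; exact/measurable_EFinP.
    rewrite ge0_integralZl//; last 3 first.
    - exact/measurable_EFinP.
    - by move=> x _; rewrite lee_fin ltW.
    - by rewrite lee_fin sqr_ge0.
    by apply: leeD2l; apply: lee_wpmul2l => //; rewrite lee_fin sqr_ge0.
  rewrite -EFinM -leeBlDr// -EFinB; congr (_%:E <= _)%E.
  by field; exact: lt0r_neq0.
rewrite ge0_integral_convolution//.
apply: (@le_trans _ _
  (\int[A]_x (((h x)^-1)%:E * ((K^-1)%:E * \int[B]_y (w y)%:E)))%E).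
  rewrite ge0_integralZr//; last 3 first.
  - exact/measurable_EFinP.
  - by move=> x _; rewrite lee_fin invr_ge0 ltW.
  - by rewrite mule_ge0// lee_fin invr_ge0 ltW.
  rewrite muleA;
    apply: (@le_trans _ _ ((CA^-1)%:E * (K^-1)%:E * \int[B]_x (w x)%:E)%E).
    by rewrite -EFinM -invfM mulrC.
  apply: lee_wpmul2r => //; apply: lee_wpmul2r => //.
  by rewrite lee_fin invr_ge0 ltW.
apply: ge0_le_integral => //.
- move=> x _; rewrite !mule_ge0// lee_fin invr_ge0 ltW//.
- by apply: emeasurable_funM => //; exact/measurable_EFinP.
- by apply: (measurable_integral_add B wE) => x; rewrite lee_fin.
move=> x _; rewrite muleA -EFinM -ge0_integralZl//; last 2 first.
- by move=> y _; rewrite lee_fin.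
- by rewrite lee_fin mulr_ge0// invr_ge0 ltW.
apply: ge0_le_integral => //.
- by move=> y _; rewrite -EFinM lee_fin mulr_ge0// mulr_ge0// invr_ge0 ltW.
- by apply: measurable_funeM.
- exact: (measurable_comp_add x wE).
move=> y _; rewrite -EFinM lee_fin -invfM mulrC ler_pdivrMr ?mulr_gt0//.
rewrite mulrC [h x * K]mulrC.
by have := wh (- x) (x + y); rewrite addKr hN.
Qed.

Lemma ereal_le_cvg (u : nat -> R) (l : R) (e : \bar R) :
  u n @[n --> \oo] --> l -> (forall n, (e <= (u n)%:E)%E) -> (e <= l%:E)%E.
Proof.
case: e => [r|_ /(_ 0%N)//|_ _]; last exact: leNye.
by move=> ul ru; rewrite lee_fin; apply: (cvgr_to_ge ul); exact: nearW.
Qed.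

Lemma levy_moment_iff (mu : probability V R) (nu : {measure set V -> \bar R})
    (a : V) (Q : V -> R) (tau : R) (gam : 'I_p -> R) :
  nonneg_quadratic_form Q -> levy_measure nu ->
  (forall t, cf mu t = levy_khintchine a Q nu t) ->
  0 < tau -> (forall r, 0 <= gam r) ->
  (\int[mu]_x (weight gam 0 x)%:E < +oo)%E <->
  (\int[nu]_(x in tail_set tau) (weight gam 0 x)%:E < +oo)%E.
Proof.
move=> QQ nuL cfmu tau0 gam0.
have [l wh] := weight_le_hpoly gam0; have [K K0 wsub] := weight_submul gam0.
have [A [B [CA [cB [[CA0 cB0] cvgcf hA Blow Bup]]]]] :=
  levy_approximation a l nuL QQ tau0.
pose L n := convolution (A n) (B n).
have tc1 : trig_cvg L mu (fun=> 1).
  by apply: trig_cvg_cst1 => t; rewrite cfmu; exact: cvgcf.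
have m01 (n : nat) : 0 < (n.+1%:R^-1 : R) <= 1.
  by rewrite invr_gt0 ltr0n invf_le1 ?ltr0n ?ler1n.
have m01' (n : nat) : 0 <= (n.+1%:R^-1 : R) <= 1.
  by have /andP[/ltW -> ->] := m01 n.
have w_cvg n : \int[L k]_x weight gam n.+1%:R^-1 x @[k --> \oo] -->
    \int[mu]_x weight gam n.+1%:R^-1 x.
  have [_ /(_ _ tc1)] := multiplier_weight gam0 L mu (m01 n).
  by under eq_fun do rewrite mul1r; exact: trig_cvg_cvg.
have bw n : bounded_mfun (weight gam n.+1%:R^-1 : V -> R).
  by have [] := multiplier_weight gam0 L mu (m01 n).
have mw m : 0 <= m -> measurable_fun setT (weight gam m : V -> R).
  by move=> ?; exact: measurable_weight.
have mwE m : 0 <= m -> measurable_fun setT (EFin \o weight gam m : V -> \bar R).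
  by move=> ?; apply/measurable_EFinP; exact: mw.
have wE0 m (x : V) : (0 <= (weight gam m x)%:E)%E by rewrite lee_fin weight_ge0.
have w_le n (x : V) : weight gam n.+1%:R^-1 x <= weight gam 0 x.
  by apply: weight_le => //; rewrite lexx invr_ge0 ler0n.
have hsub m (x y : V) : 0 <= m <= 1 ->
    weight gam m (x + y) <= K * hpoly l x * weight gam m y.
  move=> m1; rewrite (le_trans (wsub m x y m1))//.
  by rewrite ler_wpM2r ?weight_ge0// ler_wpM2l ?(ltW K0).
have mD := measurable_tail_set (p := p) tau.
split=> [muw|nuw].
- have le n : ((cB / (K * CA))%:E * \int[nu]_(x in tail_set tau)
      (weight gam n.+1%:R^-1 x)%:E <= \int[mu]_x (weight gam 0 x)%:E)%E.
    apply: (@le_trans _ _ (\int[mu]_x (weight gam n.+1%:R^-1 x)%:E)%E);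
      last first.
      apply: ge0_le_integral => //.
      + by apply: mwE; have /andP[] := m01' n.
      + exact: mwE.
      + by move=> x _; rewrite lee_fin.
    rewrite -EFin_Rintegral_bounded//.
    (* Stated for the truncated weight, whose integrals converge in [k]; the constant does not
       involve the truncation, which is removed afterwards. *)
    have lek k : ((cB / (K * CA))%:E * \int[nu]_(x in tail_set tau)
        (weight gam n.+1%:R^-1 x)%:E <=
          (\int[L k]_x weight gam n.+1%:R^-1 x)%:E)%E.
      rewrite EFin_Rintegral_bounded// mulrC EFinM -muleA.
      have := ge0_integral_translate_ge (B k) (measurable_hpoly l)
        (mw _ _) (hpoly_ge1 l) (hpolyN l) (weight_ge0 gam n.+1%:R^-1) CA0 K0
        (fun x y => hsub _ x y (m01' n)) (hA k).
      have /andP[m0 _] := m01' n.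
      move=> /(_ m0); apply: le_trans; apply: lee_wpmul2l.
        by rewrite lee_fin invr_ge0 mulr_ge0// ltW.
      by apply: Blow => //; exact: mwE.
    exact: (ereal_le_cvg (w_cvg n) lek).
  have {}le : ((cB / (K * CA))%:E * \int[nu]_(x in tail_set tau)
      (weight gam 0 x)%:E <= \int[mu]_x (weight gam 0 x)%:E)%E.
    rewrite -lee_pdivlMl ?divr_gt0 ?mulr_gt0//.
    apply: integral_weight_le => // n.
    by rewrite lee_pdivlMl ?divr_gt0 ?mulr_gt0.
  rewrite -lee_pdivlMl ?divr_gt0 ?mulr_gt0// in le.
  apply: le_lt_trans le _; apply: lte_mul_pinfty => //.
  by rewrite lee_fin invr_ge0 ltW// divr_gt0 ?mulr_gt0.
- have wI : (\int[nu]_(x in tail_set tau) (weight gam 0 x)%:E)%E \is a fin_num.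
    by rewrite ge0_fin_numE//; apply: integral_ge0.
  set I := fine (\int[nu]_(x in tail_set tau) (weight gam 0 x)%:E)%E.
  have IE : (\int[nu]_(x in tail_set tau) (weight gam 0 x)%:E)%E = I%:E.
    by rewrite fineK.
  pose CB := expR (K * I) * weight gam 0 (0 : V).
  have CB0 : 0 <= CB by rewrite mulr_ge0 ?expR_ge0 ?weight_ge0.
  have hB n : (\int[B n]_x (weight gam 0 x)%:E <= CB%:E)%E.
    apply: (Bup (weight gam 0) K I) => //.
    - exact: mw.
    - exact: weight_ge0.
    - exact: ltW.
    - by move=> x y; apply: wsub; rewrite lexx ler01.
  have wK0 (x : V) : 0 <= K * weight gam 0 x
    by rewrite mulr_ge0 ?weight_ge0// ltW.
  (* Submultiplicativity splits the weight over the two walks: [hpoly] absorbs the factor from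
     [A n], the exponential bound the one from [B n]. *)
  have hL n : (\int[L n]_x (weight gam 0 x)%:E <= (K * CB * CA)%:E)%E.
    rewrite ge0_integral_convolution//; last exact: mwE.
    apply: (@le_trans _ _ (\int[A n]_x ((K * CB)%:E * (hpoly l x)%:E))%E).
      apply: ge0_le_integral => //.
      - by move=> x _; apply: integral_ge0.
      - exact: (measurable_integral_add (B n) (mwE 0 (lexx 0)) (wE0 0)).
      - apply: measurable_funeM; apply/measurable_EFinP;
          exact: measurable_hpoly.
      move=> x _; apply: (@le_trans _ _ ((K * weight gam 0 x)%:E *
          \int[B n]_y (weight gam 0 y)%:E)%E).
        rewrite -ge0_integralZl//; [|exact: mwE|exact: wK0].
        apply: ge0_le_integral => //.
        - exact: (measurable_comp_add x (mwE 0 (lexx 0))).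
        - by apply: measurable_funeM; exact: mwE.
        - by move=> y _; rewrite -EFinM lee_fin wsub// lexx ler01.
      apply: (@le_trans _ _ ((K * weight gam 0 x)%:E * CB%:E)%E).
        by apply: lee_wpmul2l; [rewrite lee_fin; exact: wK0|exact: hB].
      rewrite -!EFinM lee_fin mulrAC ler_wpM2l//.
      by rewrite mulr_ge0// ltW.
    rewrite ge0_integralZl//; last 3 first.
    - by apply/measurable_EFinP; exact: measurable_hpoly.
    - by move=> x _; rewrite lee_fin (le_trans ler01)// hpoly_ge1.
    - by rewrite lee_fin mulr_ge0// ltW.
    rewrite [X in (_ <= X)%E]EFinM; apply: lee_wpmul2l; last exact: hA.
    by rewrite lee_fin mulr_ge0// ltW.
  apply: (@le_lt_trans _ _ (K * CB * CA)%:E); last exact: ltry.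
  apply: integral_weight_le => // n.
  (* The truncated weight lies below the full one, so the bound for [L k] passes to [mu], still
     uniformly in [n]. *)
  rewrite -EFin_Rintegral_bounded// lee_fin.
  apply: (cvgr_to_le (w_cvg n)); apply: nearW => k.
  rewrite -lee_fin EFin_Rintegral_bounded//; apply: le_trans (hL k).
  apply: ge0_le_integral => //.
  + by apply: mwE; have /andP[] := m01' n.
  + exact: mwE.
  + by move=> x _; rewrite lee_fin.
Qed.

End moments.

Unset Implicit Arguments.
Set Strict Implicit.
Set Printing Implicit Defensive.

Theorem theorem1 (R : realType) (d : measure_display) (T : measurableType d)
    (P : probability T R) (p : nat) (X : {RV P >-> 'rV[R]_p})
    (a : 'rV[R]_p) (Q : 'rV[R]_p -> R)
    (nu : {measure set 'rV[R]_p -> \bar R}) (tau : R) (beta : 'I_p -> R) :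
  (1 <= p)%N ->
  infinitely_divisible (distribution P X) ->
  nonneg_quadratic_form Q ->
  levy_measure nu ->
  (forall t : 'rV[R]_p, char_fun P X t = levy_khintchine a Q nu t) ->
  0 < tau ->
  (forall r : 'I_p, 0 <= beta r) ->
  (forall alpha : 'I_p -> R, (forall r : 'I_p, 0 <= alpha r <= beta r) ->
    ('E_P[(fun w => \prod_(r < p) (`|X w ord0 r| `^ alpha r))%R] < +oo)%E)
  <->
  (forall alpha : 'I_p -> R, (forall r : 'I_p, 0 <= alpha r <= beta r) ->
    (\int[levy_restr nu tau]_x
      (\prod_(r < p) (`|x ord0 r| `^ alpha r))%R%:E < +oo)%E).
Proof.
move=> _ _ Qquad nulevy chX tau0 beta0.
have cfX t : cf (distribution P X) t = levy_khintchine a Q nu t.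
  by rewrite -char_fun_distribution.
have gam0 r : 0 <= beta r / 2 by rewrite divr_ge0.
(* Applied to two measures: the law of [X] and the restriction of [nu] to the tail. *)
have moments (m : {measure set 'rV[R]_p -> \bar R}) :=
  moment_lty_weight m beta0.
have restrE : (\int[levy_restr nu tau]_x (weight (fun r => beta r / 2) 0 x)%:E =
    \int[nu]_(x in tail_set tau) (weight (fun r => beta r / 2) 0 x)%:E)%E.
  apply: ge0_integral_mrestr; last by move=> x; rewrite lee_fin weight_ge0.
  by apply/measurable_EFinP; exact: measurable_weight.
have iffX := levy_moment_iff Qquad nulevy cfX tau0 gam0.
split=> [h|/moments h al albeta].
  apply/moments; rewrite restrE; apply/iffX/moments => al /h.
  by rewrite expectation_moment.
rewrite expectation_moment; move: al albeta.
by apply/moments/iffX; rewrite -restrE.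
Qed.
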